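(* Let $\Lambda=kQ/I$ be a bound quiver algebra over a field $k$. The algebra $\Lambda$ is $\tau$-rigid as a $\Lambda$-bimodule if and only if both of the following hold: \begin{itemize} \item $\mathrm{HH}^1(\Lambda)=0$, \item $\dim_k\mathrm{HH}^2(\Lambda)=\dim_k\mathrm{Hom}_{kQ-kQ}(I/I^2,\Lambda)$. \end{itemize}
   Context: $k$ is a field. ''Algebra'' means finite dimensional associative unital $k$-algebra; modules over it are finitely generated. For an algebra $\Lambda$, $\Lambda^e=\Lambda\otimes_k\Lambda^{op}$, and $\Lambda$-bimodules are identified with left $\Lambda^e$-modules; $\mathrm{Hom}_{\Lambda-\Lambda}$, $\mathrm{Ext}_{\Lambda-\Lambda}$ denote Hom and Ext over $\Lambda^e$. $\mathrm{HH}^n(\Lambda)=\mathrm{Ext}^n_{\Lambda-\Lambda}(\Lambda,\Lambda)$ is Hochschild cohomology. Auslander-Reiten translation: $\mathsf D=\mathrm{Hom}_k(-,k)$. For an algebra $A$ and a left $A$-module $M$ with minimal projective presentation $P_1\xrightarrow{d_1}P_0\to M\to 0$, $\mathrm{Tr}\,M$ is the cokernel of $d_1^*:\mathrm{Hom}_A(P_0,A)\to\mathrm{Hom}_A(P_1,A)$ and $\tau M=\mathsf D\,\mathrm{Tr}\,M$. A left $A$-module $M$ is $\tau$-rigid if $\mathrm{Hom}_A(M,\tau M)=0$. Thus $\Lambda$ is $\tau$-rigid as a $\Lambda$-bimodule if $\mathrm{Hom}_{\Lambda-\Lambda}(\Lambda,\tau\Lambda)=0$, where $\tau\Lambda$ is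 computed with $A=\Lambda^e$ and $M=\Lambda$. A quiver $Q$ is a finite oriented graph with vertices $Q_0$, arrows $Q_1$. $kQ$ is the path algebra with basis all oriented paths (including the vertices, the paths of length $0$). $F=\langle Q_1\rangle$ is the ideal generated by the arrows. A two-sided ideal $I$ of $kQ$ is admissible if $F^n\subset I\subset F^2$ for some $n\ge 2$; then $kQ/I$ is called a bound quiver algebra. $\mathrm{Hom}_{kQ-kQ}$ denotes morphisms of $kQ$-bimodules; $I/I^2$ and $\Lambda=kQ/I$ are $kQ$-bimodules in the natural way. *)

(* Defs.v *)
From HB Require Import structures.
From mathcomp Require Import all_boot all_order all_algebra.
From mathcomp Require Import finmap.
From mathcomp Require Import boolp functions.
From mathcomp.multinomials Require Import monalg.

Set Implicit Arguments.
Unset Strict Implicit.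
Unset Printing Implicit Defensive.

Import GRing.Theory.
Local Open Scope ring_scope.
Local Open Scope quotient_scope.

(* An associative unital [k]-algebra is a ring with a central ring morphism
   from [k].  MathComp's [algType] is not used because it excludes the zero
   ring, and the path algebra of the empty quiver is zero. *)
HB.mixin Record PzRing_isPzAlgebra (k : fieldType) A of GRing.PzRing A := {
  algin : k -> A;
  algin_zmod : zmod_morphism algin;
  algin_monoid : monoid_morphism algin;
  algin_central : forall c x, algin c * x = x * algin c
}.

#[short(type="pzAlgType")]
HB.structure Definition PzAlgebra (k : fieldType) :=
  {A of GRing.PzRing A & PzRing_isPzAlgebra k A}.

Section Algin.
Variables (k : fieldType) (A : pzAlgType k).
HB.instance Definition _ := GRing.isZmodMorphism.Build k A algin algin_zmod.
HB.instance Definition _ := GRing.isMonoidMorphism.Build k A algin algin_monoid.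

Fact alginc_zmod : zmod_morphism (algin : k -> A^c).
Proof. exact: algin_zmod. Qed.
Fact alginc_monoid : monoid_morphism (algin : k -> A^c).
Proof.
split; first exact: algin_monoid.1.
by move=> x y; rewrite mulrC; exact: algin_monoid.2.
Qed.
Fact alginc_central c (x : A^c) : (algin c : A^c) * x = x * (algin c : A^c).
Proof. exact: (esym (algin_central c (x : A))). Qed.
HB.instance Definition _ := PzRing_isPzAlgebra.Build k A^c
  alginc_zmod alginc_monoid alginc_central.
End Algin.

Section ZmodQuot.
Variables (V : zmodType) (U : zmodClosed V).
Local Notation qt := (Quotient.quot U).
Definition qpi (x : V) : qt := \pi_qt x.
Definition qrepr (x : qt) : V := repr x.

Lemma qreprK : cancel qrepr qpi.
Proof. by move=> x; exact: reprK. Qed.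

Lemma qpiP x y : qpi x = qpi y <-> x - y \in (U : {pred V}).
Proof.
rewrite /qpi; split=> [/eqP|H]; first by rewrite -Quotient.idealrBE.
by apply/eqP; rewrite -Quotient.idealrBE.
Qed.

Fact qpi_zmod : zmod_morphism qpi.
Proof. by move=> x y; rewrite /qpi !piE. Qed.
HB.instance Definition _ := GRing.isZmodMorphism.Build V qt qpi qpi_zmod.

Lemma qpi0 x : qpi x = 0 <-> x \in (U : {pred V}).
Proof. by rewrite -(raddf0 qpi) qpiP subr0. Qed.

Lemma qrepr_qpi x : qrepr (qpi x) - x \in (U : {pred V}).
Proof. by apply/qpiP; rewrite qreprK. Qed.
End ZmodQuot.

Definition subzmodT (V : zmodType) (U : zmodClosed V) : Type :=
  {x : V | x \in (U : {pred V})}.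
HB.instance Definition _ (V : zmodType) (U : zmodClosed V) := SubType.on (subzmodT U).
HB.instance Definition _ (V : zmodType) (U : zmodClosed V) := Choice.on (subzmodT U).
HB.instance Definition _ (V : zmodType) (U : zmodClosed V) :=
  [SubChoice_isSubZmodule of subzmodT U by <:].

Definition submodT (R : pzRingType) (V : lmodType R) (U : submodClosed V) : Type :=
  {x : V | x \in (U : {pred V})}.
HB.instance Definition _ R (V : lmodType R) (U : submodClosed V) :=
  SubType.on (submodT U).
HB.instance Definition _ R (V : lmodType R) (U : submodClosed V) :=
  Choice.on (submodT U).
HB.instance Definition _ R (V : lmodType R) (U : submodClosed V) :=
  [SubChoice_isSubLmodule of submodT U by <:].

Section QuotMod.
Variables (R : pzRingType) (V : lmodType R) (U : submodClosed V).

(* [submodClosed] carries no closure under opposites, which [Quotient.quot]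
   requires. *)
Definition submod_zmod : {pred V} := fun x => x \in (U : {pred V}).
Fact submod_zmod_closed : zmod_closed submod_zmod.
Proof.
split=> [|x y xU yU]; first exact: (rpred0 U).
have : x + (-1) *: y \in (U : {pred V}) by rewrite rpredD ?rpredZ.
by rewrite scaleN1r.
Qed.
HB.instance Definition _ := GRing.isZmodClosed.Build V submod_zmod submod_zmod_closed.

Definition quotmod : Type := Quotient.quot submod_zmod.
HB.instance Definition _ := GRing.Zmodule.on quotmod.

Definition qscale (a : R) (x : quotmod) : quotmod := qpi submod_zmod (a *: qrepr x).

Lemma qscale_pi a x : qscale a (qpi submod_zmod x) = qpi submod_zmod (a *: x).
Proof. by apply/qpiP; rewrite -scalerBr; apply: rpredZ; exact: qrepr_qpi. Qed.

Fact qscaleA a b v : qscale a (qscale b v) = qscale (a * b) v.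
Proof. by rewrite -(qreprK v) !qscale_pi scalerA. Qed.
Fact qscale1 : left_id 1 qscale.
Proof. by move=> v; rewrite -(qreprK v) qscale_pi scale1r. Qed.
Fact qscaleDr : right_distributive qscale +%R.
Proof.
move=> a u v; rewrite -(qreprK u) -(qreprK v) -(raddfD (qpi submod_zmod)) !qscale_pi.
by rewrite scalerDr (raddfD (qpi submod_zmod)).
Qed.
Fact qscaleDl v : {morph qscale^~ v : a b / a + b}.
Proof. by move=> a b /=; rewrite -(qreprK v) !qscale_pi scalerDl (raddfD (qpi submod_zmod)). Qed.
HB.instance Definition _ := GRing.Zmodule_isLmodule.Build R quotmod
  qscaleA qscale1 qscaleDr qscaleDl.
End QuotMod.

Section KerIm.
Variables (R : pzRingType) (U V : lmodType R) (f : {linear U -> V}).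

Definition ker_pred : {pred U} := fun x => f x == 0.
Fact ker_pred_closed : subsemimod_closed ker_pred.
Proof.
split; first split.
- by rewrite unfold_in /ker_pred raddf0.
- move=> x y; rewrite !unfold_in /ker_pred => /eqP fx /eqP fy.
  by rewrite raddfD /= fx fy addr0.
- move=> a x; rewrite !unfold_in /ker_pred => /eqP fx.
  by rewrite linearZ_LR /= fx scaler0.
Qed.
HB.instance Definition _ := GRing.isSubmodClosed.Build R U ker_pred ker_pred_closed.

Definition im_pred : {pred V} := fun y => `[< exists x, f x = y >].
Fact im_pred_closed : subsemimod_closed im_pred.
Proof.
split; first split.
- by apply/asboolP; exists 0; rewrite raddf0.
- move=> x y /asboolP[u <-] /asboolP[v <-]; apply/asboolP.
  by exists (u + v); rewrite raddfD.
- by move=> a x /asboolP[u <-]; apply/asboolP; exists (a *: u); rewrite linearZ_LR.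
Qed.
HB.instance Definition _ := GRing.isSubmodClosed.Build R V im_pred im_pred_closed.
End KerIm.

HB.mixin Record isTwoSided (A : pzRingType) (S : A -> bool) := {
  idealMl : forall a x, x \in (S : {pred A}) -> a * x \in (S : {pred A});
  idealMr : forall a x, x \in (S : {pred A}) -> x * a \in (S : {pred A})
}.

#[short(type="ideal")]
HB.structure Definition TwoSidedIdeal (A : pzRingType) :=
  {S of GRing.ZmodClosed A S & isTwoSided A S}.

Definition quotalg (A : pzRingType) (I : ideal A) : Type := Quotient.quot I.

Section QuotAlg.
Variables (k : fieldType) (A : pzAlgType k) (I : ideal A).
HB.instance Definition _ := GRing.Zmodule.on (quotalg I).
Local Notation Q := (quotalg I).
Local Notation pi := (qpi I).

Definition qmul (x y : Q) : Q := pi (qrepr x * qrepr y).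

Lemma qmul_pi x y : qmul (pi x) (pi y) = pi (x * y).
Proof.
apply/qpiP; set a := qrepr _; set b := qrepr _.
have -> : a * b - x * y = (a - x) * b + x * (b - y).
  by rewrite mulrBl mulrBr addrA subrK.
apply: rpredD; first by apply: idealMr; exact: qrepr_qpi.
by apply: idealMl; exact: qrepr_qpi.
Qed.

Fact qmulA : associative qmul.
Proof.
by move=> x y z; rewrite -(qreprK x) -(qreprK y) -(qreprK z) !qmul_pi mulrA.
Qed.
Fact qmul1 : left_id (pi 1 : Q) qmul.
Proof. by move=> x; rewrite -(qreprK x) qmul_pi mul1r. Qed.
Fact qmulr1 : right_id (pi 1 : Q) qmul.
Proof. by move=> x; rewrite -(qreprK x) qmul_pi mulr1. Qed.
Fact qmulDl : left_distributive qmul +%R.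
Proof.
move=> x y z; rewrite -(qreprK x) -(qreprK y) -(qreprK z).
by rewrite -(raddfD pi) !qmul_pi mulrDl (raddfD pi).
Qed.
Fact qmulDr : right_distributive qmul +%R.
Proof.
move=> x y z; rewrite -(qreprK x) -(qreprK y) -(qreprK z).
by rewrite -(raddfD pi) !qmul_pi mulrDr (raddfD pi).
Qed.
HB.instance Definition _ := GRing.Zmodule_isPzRing.Build Q
  qmulA qmul1 qmulr1 qmulDl qmulDr.

Definition qproj (x : A) : Q := pi x.
Fact qproj_zmod : zmod_morphism qproj.
Proof. exact: qpi_zmod. Qed.
Fact qproj_monoid : monoid_morphism qproj.
Proof. by split=> [|x y]; [exact: erefl | exact: esym (qmul_pi x y)]. Qed.
HB.instance Definition _ := GRing.isZmodMorphism.Build A Q qproj qproj_zmod.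
HB.instance Definition _ := GRing.isMonoidMorphism.Build A Q qproj qproj_monoid.

Definition qalgin (c : k) : Q := qproj (algin c).
Fact qalgin_zmod : zmod_morphism qalgin.
Proof. by move=> x y; rewrite /qalgin (raddfB algin) (raddfB qproj). Qed.
Fact qalgin_monoid : monoid_morphism qalgin.
Proof. by split=> [|x y]; rewrite /qalgin ?rmorph1 ?rmorphM. Qed.
Fact qalgin_central c x : qalgin c * x = x * qalgin c.
Proof.
rewrite -(qreprK x) -[qpi _ _]/(qproj _) /qalgin.
by rewrite -!(rmorphM qproj) algin_central.
Qed.
HB.instance Definition _ := PzRing_isPzAlgebra.Build k Q
  qalgin_zmod qalgin_monoid qalgin_central.
End QuotAlg.

Section IdealOps.
Variable A : pzRingType.

Definition ideal_gen (S : A -> Prop) : {pred A} :=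
  fun x => `[< forall J : ideal A,
                 (forall s, S s -> s \in (J : {pred A})) -> x \in (J : {pred A}) >].

Section Gen.
Variable S : A -> Prop.
Fact ideal_gen_zmod : zmod_closed (ideal_gen S).
Proof.
split; first by apply/asboolP => J _; rewrite rpred0.
move=> x y /asboolP hx /asboolP hy; apply/asboolP => J hJ.
by rewrite rpredB ?hx ?hy.
Qed.
HB.instance Definition _ :=
  GRing.isZmodClosed.Build A (ideal_gen S) ideal_gen_zmod.
Fact ideal_gen_Ml a x : x \in ideal_gen S -> a * x \in ideal_gen S.
Proof. by move=> /asboolP hx; apply/asboolP => J hJ; rewrite idealMl ?hx. Qed.
Fact ideal_gen_Mr a x : x \in ideal_gen S -> x * a \in ideal_gen S.
Proof. by move=> /asboolP hx; apply/asboolP => J hJ; rewrite idealMr ?hx. Qed.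
HB.instance Definition _ :=
  isTwoSided.Build A (ideal_gen S) ideal_gen_Ml ideal_gen_Mr.
End Gen.

Definition ideal_full : ideal A := ideal_gen (fun=> True).

Definition ideal_mul (I J : ideal A) : ideal A :=
  ideal_gen (fun z => exists x y,
    [/\ x \in (I : {pred A}), y \in (J : {pred A}) & z = x * y]).

Definition ideal_pow (I : ideal A) (n : nat) : ideal A :=
  iter n (ideal_mul I) ideal_full.

Definition ideal_sub (I J : ideal A) : Prop :=
  forall x, x \in (I : {pred A}) -> x \in (J : {pred A}).
End IdealOps.

Section FreeExt.
Variables (K : choiceType) (G V : zmodType) (h : K -> G -> V).
Hypothesis hB : forall x, zmod_morphism (h x).

Definition fext (g : {malg G[K]}) : V := \sum_(x <- msupp g) h x g@_x.

Let h0 x : h x 0 = 0.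
Proof. by rewrite -[X in h x X](subrr (0 : G)) hB subrr. Qed.

Lemma fextEw (g : {malg G[K]}) (d : {fset K}) :
  (msupp g `<=` d)%fset -> fext g = \sum_(x <- d) h x g@_x.
Proof.
move=> gd; apply: big_fset_incl => // x xd xg.
by rewrite mcoeff_outdom.
Qed.

Lemma fextB : zmod_morphism fext.
Proof.
move=> f g; pose d := (msupp f `|` msupp g)%fset.
rewrite (@fextEw f d) ?fsubsetUl // (@fextEw g d) ?fsubsetUr //.
rewrite (@fextEw _ d) ?msuppB_le // -sumrB.
by apply: eq_bigr => x _; rewrite mcoeffB hB.
Qed.

Lemma fextU x c : fext << c *g x >> = h x c.
Proof. by rewrite (fextEw msuppU_le) big_seq_fset1 mcoeffUU. Qed.
End FreeExt.

Lemma zmod_morph_sum (U V : zmodType) (f : U -> V) : zmod_morphism f ->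
  forall I (r : seq I) (F : I -> U), f (\sum_(i <- r) F i) = \sum_(i <- r) f (F i).
Proof.
move=> fB I r F; have f0 : f 0 = 0 by rewrite -(subrr 0) fB subrr.
apply: (big_morph f) => // x y.
by rewrite -[y in LHS]opprK fB -[- y]sub0r fB f0 sub0r opprK.
Qed.

Lemma malg_ext (K : choiceType) (G V : zmodType) (f g : {malg G[K]} -> V) :
  zmod_morphism f -> zmod_morphism g ->
  (forall c x, f << c *g x >> = g << c *g x >>) -> f =1 g.
Proof.
move=> fB gB fg a; rewrite (monalgE a) (zmod_morph_sum fB) (zmod_morph_sum gB).
exact: eq_bigr.
Qed.

(* A semigroup whose product may be undefined ([None], to be read as zero).
   [punits] lists orthogonal local units: the last two axioms say that exactly
   one of them has a defined product with a given element, which it fixes. *)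
HB.mixin Record Choice_isPartialSemigroup S of Choice S := {
  pmul : S -> S -> option S;
  punits : seq S;
  pmulA : forall x y z,
    obind (fun u => pmul u z) (pmul x y) = obind (pmul x) (pmul y z);
  pmul_unitl : forall x, pmap (fun e => pmul e x) punits = [:: x];
  pmul_unitr : forall x, pmap (fun e => pmul x e) punits = [:: x]
}.

#[short(type="psemigroupType")]
HB.structure Definition PartialSemigroup :=
  {S of Choice S & Choice_isPartialSemigroup S}.

Definition psalg (k : fieldType) (S : psemigroupType) : Type := {malg k[S]}.

Section PSAlg.
Variables (k : fieldType) (S : psemigroupType).
HB.instance Definition _ := GRing.Zmodule.on (psalg k S).
Implicit Types (f g h : psalg k S) (x y z : S) (c d e : k).

Definition ps_term c (o : option S) : psalg k S :=
  if o is Some x then << c *g x >> else 0.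

Definition ps_mul f g : psalg k S :=
  \sum_(x <- msupp f) \sum_(y <- msupp g) ps_term (f@_x * g@_y) (pmul x y).

Definition ps_scalar c : psalg k S := \sum_(e <- punits) << c *g e >>.

Lemma ps_termB o : zmod_morphism (ps_term^~ o).
Proof. by case: o => [x|] c d /=; rewrite ?subr0 ?monalgUB. Qed.

Lemma ps_mulBr f : zmod_morphism (ps_mul f).
Proof.
move=> g h; rewrite /ps_mul -sumrB; apply: eq_bigr => x _.
apply: (fextB (h := fun y d => ps_term (f@_x * d) (pmul x y))) => y c d.
by rewrite mulrBr ps_termB.
Qed.

Lemma ps_mulBl g : zmod_morphism (ps_mul^~ g).
Proof.
move=> f h /=.
apply: (fextB (h := fun x c => \sum_(y <- msupp g) ps_term (c * g@_y) (pmul x y))).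
move=> x c d; rewrite -sumrB; apply: eq_bigr => y _.
by rewrite mulrBl ps_termB.
Qed.

Lemma ps_mul0 f : ps_mul f 0 = 0.
Proof. by have := ps_mulBr f 0 0; rewrite !subrr. Qed.

Lemma ps_0mul f : ps_mul 0 f = 0.
Proof. by have := ps_mulBl f 0 0; rewrite !subrr. Qed.

Lemma ps_mulUU c x d y :
  ps_mul << c *g x >> << d *g y >> = ps_term (c * d) (pmul x y).
Proof.
rewrite /ps_mul.
rewrite -/(fext (fun x c => \sum_(y0 <- msupp (<< d *g y >> : {malg k[S]}))
  ps_term (c * (<< d *g y >> : {malg k[S]})@_y0) (pmul x y0)) _).
have tB u v : zmod_morphism (fun a => ps_term (u * a) v).
  by move=> a b; rewrite mulrBr ps_termB.
rewrite fextU; first by apply: (fextU (h := fun y d => ps_term (c * d) (pmul x y))).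
move=> z a b; rewrite -sumrB; apply: eq_bigr => w _.
by rewrite mulrBl ps_termB.
Qed.

Lemma ps_mulUr f c d x o : f = ps_term c o ->
  ps_mul f << d *g x >> = ps_term (c * d) (obind (fun u => pmul u x) o).
Proof.
move=> ->; case: o => [y|] /=; first exact: ps_mulUU.
exact: ps_0mul.
Qed.

Lemma ps_mulUl f c d x o : f = ps_term c o ->
  ps_mul << d *g x >> f = ps_term (d * c) (obind (pmul x) o).
Proof.
move=> ->; case: o => [y|] /=; first exact: ps_mulUU.
exact: ps_mul0.
Qed.

Fact ps_mulA : associative ps_mul.
Proof.
move=> f g h; move: f; apply: malg_ext.
- by move=> a b; rewrite ps_mulBl.
- by move=> a b; rewrite !ps_mulBl.
move=> c x; move: g; apply: malg_ext.
- by move=> a b; rewrite ps_mulBl ps_mulBr.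
- by move=> a b; rewrite ps_mulBr ps_mulBl.
move=> d y; move: h; apply: malg_ext.
- by move=> a b; rewrite !ps_mulBr.
- by move=> a b; rewrite ps_mulBr.
move=> e z; rewrite (ps_mulUl _ _ (ps_mulUU _ _ _ _)).
by rewrite (ps_mulUr _ _ (ps_mulUU _ _ _ _)) mulrA pmulA.
Qed.

Lemma sum_ps_term c (T : Type) (F : T -> option S) (s : seq T) :
  \sum_(i <- s) ps_term c (F i) = \sum_(x <- pmap F s) << c *g x >>.
Proof.
elim: s => [|a s IH]; first by rewrite !big_nil.
by rewrite big_cons /= IH; case: (F a) => [x|] /=; rewrite ?big_cons ?add0r.
Qed.

Lemma ps_scalarMU c d x : ps_mul (ps_scalar c) << d *g x >> = << c * d *g x >>.
Proof.
rewrite (zmod_morph_sum (@ps_mulBl _)).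
under eq_bigr => e _ do rewrite ps_mulUU.
by rewrite sum_ps_term pmul_unitl big_seq1.
Qed.

Lemma ps_scalarUM c d x : ps_mul << d *g x >> (ps_scalar c) = << d * c *g x >>.
Proof.
rewrite (zmod_morph_sum (@ps_mulBr _)).
under eq_bigr => e _ do rewrite ps_mulUU.
by rewrite sum_ps_term pmul_unitr big_seq1.
Qed.

Fact ps_mul1l : left_id (ps_scalar 1) ps_mul.
Proof.
apply: malg_ext => [|//|c x]; first exact: ps_mulBr.
by rewrite ps_scalarMU mul1r.
Qed.

Fact ps_mul1r : right_id (ps_scalar 1) ps_mul.
Proof.
apply: malg_ext => [|//|c x]; first exact: ps_mulBl.
by rewrite ps_scalarUM mulr1.
Qed.

Fact ps_mulDl : left_distributive ps_mul +%R.
Proof.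
move=> f g h; have := ps_mulBl h (f + g) g; rewrite /= addrK => ->.
by rewrite subrK.
Qed.

Fact ps_mulDr : right_distributive ps_mul +%R.
Proof.
move=> f g h; have := ps_mulBr f (g + h) h; rewrite /= addrK => ->.
by rewrite subrK.
Qed.

HB.instance Definition _ := GRing.Zmodule_isPzRing.Build (psalg k S)
  ps_mulA ps_mul1l ps_mul1r ps_mulDl ps_mulDr.

Fact ps_scalar_zmod : zmod_morphism ps_scalar.
Proof.
by move=> c d; rewrite /ps_scalar -sumrB; apply: eq_bigr => x _; rewrite monalgUB.
Qed.
Fact ps_scalar_monoid : monoid_morphism ps_scalar.
Proof.
split=> // c d; rewrite -[RHS]/(ps_mul _ _) [in RHS]/ps_scalar.
rewrite (zmod_morph_sum (@ps_mulBr _)).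
by apply: eq_bigr => x _; rewrite ps_scalarMU.
Qed.
Fact ps_scalar_central c f : ps_scalar c * f = f * ps_scalar c.
Proof.
move: f; apply: malg_ext => [||d x]; [exact: ps_mulBr|exact: ps_mulBl|].
rewrite -[LHS]/(ps_mul _ _) -[RHS]/(ps_mul _ _).
by rewrite ps_scalarMU ps_scalarUM mulrC.
Qed.
HB.instance Definition _ := PzRing_isPzAlgebra.Build k (psalg k S)
  ps_scalar_zmod ps_scalar_monoid ps_scalar_central.

Definition ps_elt (x : S) : psalg k S := << x >>.
End PSAlg.

Record quiver := Quiver {
  vertex : finType;
  arrow : finType;
  source : arrow -> vertex;
  target : arrow -> vertex
}.

Section Path.
Variable Q : quiver.

Fixpoint is_path (v : vertex Q) (s : seq (arrow Q)) : bool :=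
  if s is a :: s' then (source a == v) && is_path (target a) s' else true.

Fixpoint path_end (v : vertex Q) (s : seq (arrow Q)) : vertex Q :=
  if s is a :: s' then path_end (target a) s' else v.

(* A path is its initial vertex with the sequence of arrows it traverses, the
   first arrow coming first; empty sequences give the paths of length 0. *)
Definition qpath : Type :=
  {p : vertex Q * seq (arrow Q) | is_path p.1 p.2}.
HB.instance Definition _ := SubType.on qpath.
HB.instance Definition _ := Choice.on qpath.

Definition vertex_path (v : vertex Q) : qpath :=
  exist (fun p => is_path p.1 p.2) (v, [::]) isT.

Lemma arrow_is_path (a : arrow Q) : is_path (source a) [:: a].
Proof. by rewrite /= eqxx. Qed.

Definition arrow_path (a : arrow Q) : qpath :=
  exist (fun p => is_path p.1 p.2) (source a, [:: a]) (arrow_is_path a).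

(* The product [p q] is "first p, then q"; the opposite convention gives the
   opposite algebra. *)
Definition path_comp (p q : qpath) : option qpath :=
  if path_end (val p).1 (val p).2 == (val q).1
  then insub ((val p).1, (val p).2 ++ (val q).2) else None.

Lemma is_path_cat v s t :
  is_path v (s ++ t) = is_path v s && is_path (path_end v s) t.
Proof. by elim: s v => //= a s IH v; rewrite IH andbA. Qed.

Lemma path_end_cat v s t : path_end v (s ++ t) = path_end (path_end v s) t.
Proof. by elim: s v => //= a s IH v; rewrite IH. Qed.

Lemma path_compP p q r : path_comp p q = Some r <->
  path_end (val p).1 (val p).2 = (val q).1
  /\ val r = ((val p).1, (val p).2 ++ (val q).2).
Proof.
rewrite /path_comp; case: eqP => [pq|pq]; last by split=> [//|[]].
have pqP : is_path (val p).1 ((val p).2 ++ (val q).2).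
  by rewrite is_path_cat pq (valP p) (valP q).
rewrite insubT /=; split=> [[<-]//|[_ rE]].
by congr Some; apply: val_inj.
Qed.

Fact path_compA (p q r : qpath) :
  obind (fun u => path_comp u r) (path_comp p q)
  = obind (path_comp p) (path_comp q r).
Proof.
have sym (o o' : option qpath) :
    (forall s, o = Some s -> o' = Some s) ->
    (forall s, o' = Some s -> o = Some s) -> o = o'.
  case: o o' => [s|] [s'|] // H H'; first by rewrite (H s).
    by have := H s erefl.
  by have := H' s' erefl.
apply: sym => s.
- case pq : (path_comp p q) => [u|] //= /path_compP[ur sE].
  move: pq => /path_compP[pq uE]; rewrite uE /= in ur sE.
  rewrite path_end_cat pq in ur.
  have qrP : is_path (val q).1 ((val q).2 ++ (val r).2).
    by rewrite is_path_cat ur (valP q) (valP r).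
  pose w : qpath := exist (fun p => is_path p.1 p.2) (_, _) qrP.
  have -> : path_comp q r = Some w by apply/path_compP.
  by apply/path_compP; split=> //=; rewrite sE catA.
- case qr : (path_comp q r) => [u|] //= /path_compP[pu sE].
  move: qr => /path_compP[qr uE]; rewrite uE /= in pu sE.
  have pqP : is_path (val p).1 ((val p).2 ++ (val q).2).
    by rewrite is_path_cat pu (valP p) (valP q).
  pose w : qpath := exist (fun p => is_path p.1 p.2) (_, _) pqP.
  have -> : path_comp p q = Some w by apply/path_compP.
  by apply/path_compP; split; rewrite /= ?path_end_cat ?pu // sE catA.
Qed.

Definition vertex_paths : seq qpath := [seq vertex_path v | v <- enum (vertex Q)].

Lemma pmap_pred1 (T : eqType) (U : Type) (s : seq T) (x : T) (y : U) :
  uniq s -> x \in s -> pmap (fun z => if z == x then Some y else None) s = [:: y].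
Proof.
elim: s => //= z s IH /andP[zs us]; rewrite inE eq_sym.
case: eqP => [zx _|_ /= xs]; last exact: IH.
rewrite /=; congr cons; move: zs; rewrite {}zx.
elim: s {IH us} => //= w s IH; rewrite inE negb_or => /andP[xw xs].
by rewrite eq_sym (negPf xw) /=; exact: IH.
Qed.

Fact vertex_paths_unitl p : pmap (fun e => path_comp e p) vertex_paths = [:: p].
Proof.
rewrite -(@pmap_pred1 _ _ _ (val p).1 p (enum_uniq (vertex Q))) ?mem_enum //.
rewrite /vertex_paths; elim: (enum _) => //= v s ->.
rewrite {1}/path_comp /=; case: eqP => [->|//] /=.
by rewrite -surjective_pairing valK.
Qed.

Fact vertex_paths_unitr p : pmap (fun e => path_comp p e) vertex_paths = [:: p].
Proof.
rewrite -(@pmap_pred1 _ _ _ (path_end (val p).1 (val p).2) p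
  (enum_uniq (vertex Q))) ?mem_enum //.
rewrite /vertex_paths; elim: (enum _) => //= v s ->.
rewrite {1}/path_comp /= eq_sym; case: eqP => [_|//] /=.
by rewrite cats0 -surjective_pairing valK.
Qed.

HB.instance Definition _ := Choice_isPartialSemigroup.Build qpath
  path_compA vertex_paths_unitl vertex_paths_unitr.
End Path.

Definition pathalg (k : fieldType) (Q : quiver) : pzAlgType k := psalg k (qpath Q).

Definition arrow_ideal (k : fieldType) (Q : quiver) : ideal (pathalg k Q) :=
  ideal_gen (fun x : pathalg k Q => exists a : arrow Q, x = ps_elt k (arrow_path a)).

Definition admissible (k : fieldType) (Q : quiver) (I : ideal (pathalg k Q)) : Prop :=
  exists2 n, (2 <= n)%N &
    ideal_sub (ideal_pow (arrow_ideal k Q) n) I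
    /\ ideal_sub I (ideal_pow (arrow_ideal k Q) 2).

Definition pairmon (A B : pzRingType) : Type := (A * B)%type.

Section PairMon.
Variables A B : pzRingType.
HB.instance Definition _ := Choice.on (pairmon A B).
Definition pm_mul (x y : pairmon A B) : option (pairmon A B) :=
  Some (x.1 * y.1, x.2 * y.2).
Fact pm_mulA x y z :
  obind (fun u => pm_mul u z) (pm_mul x y) = obind (pm_mul x) (pm_mul y z).
Proof. by rewrite /pm_mul /= !mulrA. Qed.
Fact pm_mul1l (x : pairmon A B) : pmap (fun e => pm_mul e x) [:: (1, 1)] = [:: x].
Proof. by case: x => a b; rewrite /pm_mul /= !mul1r. Qed.
Fact pm_mul1r (x : pairmon A B) : pmap (fun e => pm_mul x e) [:: (1, 1)] = [:: x].
Proof. by case: x => a b; rewrite /pm_mul /= !mulr1. Qed.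
HB.instance Definition _ := Choice_isPartialSemigroup.Build (pairmon A B)
  pm_mulA pm_mul1l pm_mul1r.
End PairMon.

Section Tensor.
Variables (k : fieldType) (A B : pzAlgType k).
Local Notation F := (psalg k (pairmon A B)).

Definition free_pair (a : A) (b : B) : F := ps_elt k ((a, b) : pairmon A B).

Variant tensor_rel : F -> Prop :=
| TensorDl a a' b :
    tensor_rel (free_pair (a + a') b - (free_pair a b + free_pair a' b))
| TensorDr a b b' :
    tensor_rel (free_pair a (b + b') - (free_pair a b + free_pair a b'))
| TensorZl c a b :
    tensor_rel (free_pair (algin c * a) b - algin c * free_pair a b)
| TensorZr c a b :
    tensor_rel (free_pair a (algin c * b) - algin c * free_pair a b).

(* The tensor product of algebras is the semigroup algebra of [A * B] modulo
   bilinearity, so that (a # b) (a' # b') = a a' # b b'.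
   A multiple [free_pair a0 b0 * r * free_pair a1 b1] of a relation [r] is again
   a relation, so the ideal generated by the relations is their linear span. *)
Definition tensor : pzAlgType k := quotalg (ideal_gen tensor_rel).

Definition tensor_pure (a : A) (b : B) : tensor := qproj _ (free_pair a b).
End Tensor.

Definition envalg (k : fieldType) (A : pzAlgType k) : pzAlgType k := tensor A A^c.

(* [ract a v] is the product of [v] by [a] on the right; the last axiom says that
   [k] acts in the same way on both sides. *)
HB.mixin Record Zmodule_isBimodule (k : fieldType) (A : pzAlgType k) V
    of GRing.Zmodule V := {
  lact : A -> V -> V;
  ract : A -> V -> V;
  lactA : forall a b v, lact a (lact b v) = lact (a * b) v;
  lact1 : forall v, lact 1 v = v;
  lactDr : forall a, {morph lact a : u v / u + v};
  lactDl : forall v, {morph lact^~ v : a b / a + b};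
  ractA : forall a b v, ract b (ract a v) = ract (a * b) v;
  ract1 : forall v, ract 1 v = v;
  ractDr : forall a, {morph ract a : u v / u + v};
  ractDl : forall v, {morph ract^~ v : a b / a + b};
  lractC : forall a b v, lact a (ract b v) = ract b (lact a v);
  lract_algin : forall c v, lact (algin c) v = ract (algin c) v
}.

#[short(type="bimodType")]
HB.structure Definition Bimodule (k : fieldType) (A : pzAlgType k) :=
  {V of GRing.Zmodule V & Zmodule_isBimodule k A V}.

Lemma morphD_zmod (U V : zmodType) (f : U -> V) :
  {morph f : x y / x + y} -> zmod_morphism f.
Proof. by move=> fD x y; apply: (addIr (f y)); rewrite -fD !subrK. Qed.

(* The same additive group as a left module over [envalg A], where the pure
   tensor of [a] and [b] maps [v] to [a v b] (lemma [env_pureE]). *)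
Definition env (k : fieldType) (A : pzAlgType k) (V : bimodType A) : Type := V.

Section Env.
Variables (k : fieldType) (A : pzAlgType k) (V : bimodType A).
Local Notation F := (psalg k (pairmon A A^c)).
Implicit Types (f g : F) (v w : V).

Let lB a := morphD_zmod (lactDr (s := V) a).
Let rB a := morphD_zmod (ractDr (s := V) a).
Let lBl v := morphD_zmod (lactDl (s := V) v).
Let rBl v := morphD_zmod (ractDl (s := V) v).

Definition pair_act (c : k) (x : pairmon A A^c) (v : V) : V :=
  lact (algin c) (lact x.1 (ract (x.2 : A) v)).

Definition free_act f v : V := \sum_(x <- msupp f) pair_act f@_x x v.

Lemma pair_actBr c x : zmod_morphism (pair_act c x).
Proof. by move=> v w; rewrite /pair_act rB !lB. Qed.
Lemma pair_actBl x v : zmod_morphism (fun c => pair_act c x v).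
Proof. by move=> c d; rewrite /pair_act raddfB lBl. Qed.

Lemma free_actBr f : zmod_morphism (free_act f).
Proof.
move=> v w; rewrite /free_act -sumrB; apply: eq_bigr => x _.
exact: pair_actBr.
Qed.
Lemma free_actBl v : zmod_morphism (free_act^~ v).
Proof.
move=> f g; apply: (fextB (h := fun x c => pair_act c x v)) => x.
exact: pair_actBl.
Qed.
Lemma free_actU c x v : free_act << c *g x >> v = pair_act c x v.
Proof.
apply: (fextU (h := fun x c => pair_act c x v)) => y.
exact: pair_actBl.
Qed.

Lemma pair_actA c d (x y : pairmon A A^c) v :
  pair_act c x (pair_act d y v)
  = pair_act (c * d) ((x.1 * y.1, x.2 * y.2) : pairmon A A^c) v.
Proof.
rewrite /pair_act /= -!lractC !lactA -ractA; congr lact.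
by rewrite rmorphM -!mulrA; congr (_ * _); rewrite !mulrA algin_central.
Qed.

Lemma free_actM f g v : free_act (f * g) v = free_act f (free_act g v).
Proof.
move: f; apply: malg_ext.
- by move=> f f'; rewrite mulrBl free_actBl.
- by move=> f f'; rewrite free_actBl.
move=> c x; move: g; apply: malg_ext.
- by move=> g g'; rewrite mulrBr free_actBl.
- by move=> g g'; rewrite free_actBl free_actBr.
move=> d y; have -> : (<< c *g x >> : F) * (<< d *g y >> : F)
    = << c * d *g ((x.1 * y.1, x.2 * y.2) : pairmon A A^c) >>.
  exact: ps_mulUU.
rewrite [LHS]free_actU [RHS]free_actU -pair_actA; congr pair_act.
by rewrite [RHS]free_actU.
Qed.

Lemma free_act0 f : free_act f 0 = 0.
Proof. by have := free_actBr f 0 0; rewrite !subrr. Qed.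

Lemma free_act_scalar c v : free_act (algin c) v = lact (algin c) v.
Proof.
rewrite -[X in free_act X]/(ps_scalar _ c) /ps_scalar big_seq1 free_actU.
by rewrite /pair_act /= lact1 ract1.
Qed.

Lemma free_act_pair a (b : A) v : free_act (free_pair a (b : A^c)) v = lact a (ract b v).
Proof. by rewrite /free_pair /ps_elt free_actU /pair_act rmorph1 lact1. Qed.

Definition annih : {pred F} := fun f => `[< forall v, free_act f v = 0 >].
Fact annih_zmod : zmod_closed annih.
Proof.
split=> [|f g /asboolP f0 /asboolP g0]; apply/asboolP => v.
  by have := free_actBl v 0 0; rewrite /= !subrr.
by rewrite free_actBl f0 g0 subrr.
Qed.
HB.instance Definition _ := GRing.isZmodClosed.Build F annih annih_zmod.
Fact annih_Ml f g : g \in annih -> f * g \in annih.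
Proof. by move=> /asboolP g0; apply/asboolP => v; rewrite free_actM g0 free_act0. Qed.
Fact annih_Mr f g : g \in annih -> g * f \in annih.
Proof. by move=> /asboolP g0; apply/asboolP => v; rewrite free_actM g0. Qed.
HB.instance Definition _ := isTwoSided.Build F annih annih_Ml annih_Mr.

Lemma tensor_rel_annih f : tensor_rel f -> f \in annih.
Proof.
have actD v : {morph free_act^~ v : f g / f + g}.
  move=> h h' /=; apply: (addIr (- free_act h' v)).
  by rewrite -free_actBl !addrK.
move=> fR; apply/asboolP => v; case: {f}fR => [a a' b|a b b'|c a b|c a b].
- rewrite free_actBl actD.
  rewrite [X in X - _]free_act_pair [X in _ - (X + _)]free_act_pair.
  rewrite [X in _ - (_ + X)]free_act_pair.
  by rewrite lactDl subrr.
- rewrite free_actBl actD.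
  rewrite [X in X - _]free_act_pair [X in _ - (X + _)]free_act_pair.
  rewrite [X in _ - (_ + X)]free_act_pair.
  by rewrite ractDl lactDr subrr.
- rewrite free_actBl free_actM free_act_scalar.
  rewrite [X in X - _]free_act_pair [X in _ - lact _ X]free_act_pair.
  by rewrite lactA subrr.
rewrite free_actBl free_actM free_act_scalar.
rewrite [X in X - _]free_act_pair [X in _ - lact _ X]free_act_pair.
have -> : (algin c * b : A^c) = (algin c : A) * (b : A).
  by rewrite algin_central.
by rewrite -ractA -lract_algin -lractC !lactA algin_central subrr.
Qed.

Lemma free_act_eq f g v :
  f - g \in (ideal_gen (@tensor_rel k A A^c) : {pred F}) -> free_act f v = free_act g v.
Proof.
move=> /asboolP /(_ annih) /(_ tensor_rel_annih) /asboolP /(_ v).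
by rewrite free_actBl => /eqP; rewrite subr_eq0 => /eqP.
Qed.

HB.instance Definition _ := GRing.Zmodule.on (env V).

Definition env_scale (t : envalg A) (v : env V) : env V := free_act (qrepr t) v.

Lemma env_scale_proj f v : env_scale (qproj _ f) v = free_act f v.
Proof. by apply: free_act_eq; exact: qrepr_qpi. Qed.

Fact env_scaleA s t v : env_scale s (env_scale t v) = env_scale (s * t) v.
Proof.
rewrite -(qreprK s) -(qreprK t) -![qpi _ _]/(qproj _ _) -rmorphM.
by rewrite !env_scale_proj free_actM.
Qed.
Fact env_scale1 : left_id 1 env_scale.
Proof.
move=> v; rewrite -[LHS]/(env_scale (qproj _ 1) v) env_scale_proj.
rewrite -[X in free_act X](rmorph1 (algin : k -> F)) free_act_scalar.
by rewrite rmorph1 lact1.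
Qed.
Fact env_scaleDr : right_distributive env_scale +%R.
Proof.
move=> t u v; apply: (addIr (- env_scale t v)).
by rewrite -[LHS]free_actBr !addrK.
Qed.
Fact env_scaleDl v : {morph env_scale^~ v : s t / s + t}.
Proof.
move=> s t /=; rewrite -(qreprK s) -(qreprK t) -![qpi _ _]/(qproj _ _).
rewrite -(raddfD (qproj _)) !env_scale_proj.
set f := qrepr s; set g := qrepr t.
by apply: (addIr (- free_act g v)); rewrite -free_actBl !addrK.
Qed.
HB.instance Definition _ := GRing.Zmodule_isLmodule.Build (envalg A) (env V)
  env_scaleA env_scale1 env_scaleDr env_scaleDl.

Lemma env_pureE (a b : A) (v : env V) :
  tensor_pure a (b : A^c) *: v = lact a (ract b (v : V)).
Proof. exact: etrans (env_scale_proj _ _) (free_act_pair _ _ _). Qed.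
End Env.

Definition bireg (A : Type) : Type := A.

Section Bireg.
Variables (k : fieldType) (A : pzAlgType k).
HB.instance Definition _ := GRing.Zmodule.on (bireg A).
Let birA (a b : A) (v : bireg A) : (v : A) * a * b = (v : A) * (a * b).
Proof. by rewrite mulrA. Qed.
Let bilA (a b : A) (v : bireg A) : a * (b * (v : A)) = a * b * (v : A).
Proof. exact: mulrA. Qed.
Let bilr (a b : A) (v : bireg A) : a * ((v : A) * b) = a * (v : A) * b.
Proof. exact: mulrA. Qed.
HB.instance Definition _ := Zmodule_isBimodule.Build k A (bireg A)
  bilA (@mul1r A) (@mulrDr A) (fun v a b => mulrDl a b v)
  birA (@mulr1 A) (fun a u v => mulrDl u v a) (fun v a b => mulrDr v a b)
  bilr (@algin_central k A).
End Bireg.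

Definition regenv (k : fieldType) (A : pzAlgType k) : lmodType (envalg A) :=
  env (bireg A).

(* Restriction of scalars to the base field. *)
Definition restr (k : fieldType) (A : pzAlgType k) (M : lmodType A) : Type := M.

Section Restr.
Variables (k : fieldType) (A : pzAlgType k) (M : lmodType A).
HB.instance Definition _ := GRing.Zmodule.on (restr M).
Definition restr_scale (c : k) (v : restr M) : restr M := (algin c : A) *: (v : M).
Fact restr_scaleA c d v : restr_scale c (restr_scale d v) = restr_scale (c * d) v.
Proof. by rewrite /restr_scale scalerA -(rmorphM algin). Qed.
Fact restr_scale1 : left_id 1 restr_scale.
Proof. by move=> v; rewrite /restr_scale (rmorph1 algin) scale1r. Qed.
Fact restr_scaleDr : right_distributive restr_scale +%R.
Proof. by move=> c u v; exact: scalerDr. Qed.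
Fact restr_scaleDl v : {morph restr_scale^~ v : c d / c + d}.
Proof. by move=> c d; rewrite /restr_scale (raddfD algin) scalerDl. Qed.
HB.instance Definition _ := GRing.Zmodule_isLmodule.Build k (restr M)
  restr_scaleA restr_scale1 restr_scaleDr restr_scaleDl.
End Restr.

(* [homA M N] is the [k]-vector space of [A]-linear maps. *)
Section HomA.
Variables (k : fieldType) (A : pzAlgType k) (M N : lmodType A).

Definition hom_pred : {pred M -> restr N} :=
  fun f => `[< linear (f : M -> N) >].
Fact hom_pred_closed : subsemimod_closed hom_pred.
Proof.
split; first split.
- by apply/asboolP => a x y; rewrite scaler0 addr0.
- move=> f g /asboolP fL /asboolP gL; apply/asboolP => a x y.
  rewrite -[LHS]/((f (a *: x + y) : N) + (g (a *: x + y) : N)) fL gL.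
  by rewrite addrACA -scalerDr.
- move=> c f /asboolP fL; apply/asboolP => a x y.
  rewrite -[LHS]/((algin c : A) *: (f (a *: x + y) : N)) fL scalerDr.
  by rewrite scalerA algin_central -scalerA.
Qed.
HB.instance Definition _ :=
  GRing.isSubmodClosed.Build k (M -> restr N) hom_pred hom_pred_closed.

Definition homA : lmodType k := submodT hom_pred.

Definition hom_fun (f : homA) : M -> N := val f.
Fact hom_fun_linear (f : homA) : linear (hom_fun f).
Proof. exact/asboolP/(valP f). Qed.
HB.instance Definition _ (f : homA) :=
  GRing.isLinear.Build A M N *:%R (hom_fun f) (hom_fun_linear f).
End HomA.

Section HomPrecomp.
Variables (k : fieldType) (A : pzAlgType k) (M M' N : lmodType A).
Variable d : {linear M' -> M}.

Fact hom_precomp_subproof (f : homA M N) :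
  ((val f \o d : M' -> restr N) \in @hom_pred k A M' N).
Proof.
by apply/asboolP => a x y; rewrite /= linearP; have /asboolP fL := valP f; exact: fL.
Qed.
Definition hom_precomp (f : homA M N) : homA M' N :=
  Sub (val f \o d : M' -> restr N) (hom_precomp_subproof f).
Fact hom_precomp_linear : linear hom_precomp.
Proof. by move=> c f g; apply: val_inj; apply/funext. Qed.
HB.instance Definition _ :=
  GRing.isLinear.Build k (homA M N) (homA M' N) *:%R hom_precomp hom_precomp_linear.
End HomPrecomp.

Section Modules.
Variables (k : fieldType) (A : pzAlgType k).
Implicit Types (M N P : lmodType A).

Definition fin_gen M : Prop :=
  exists n (g : 'I_n -> M), forall x, exists c : 'I_n -> A, x = \sum_i c i *: g i.

Definition projective P : Prop :=
  forall (X Y : lmodType A) (g : {linear X -> Y}) (f : {linear P -> Y}),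
    (forall y, exists x, g x = y) ->
    exists h : {linear P -> X}, forall p, g (h p) = f p.

Definition superfluous M (K : submodClosed M) : Prop :=
  forall N : submodClosed M,
    (forall x, exists y z, [/\ y \in (K : {pred M}), z \in (N : {pred M}) & x = y + z]) ->
    forall x, x \in (N : {pred M}).

(* Minimality: [P0 -> M] and [P1 -> ker d0] are projective covers. *)
Record min_proj_pres M (P1 P0 : lmodType A)
    (d1 : {linear P1 -> P0}) (d0 : {linear P0 -> M}) : Prop := {
  mpp_fg0 : fin_gen P0;
  mpp_fg1 : fin_gen P1;
  mpp_proj0 : projective P0;
  mpp_proj1 : projective P1;
  mpp_surj : forall x, exists y, d0 y = x;
  mpp_exact : forall x, d0 x = 0 <-> exists y, d1 y = x;
  mpp_min0 : superfluous (ker_pred d0);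
  mpp_min1 : superfluous (ker_pred d1)
}.
End Modules.

(* [rdual P] is Hom_A(P, A), a right A-module by (f b)(x) = f x * b. *)
Definition rdual (k : fieldType) (A : pzAlgType k) (P : lmodType A) : Type :=
  homA P A^o.

Section RDual.
Variables (k : fieldType) (A : pzAlgType k).

Section RDualModule.
Variable P : lmodType A.
HB.instance Definition _ := GRing.Zmodule.on (rdual P).

Fact rdual_scale_subproof (b : A) (f : rdual P) :
  (fun x => (hom_fun f x : A) * b) \in @hom_pred k A P A^o.
Proof.
apply/asboolP => a x y; rewrite linearP.
by rewrite -[RHS]/(a * ((hom_fun f x : A) * b) + (hom_fun f y : A) * b)
  mulrA -mulrDl.
Qed.
Definition rdual_scale (b : A^c) (f : rdual P) : rdual P :=
  (Sub ((fun x => (hom_fun f x : A) * (b : A)) : P -> restr A^o)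
    (rdual_scale_subproof b f) : submodT (@hom_pred k A P A^o)).

Lemma rdualP (f g : rdual P) : hom_fun f =1 hom_fun g -> f = g.
Proof. by move=> fg; apply/val_inj/funext. Qed.

Lemma rdual_scaleE b f x : hom_fun (rdual_scale b f) x = (hom_fun f x : A) * (b : A).
Proof. by []. Qed.
Lemma rdual_addE (f g : rdual P) x : hom_fun (f + g) x = hom_fun f x + hom_fun g x.
Proof. by []. Qed.

Fact rdual_scaleA b c f :
  rdual_scale b (rdual_scale c f) = rdual_scale (b * c) f.
Proof. by apply: rdualP => x; rewrite !rdual_scaleE -mulrA. Qed.
Fact rdual_scale1 : left_id 1 rdual_scale.
Proof. by move=> f; apply: rdualP => x; rewrite rdual_scaleE mulr1. Qed.
Fact rdual_scaleDr : right_distributive rdual_scale +%R.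
Proof.
move=> b f g; apply: rdualP => x.
by rewrite rdual_scaleE !rdual_addE !rdual_scaleE mulrDl.
Qed.
Fact rdual_scaleDl f : {morph rdual_scale^~ f : b c / b + c}.
Proof.
move=> b c; apply: rdualP => x.
by rewrite rdual_addE !rdual_scaleE mulrDr.
Qed.
HB.instance Definition _ := GRing.Zmodule_isLmodule.Build A^c (rdual P)
  rdual_scaleA rdual_scale1 rdual_scaleDr rdual_scaleDl.
End RDualModule.

Variables (P1 P0 : lmodType A) (d : {linear P1 -> P0}).

Definition rdual_map (f : rdual P0) : rdual P1 := hom_precomp d f.
Fact rdual_map_linear : linear rdual_map.
Proof. by move=> c f g; apply: rdualP. Qed.
HB.instance Definition _ :=
  GRing.isLinear.Build A^c (rdual P0) (rdual P1) *:%R rdual_map rdual_map_linear.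

Definition transpose_of : lmodType A^c := quotmod (im_pred rdual_map).
End RDual.

(* [kdual C] is Hom_k(C, k) for a right A-module [C], with (a phi)(x) = phi (x a). *)
Section KDual.
Variables (k : fieldType) (A : pzAlgType k) (C : lmodType A^c).

Definition kdual_pred : {pred restr C -> k^o} := fun phi => `[< linear phi >].
Fact kdual_pred_closed : subsemimod_closed kdual_pred.
Proof.
split; first split.
- by apply/asboolP => a x y; rewrite scaler0 addr0.
- move=> f g /asboolP fL /asboolP gL; apply/asboolP => a x y.
  rewrite -[LHS]/((f (a *: x + y) : k^o) + (g (a *: x + y) : k^o)) fL gL.
  by rewrite addrACA -scalerDr.
- move=> c f /asboolP fL; apply/asboolP => a x y.
  rewrite -[LHS]/(c * f (a *: x + y)) fL mulrDr.
  by rewrite -[_ *: _ in LHS]/(a * f x) mulrCA.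
Qed.
HB.instance Definition _ :=
  GRing.isSubmodClosed.Build k (restr C -> k^o) kdual_pred kdual_pred_closed.

Definition kdual : Type := submodT kdual_pred.
HB.instance Definition _ := GRing.Zmodule.on kdual.

Fact kdual_scale_subproof (a : A) (phi : kdual) :
  (fun x : restr C => (val phi : restr C -> k^o) ((a : A^c) *: (x : C))) \in kdual_pred.
Proof.
have /asboolP pL := valP phi; apply/asboolP => c x y.
rewrite -pL; congr (val phi _).
rewrite -[c *: _ in RHS]/(restr_scale _ _) /restr_scale scalerA.
rewrite -[c *: x in LHS]/((algin c : A^c) *: (x : C)) scalerDr scalerA.
by rewrite -algin_central.
Qed.
Definition kdual_scale (a : A) (phi : kdual) : kdual :=
  Sub (fun x : restr C => (val phi : restr C -> k^o) ((a : A^c) *: (x : C)))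
    (kdual_scale_subproof a phi).

Fact kdual_scaleA a b phi :
  kdual_scale a (kdual_scale b phi) = kdual_scale (a * b) phi.
Proof.
by apply: val_inj; apply/funext => x; rewrite /= scalerA.
Qed.
Fact kdual_scale1 : left_id 1 kdual_scale.
Proof. by move=> phi; apply: val_inj; apply/funext => x; rewrite /= scale1r. Qed.
Fact kdual_scaleDr : right_distributive kdual_scale +%R.
Proof. by move=> a f g; apply: val_inj; apply/funext. Qed.
Fact kdual_scaleDl phi : {morph kdual_scale^~ phi : a b / a + b}.
Proof.
move=> a b; apply: val_inj; apply/funext => x.
have /asboolP pL := valP phi.
have pD (u w : restr C) : (val phi : restr C -> k^o) (u + w)
    = (val phi : restr C -> k^o) u + (val phi : restr C -> k^o) w.
  by have := pL 1 u w; rewrite !scale1r.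
rewrite -[LHS]/((val phi : restr C -> k^o) ((a + b : A^c) *: (x : C))) scalerDl.
exact: pD.
Qed.
HB.instance Definition _ := GRing.Zmodule_isLmodule.Build A kdual
  kdual_scaleA kdual_scale1 kdual_scaleDr kdual_scaleDl.
End KDual.

(* The Auslander-Reiten translate computed from the map [d1] of a minimal
   projective presentation: the dual of the cokernel of Hom_A(d1, A). *)
Definition ar_translate (k : fieldType) (A : pzAlgType k) (P1 P0 : lmodType A)
    (d1 : {linear P1 -> P0}) : lmodType A := kdual (transpose_of d1).

Definition tau_rigid (k : fieldType) (A : pzAlgType k) (M : lmodType A) : Prop :=
  exists (P1 P0 : lmodType A) (d1 : {linear P1 -> P0}) (d0 : {linear P0 -> M}),
    min_proj_pres d1 d0
    /\ forall f : {linear M -> ar_translate d1}, forall x, f x = 0.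

Definition freemod (A : pzRingType) (X : choiceType) : Type := {malg A[X]}.

Section FreeMod.
Variables (A : pzRingType) (X : choiceType).
Local Notation F := (freemod A X).
HB.instance Definition _ := GRing.Zmodule.on F.
Implicit Types (f g : F) (a b c : A) (x : X).

Definition fm_elt (c : A) (x : X) : F := << c *g x >>.
Definition fm_scale (a : A) (f : F) : F := [malg x in msupp f => a * f@_x].

Lemma fm_scaleE a f x : (fm_scale a f)@_x = a * f@_x.
Proof. by rewrite mcoeffE; case: ifP => // /negbT /mcoeff_outdom ->; rewrite mulr0. Qed.

Fact fm_scaleA a b f : fm_scale a (fm_scale b f) = fm_scale (a * b) f.
Proof. by apply/malgP => x; rewrite !fm_scaleE mulrA. Qed.
Fact fm_scale1 : left_id 1 fm_scale.
Proof. by move=> f; apply/malgP => x; rewrite fm_scaleE mul1r. Qed.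
Fact fm_scaleDr : right_distributive fm_scale +%R.
Proof.
by move=> a f g; apply/malgP => x; rewrite fm_scaleE !mcoeffD !fm_scaleE mulrDr.
Qed.
Fact fm_scaleDl f : {morph fm_scale^~ f : a b / a + b}.
Proof.
by move=> a b; apply/malgP => x; rewrite fm_scaleE mcoeffD !fm_scaleE mulrDl.
Qed.
HB.instance Definition _ := GRing.Zmodule_isLmodule.Build A F
  fm_scaleA fm_scale1 fm_scaleDr fm_scaleDl.

Lemma fm_scaleU a c x : a *: fm_elt c x = fm_elt (a * c) x.
Proof.
apply/malgP => y; rewrite -[_ *: _]/(fm_scale _ _) fm_scaleE !mcoeffU.
by rewrite mulrnAr.
Qed.

Section Lift.
Variables (M : lmodType A) (u : X -> M).

Definition fm_lift (f : F) : M := \sum_(x <- msupp f) f@_x *: u x.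

Lemma fm_liftB : zmod_morphism fm_lift.
Proof.
apply: (fextB (h := fun x c => c *: u x)) => x c d.
exact: scalerBl.
Qed.
Lemma fm_liftU c x : fm_lift (fm_elt c x) = c *: u x.
Proof.
apply: (fextU (h := fun x c => c *: u x)) => y a b.
exact: scalerBl.
Qed.
Fact fm_lift_scalable : scalable fm_lift.
Proof.
move=> a; apply: malg_ext => [f g|f g|c x].
- by rewrite scalerBr fm_liftB.
- by rewrite fm_liftB scalerBr.
by rewrite -/(fm_elt c x) fm_scaleU !fm_liftU scalerA.
Qed.
HB.instance Definition _ := GRing.isZmodMorphism.Build F M fm_lift fm_liftB.
HB.instance Definition _ := GRing.isScalable.Build A F M *:%R fm_lift fm_lift_scalable.
End Lift.
End FreeMod.

Section Resolution.
Variables (k : fieldType) (A : pzAlgType k).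
Implicit Types (M N : lmodType A).

Record proj_resolution M := ProjResolution {
  pr_mod : nat -> lmodType A;
  pr_diff : forall n, {linear pr_mod n.+1 -> pr_mod n};
  pr_aug : {linear pr_mod 0 -> M};
  pr_proj : forall n, projective (pr_mod n);
  pr_surj : forall x, exists y, pr_aug y = x;
  pr_exact0 : forall x, pr_aug x = 0 <-> exists y, pr_diff 0 y = x;
  pr_exact : forall n x, pr_diff n x = 0 <-> exists y, pr_diff n.+1 y = x
}.

Lemma freemod_projective (X : choiceType) : projective (freemod A X).
Proof.
move=> Y Z g f gS.
have [u uE] := choice (fun x : X => gS (f (fm_elt 1 x))).
exists (fm_lift u : {linear freemod A X -> Y}) => p.
apply: (malg_ext (f := fun p => g (fm_lift u p)) (g := f)) => [a b|a b|c x].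
- by rewrite !raddfB.
- exact: raddfB.
rewrite -/(fm_elt c x) fm_liftU linearZ_LR /= uE -linearZ_LR fm_scaleU.
by rewrite mulr1.
Qed.

Section FreeResolution.
Variable M : lmodType A.

Definition free_cover N : lmodType A := freemod A N.
Definition cover_map N : {linear free_cover N -> N} := fm_lift (fun x : N => x).

Lemma cover_map_surj N x : exists y, @cover_map N y = x.
Proof. by exists (fm_elt 1 x); rewrite /= fm_liftU scale1r. Qed.

Fixpoint syzygy (n : nat) : lmodType A :=
  if n is m.+1 then submodT (ker_pred (@cover_map (syzygy m))) else M.

Definition fr_diff n (x : free_cover (syzygy n.+1)) : free_cover (syzygy n) :=
  val (@cover_map (syzygy n.+1) x).
Fact fr_diff_linear n : linear (@fr_diff n).
Proof. by move=> a x y; rewrite /fr_diff linearP. Qed.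
HB.instance Definition _ n :=
  GRing.isLinear.Build A (free_cover (syzygy n.+1)) (free_cover (syzygy n)) *:%R
    (@fr_diff n) (@fr_diff_linear n).

Lemma fr_diff_im n x :
  @cover_map (syzygy n) x = 0 <-> exists y, @fr_diff n y = x.
Proof.
split=> [x0|[y <-]]; last exact/eqP/(valP (@cover_map (syzygy n.+1) y)).
have xK : x \in ker_pred (@cover_map (syzygy n)) by apply/eqP.
have [y yE] := @cover_map_surj (syzygy n.+1) (Sub x xK).
by exists y; rewrite /fr_diff yE.
Qed.

Lemma fr_diff_exact n x :
  @fr_diff n x = 0 <-> exists y, @fr_diff n.+1 y = x.
Proof.
rewrite -fr_diff_im; split=> [x0|x0]; first by apply: val_inj; exact: x0.
by rewrite /fr_diff x0.
Qed.

Definition free_resolution : proj_resolution M :=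
  @ProjResolution M (fun n => free_cover (syzygy n)) (fun n => @fr_diff n)
    (@cover_map M) (fun n => @freemod_projective (syzygy n))
    (@cover_map_surj M) (@fr_diff_im 0) fr_diff_exact.
End FreeResolution.

Section ExtOf.
Variables (M : lmodType A) (P : proj_resolution M) (N : lmodType A) (n : nat).

Definition cochain (i : nat) : lmodType k := homA (pr_mod P i) N.
Definition codiff (i : nat) : {linear cochain i -> cochain i.+1} :=
  hom_precomp (pr_diff P i).

Definition is_coboundary : cochain n -> Prop :=
  if n is m.+1 return cochain n -> Prop
  then fun f => exists g, codiff m g = f
  else fun f => f = 0.

Definition coboundaries : {pred submodT (ker_pred (codiff n))} :=
  fun z => `[< is_coboundary (val z) >].
Fact coboundaries_closed : subsemimod_closed coboundaries.
Proof.
rewrite /coboundaries /is_coboundary; case: n => [|m]; (split; first split).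
- exact/asboolP.
- move=> x y /asboolP x0 /asboolP y0; apply/asboolP.
  by rewrite raddfD /= x0 y0 addr0.
- by move=> a x /asboolP x0; apply/asboolP; rewrite linearZ_LR /= x0 scaler0.
- apply/asboolP; exists (0 : cochain m).
  exact: (raddf0 (codiff m)).
- move=> x y /asboolP[f fx] /asboolP[g gy]; apply/asboolP.
  by exists (f + g); rewrite (raddfD (codiff m)) /= fx gy.
- move=> a x /asboolP[f fx]; apply/asboolP.
  by exists (a *: f); rewrite (linearZ_LR (codiff m)) /= fx.
Qed.
HB.instance Definition _ := GRing.isSubmodClosed.Build k
  (submodT (ker_pred (codiff n))) coboundaries coboundaries_closed.

(* Cohomology of Hom_A(P, N) in degree [n]. *)
Definition Ext_of : lmodType k := quotmod coboundaries.
End ExtOf.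

Definition Ext M N (n : nat) : lmodType k := Ext_of (free_resolution M) N n.
End Resolution.

Definition HH (k : fieldType) (A : pzAlgType k) (n : nat) : lmodType k :=
  Ext (regenv A) (regenv A) n.

Definition bimod_k (k : fieldType) (A : pzAlgType k) (V : bimodType A) : Type := V.

Section BimodK.
Variables (k : fieldType) (A : pzAlgType k) (V : bimodType A).
HB.instance Definition _ := GRing.Zmodule.on (bimod_k V).
Definition bimod_scale (c : k) (v : bimod_k V) : bimod_k V := lact (algin c) (v : V).
Fact bimod_scaleA c d v : bimod_scale c (bimod_scale d v) = bimod_scale (c * d) v.
Proof. by rewrite /bimod_scale lactA -(rmorphM algin). Qed.
Fact bimod_scale1 : left_id 1 bimod_scale.
Proof. by move=> v; rewrite /bimod_scale (rmorph1 algin) lact1. Qed.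
Fact bimod_scaleDr : right_distributive bimod_scale +%R.
Proof. by move=> c u v; exact: lactDr. Qed.
Fact bimod_scaleDl v : {morph bimod_scale^~ v : c d / c + d}.
Proof. by move=> c d; rewrite /bimod_scale (raddfD algin) lactDl. Qed.
HB.instance Definition _ := GRing.Zmodule_isLmodule.Build k (bimod_k V)
  bimod_scaleA bimod_scale1 bimod_scaleDr bimod_scaleDl.
End BimodK.

Section BimodHom.
Variables (k : fieldType) (A : pzAlgType k) (U V : bimodType A).

Definition is_bimod_hom (f : U -> V) : Prop :=
  [/\ {morph f : u v / u + v},
      forall a u, f (lact a u) = lact a (f u) &
      forall a u, f (ract a u) = ract a (f u)].

Definition bimod_hom_pred : {pred U -> bimod_k V} := fun f => `[< is_bimod_hom f >].
Fact bimod_hom_closed : subsemimod_closed bimod_hom_pred.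
Proof.
have act0 (f : V -> V) : {morph f : u v / u + v} -> f 0 = 0.
  by move=> fD; apply: (addIr (f 0)); rewrite -fD !add0r.
split; first split.
- apply/asboolP; split=> [u v|a u|a u] //.
  + by rewrite addr0.
  + by rewrite act0 //; exact: lactDr.
  + by rewrite act0 //; exact: ractDr.
- move=> f g /asboolP[fD fl fr] /asboolP[gD gl gr]; apply/asboolP.
  split=> [u v|a u|a u].
  + rewrite -[LHS]/((f (u + v) : V) + (g (u + v) : V)) fD gD.
    exact: addrACA.
  + rewrite -[LHS]/((f (lact a u) : V) + (g (lact a u) : V)) fl gl.
    exact: esym (lactDr _ _ _).
  + rewrite -[LHS]/((f (ract a u) : V) + (g (ract a u) : V)) fr gr.
    exact: esym (ractDr _ _ _).
- move=> c f /asboolP[fD fl fr]; apply/asboolP.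
  split=> [u v|a u|a u].
  + rewrite -[LHS]/(lact (algin c) (f (u + v) : V)) fD.
    exact: lactDr.
  + rewrite -[LHS]/(lact (algin c) (f (lact a u) : V)) fl.
    by rewrite lactA algin_central -lactA.
  + rewrite -[LHS]/(lact (algin c) (f (ract a u) : V)) fr.
    exact: lractC.
Qed.
HB.instance Definition _ :=
  GRing.isSubmodClosed.Build k (U -> bimod_k V) bimod_hom_pred bimod_hom_closed.

Definition bimod_hom : lmodType k := submodT bimod_hom_pred.
End BimodHom.

Section IdealSquare.
Variables (k : fieldType) (A : pzAlgType k) (I : ideal A).

Definition ideal_sq_pred : {pred subzmodT I} :=
  fun x => val x \in (ideal_mul I I : {pred A}).
Fact ideal_sq_zmod : zmod_closed ideal_sq_pred.
Proof.
split=> [|x y xI yI]; first exact: (rpred0 (ideal_mul I I)).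
exact: (rpredB xI yI).
Qed.
HB.instance Definition _ :=
  GRing.isZmodClosed.Build (subzmodT I) ideal_sq_pred ideal_sq_zmod.

Definition ideal_mod_sq : Type := Quotient.quot ideal_sq_pred.
HB.instance Definition _ := GRing.Zmodule.on ideal_mod_sq.
Local Notation pi := (qpi ideal_sq_pred).
Implicit Types (x y : subzmodT I) (t u v : ideal_mod_sq) (a b : A).

Definition ideal_lmul a x : subzmodT I := Sub (a * val x) (idealMl a _ (valP x)).
Definition ideal_rmul a x : subzmodT I := Sub (val x * a) (idealMr a _ (valP x)).

Definition ims_lact a t : ideal_mod_sq := pi (ideal_lmul a (qrepr t)).
Definition ims_ract a t : ideal_mod_sq := pi (ideal_rmul a (qrepr t)).

Lemma ims_lact_pi a x : ims_lact a (pi x) = pi (ideal_lmul a x).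
Proof.
apply/qpiP.
have : a * val (qrepr (pi x) - x) \in (ideal_mul I I : {pred A}).
  by apply: idealMl; exact: (qrepr_qpi ideal_sq_pred x).
by rewrite raddfB mulrBr.
Qed.
Lemma ims_ract_pi a x : ims_ract a (pi x) = pi (ideal_rmul a x).
Proof.
apply/qpiP.
have : val (qrepr (pi x) - x) * a \in (ideal_mul I I : {pred A}).
  by apply: idealMr; exact: (qrepr_qpi ideal_sq_pred x).
by rewrite raddfB mulrBl.
Qed.

Fact ims_lactA a b t : ims_lact a (ims_lact b t) = ims_lact (a * b) t.
Proof.
rewrite -(qreprK t) !ims_lact_pi; congr pi.
by apply: val_inj; rewrite /= mulrA.
Qed.
Fact ims_lact1 t : ims_lact 1 t = t.
Proof.
rewrite -{2}(qreprK t); congr pi.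
by apply: val_inj; rewrite /= mul1r.
Qed.
Fact ims_lactDr a : {morph ims_lact a : u v / u + v}.
Proof.
move=> u v; rewrite -(qreprK u) -(qreprK v) -(raddfD pi) !ims_lact_pi.
rewrite -(raddfD pi); congr pi.
by apply: val_inj; rewrite /= mulrDr.
Qed.
Fact ims_lactDl t : {morph ims_lact^~ t : a b / a + b}.
Proof.
move=> a b /=; rewrite -(qreprK t) !ims_lact_pi -(raddfD pi); congr pi.
by apply: val_inj; rewrite /= mulrDl.
Qed.
Fact ims_ractA a b t : ims_ract b (ims_ract a t) = ims_ract (a * b) t.
Proof.
rewrite -(qreprK t) !ims_ract_pi; congr pi.
by apply: val_inj; rewrite /= mulrA.
Qed.
Fact ims_ract1 t : ims_ract 1 t = t.
Proof.
rewrite -{2}(qreprK t); congr pi.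
by apply: val_inj; rewrite /= mulr1.
Qed.
Fact ims_ractDr a : {morph ims_ract a : u v / u + v}.
Proof.
move=> u v; rewrite -(qreprK u) -(qreprK v) -(raddfD pi) !ims_ract_pi.
rewrite -(raddfD pi); congr pi.
by apply: val_inj; rewrite /= mulrDl.
Qed.
Fact ims_ractDl t : {morph ims_ract^~ t : a b / a + b}.
Proof.
move=> a b /=; rewrite -(qreprK t) !ims_ract_pi -(raddfD pi); congr pi.
by apply: val_inj; rewrite /= mulrDr.
Qed.
Fact ims_lractC a b t : ims_lact a (ims_ract b t) = ims_ract b (ims_lact a t).
Proof.
rewrite -(qreprK t) ims_lact_pi !ims_ract_pi ims_lact_pi; congr pi.
by apply: val_inj; rewrite /= mulrA.
Qed.
Fact ims_lract_algin c t : ims_lact (algin c) t = ims_ract (algin c) t.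
Proof. by congr pi; apply: val_inj; rewrite /= algin_central. Qed.
HB.instance Definition _ := Zmodule_isBimodule.Build k A ideal_mod_sq
  ims_lactA ims_lact1 ims_lactDr ims_lactDl
  ims_ractA ims_ract1 ims_ractDr ims_ractDl ims_lractC ims_lract_algin.
End IdealSquare.

(* [quotalg I] as an [A]-bimodule. *)
Definition quot_bimod (A : pzRingType) (I : ideal A) : Type := quotalg I.

Section QuotBimod.
Variables (k : fieldType) (A : pzAlgType k) (I : ideal A).
HB.instance Definition _ := GRing.Zmodule.on (quot_bimod I).
Local Notation L := (quotalg I).
Implicit Types (a b : A) (x y : quot_bimod I).

Definition qb_lact a x : quot_bimod I := qproj I a * (x : L).
Definition qb_ract a x : quot_bimod I := (x : L) * qproj I a.

Fact qb_lactA a b x : qb_lact a (qb_lact b x) = qb_lact (a * b) x.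
Proof. by rewrite /qb_lact mulrA -(rmorphM (qproj I)). Qed.
Fact qb_lact1 x : qb_lact 1 x = x.
Proof. by rewrite /qb_lact (rmorph1 (qproj I)) mul1r. Qed.
Fact qb_lactDr a : {morph qb_lact a : x y / x + y}.
Proof. by move=> x y; exact: mulrDr. Qed.
Fact qb_lactDl x : {morph qb_lact^~ x : a b / a + b}.
Proof. by move=> a b; rewrite /qb_lact (raddfD (qproj I)) mulrDl. Qed.
Fact qb_ractA a b x : qb_ract b (qb_ract a x) = qb_ract (a * b) x.
Proof. by rewrite /qb_ract -mulrA -(rmorphM (qproj I)). Qed.
Fact qb_ract1 x : qb_ract 1 x = x.
Proof. by rewrite /qb_ract (rmorph1 (qproj I)) mulr1. Qed.
Fact qb_ractDr a : {morph qb_ract a : x y / x + y}.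
Proof. by move=> x y; exact: mulrDl. Qed.
Fact qb_ractDl x : {morph qb_ract^~ x : a b / a + b}.
Proof. by move=> a b; rewrite /qb_ract (raddfD (qproj I)) mulrDr. Qed.
Fact qb_lractC a b x : qb_lact a (qb_ract b x) = qb_ract b (qb_lact a x).
Proof. exact: mulrA. Qed.
Fact qb_lract_algin c x : qb_lact (algin c) x = qb_ract (algin c) x.
Proof. exact: (algin_central (s := L) c x). Qed.
HB.instance Definition _ := Zmodule_isBimodule.Build k A (quot_bimod I)
  qb_lactA qb_lact1 qb_lactDr qb_lactDl
  qb_ractA qb_ract1 qb_ractDr qb_ractDl qb_lractC qb_lract_algin.
End QuotBimod.

Definition has_dim (k : fieldType) (V : lmodType k) (n : nat) : Prop :=
  exists b : 'I_n -> V,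
    forall v, exists! c : {ffun 'I_n -> k}, v = \sum_i c i *: b i.

(* Finite and equal dimensions. *)
Definition eq_dim (k : fieldType) (V W : lmodType k) : Prop :=
  exists n, has_dim V n /\ has_dim W n.

(* Main.v *)
Require Import Defs.
From HB Require Import structures.
From mathcomp Require Import all_boot all_order all_algebra.
From mathcomp Require Import finmap.
From mathcomp Require Import boolp functions.
From mathcomp.multinomials Require Import monalg.

Set Implicit Arguments.
Unset Strict Implicit.
Unset Printing Implicit Defensive.

Import GRing.Theory.
Local Open Scope ring_scope.

(** Let [L] be the bound quiver algebra [R / I], where [R] is the path algebra,
    and [A] its enveloping algebra. The bimodule [L] has the minimal projective
    presentation [P1 -> P0 -> L], with [P0] the sum of the [A (v (x) v)] over the
    vertices [v] and [P1] the sum of the [A (s (x) t)] over the arrows from [s] to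
    [t]; the generator of an arrow [a] goes to [a (x) t - s (x) a]. Let [K] be the
    kernel of [P1 -> P0]. Everything happens in the complex
    [Hom_A(P0, L) -> Hom_A(P1, L) -> Hom_A(K, L)].

    - By the Auslander-Reiten formula ([ar_zero_factors], [factors_ar_zero]),
      [Hom_A(L, tau L)] is dual to the cokernel of the first map. So [L] is
      tau-rigid iff the first map is onto. This can be tested on the presentation
      above: it is minimal because the kernels of its maps have their coordinates
      in the radical, which is nilpotent ([standard_min_proj_pres]), and any two
      minimal presentations are isomorphic ([min_pres_factors]).

    - The first Hochschild cohomology group is the cohomology of the complex in
      the middle, and the second is the cokernel of the last map ([Ext1_eq0],
      [Ext2_presentation]). These follow from comparing the presentation with the
      free resolution by which [Ext] is defined.

    - [K] is isomorphic to [I] modulo its square ([hom_conormal]). The isomorphism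
      is the restriction to [I] of the universal derivation [delta] from [R] to
      [P1], which sends each arrow to its generator. It is one to one
      modulo the square ([delta_inj_square]) because a linear section [sec] of
      the projection to [L] provides a derivation from [R],
      [x |-> (m |-> x * sec m - sec (x m))], that is the identity on [I] modulo
      its square and, like every derivation that kills the vertices, factors
      through [delta]. The section also serves to show that [delta] maps [I]
      onto [K] ([delta_onto_kernel]).

    Thus the last term of the complex is the space of bimodule maps from [I]
    modulo its square to [L], and it is finite dimensional. If the first map is
    onto, the complex is exact in the middle and its last map vanishes, so the
    first group is zero and the second is the whole last term. Conversely, if the
    second group, a quotient of the last term, has the same dimension, the last
    map of the complex vanishes; if the first group is zero too, the first map
    is onto ([factors_Ext]). *)

(** * Linear algebra over a field *)

Definition linmap (R : pzRingType) (U V : lmodType R) (f : U -> V) (fL : linear f) :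
  {linear U -> V} := HB.pack f (GRing.isLinear.Build R U V *:%R f fL).

Section FiniteSpan.
Variable k : fieldType.
Implicit Types V W : lmodType k.

Definition fdim V : Prop :=
  exists (I : finType) (g : I -> V), forall v, exists c : I -> k, v = \sum_i c i *: g i.

Lemma fdim_ord V : fdim V ->
  exists n, exists g : 'I_n -> V, forall v, exists c : 'I_n -> k, v = \sum_i c i *: g i.
Proof.
move=> [I [g gP]]; exists #|I|, (g \o enum_val) => v.
have [c ->] := gP v; exists (c \o enum_val).
by rewrite [LHS](reindex (enum_val : 'I_#|I| -> I)) //=; apply: onW_bij; exact: enum_val_bij.
Qed.

(** A spanning family of least size is a basis: a relation with a nonzero
    coefficient would express one of its members through the others. *)
Lemma fdim_basis V : fdim V -> exists n, has_dim V n.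
Proof.
move=> /fdim_ord.
pose spn n := exists g : 'I_n -> V, forall v, exists c : 'I_n -> k, v = \sum_i c i *: g i.
rewrite -/(exists n, spn n) => spP.
have spB : exists n, `[< spn n >] by have [n ns] := spP; exists n; apply/asboolP.
case: (ex_minnP spB) => n /asboolP[g gP] nmin; exists n, g => v.
have [c vE] := gP v; exists [ffun i => c i]; split.
  by rewrite vE; apply: eq_bigr => i _; rewrite ffunE.
move=> c' v'E; apply/ffunP => j; rewrite ffunE; apply/eqP/negPn/negP => cj.
have [m nE] : exists m, n = m.+1 by exists n.-1; rewrite (ltn_predK (ltn_ord j)).
subst n.
have := nmin m; rewrite ltnn => /(_ _) nn; apply: notF; apply: nn; apply/asboolP.
pose d i := c' i - c i; have dj : d j != 0 by rewrite subr_eq0 eq_sym.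
have d0 : \sum_i d i *: g i = 0.
  rewrite (eq_bigr (fun i => c' i *: g i - c i *: g i)) => [|i _]; last exact: scalerBl.
  by rewrite sumrB -vE -v'E subrr.
exists (g \o lift j) => w; have [e ->] := gP w.
(* subtract the multiple of the relation [d] that kills the coefficient of [g j] *)
exists (fun i => e (lift j i) - e j / d j * d (lift j i)).
have := congr1 (fun x => (e j / d j) *: x) d0; rewrite scaler0 scaler_sumr.
move=> /(congr1 (fun x => \sum_i e i *: g i - x)); rewrite subr0 -sumrB => <-.
rewrite (bigD1_ord j) //= scalerA divfK // subrr add0r.
by apply: eq_bigr => i _; rewrite scalerA -scalerBl.
Qed.

Lemma fdim_surj V W (f : {linear V -> W}) :
  (forall w, exists v, f v = w) -> fdim V -> fdim W.
Proof.
move=> fS [I [g gP]]; exists I, (f \o g) => w.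
have [v <-] := fS w; have [c ->] := gP v; exists c.
by rewrite linear_sum; apply: eq_bigr => i _; rewrite linearZ_LR.
Qed.

Lemma fdim_ffun (I : finType) V : fdim V -> fdim {ffun I -> V}.
Proof.
move=> [J [g gP]]; exists (I * J)%type, (fun p => [ffun i => if i == p.1 then g p.2 else 0]) => v.
have [c cP] := choice (fun i => gP (v i)); exists (fun p => c p.1 p.2).
apply/ffunP => i; rewrite cP sum_ffunE.
rewrite -(pair_bigA_idem _ (fun i0 j => (c i0 j *: [ffun i1 => if i1 == i0 then g j else 0]) i)) /=; last by rewrite addr0.
rewrite (bigD1 i) //= [X in _ + X]big1 ?addr0 => [|i' ii'].
  by apply: eq_bigr => j _; rewrite !ffunE eqxx.
by rewrite big1 // => j _; rewrite !ffunE eq_sym (negPf ii') scaler0.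
Qed.

(** Induction on the number of coordinates: a nonzero last coordinate splits
    off one generator, the others span its kernel. *)
Lemma fdim_coord V n (f : {linear V -> {ffun 'I_n -> k^o}}) : injective f -> fdim V.
Proof.
elim: n V f => [|n IH] V f fI.
  exists 'I_0, (fun=> 0) => v; exists (fun=> 0); rewrite big_ord0.
  by apply: fI; apply/ffunP => -[].
have lL : linear (fun v => f v ord_max : k^o).
  by move=> a x y; rewrite linearP !ffunE.
pose l := linmap lL.
pose K := submodT (ker_pred l).
have hL : linear (fun x : K => [ffun i => f (val x) (lift ord_max i)] : {ffun 'I_n -> k^o}).
  by move=> a x y; apply/ffunP => i; rewrite !ffunE linearP !ffunE.
have [|I [g gP]] := IH K (linmap hL).
  move=> x y xy; apply/val_inj/fI/ffunP => i.
  case: (unliftP ord_max i) => [j ->|->].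
    by have /ffunP/(_ j) := xy; rewrite !ffunE.
  by rewrite -[LHS]/(l (val x)) -[RHS]/(l (val y)) (eqP (valP x)) (eqP (valP y)).
have [[v0 l0]|nl] := pselect (exists v, l v != 0); last first.
  exists I, (fun i => val (g i)) => v.
  have vK : v \in ker_pred l by apply/negPn/negP => lv; apply: nl; exists v.
  have [c cE] := gP (Sub v vK); exists c.
  by rewrite -[v]/(val (Sub v vK : K)) cE raddf_sum.
exists (option I), (fun o => if o is Some i then val (g i) else v0) => v.
pose a := l v / l v0.
have vK : v - a *: v0 \in ker_pred l.
  apply/eqP; rewrite linearB linearZ_LR /= -[X in _ - X]/(a * l v0).
  by rewrite divfK // subrr.
have [c cE] := gP (Sub (v - a *: v0) vK); exists (fun o => if o is Some i then c i else a).
rewrite (bigD1 None) //= (reindex_omap Some id) /=; last by case.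
rewrite (eq_bigl xpredT); last by move=> i; rewrite eqxx.
have : v - a *: v0 = \sum_i c i *: val (g i).
  by rewrite -[LHS]/(val (Sub (v - a *: v0) vK : K)) cE raddf_sum.
by move=> <-; rewrite addrC subrK.
Qed.

Lemma has_dim_coord V n : has_dim V n ->
  exists (f : {linear V -> {ffun 'I_n -> k^o}}) (b : 'I_n -> V),
    (forall v, v = \sum_i f v i *: b i) /\
    (forall c : {ffun 'I_n -> k^o}, f (\sum_i c i *: b i) = c).
Proof.
move=> [b bP].
have [f fP] := choice bP.
have fu v (c : {ffun 'I_n -> k}) : v = \sum_i c i *: b i -> f v = c.
  by have [_ u] := fP v => /u.
have fL : linear (f : V -> {ffun 'I_n -> k^o}).
  move=> a x y; apply: fu; rewrite [x in LHS](fP x).1 [y in LHS](fP y).1.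
  rewrite scaler_sumr -big_split /=; apply: eq_bigr => i _.
  by rewrite scalerA -scalerDl !ffunE.
exists (linmap fL), b; split=> [v|c]; first exact: (fP v).1.
exact: fu.
Qed.

Lemma fdim_inj V W (f : {linear V -> W}) : injective f -> fdim W -> fdim V.
Proof.
move=> fI /fdim_basis[n /has_dim_coord[g [b [gE _]]]].
apply: (@fdim_coord V n (g \o f)) => x y /= xy; apply: fI.
by rewrite (gE (f x)) xy -gE.
Qed.

Lemma fdim_functional V (v : V) : fdim V -> v != 0 ->
  exists f : {linear V -> k^o}, f v != 0.
Proof.
move=> /fdim_basis[n /has_dim_coord[g [b [gE _]]]] v0.
have [i gi] : exists i, g v i != 0.
  apply: contrapT => ng; move/eqP: v0; apply; rewrite (gE v) big1 // => i _.
  have -> : g v i = 0 by apply/eqP/negPn/negP => gi; apply: ng; exists i.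
  by rewrite scale0r.
have fL : linear (fun v => g v i : k^o) by move=> a x y; rewrite linearP !ffunE.
by exists (linmap fL).
Qed.

Lemma fdim_section V W (f : {linear V -> W}) :
  (forall w, exists v, f v = w) -> fdim W -> exists s : {linear W -> V}, cancel s f.
Proof.
move=> fS /fdim_basis[n /has_dim_coord[g [b [gE _]]]].
have [t tE] := choice (fun i => fS (b i)).
have sL : linear (fun w => \sum_i g w i *: t i).
  move=> a x y; rewrite scaler_sumr -big_split /=; apply: eq_bigr => i _.
  by rewrite scalerA -scalerDl linearP !ffunE.
exists (linmap sL) => w; rewrite -[linmap sL w]/(\sum_i g w i *: t i) linear_sum [RHS]gE.
by apply: eq_bigr => i _; rewrite linearZ_LR /= tE.
Qed.

Lemma has_dim_bij V W (f : {linear V -> W}) n :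
  injective f -> (forall w, exists v, f v = w) -> has_dim V n -> has_dim W n.
Proof.
move=> fI fS [b bP]; exists (f \o b) => w.
have [v <-] := fS w; have [c [vE cu]] := bP v; exists c; split.
  by rewrite [in LHS]vE linear_sum; apply: eq_bigr => i _; rewrite linearZ_LR.
move=> c' c'E; apply: cu; apply: fI; rewrite c'E linear_sum.
by apply: eq_bigr => i _; rewrite linearZ_LR.
Qed.

Lemma has_dim_surj_inj V W (f : {linear V -> W}) n :
  has_dim V n -> has_dim W n -> (forall w, exists v, f v = w) -> injective f.
Proof.
move=> /has_dim_coord[g [b [gE gb]]] /has_dim_coord[h [d [hE hd]]] fS.
pose M := \matrix_(i, j) h (f (b i)) j.
pose r v := \row_i g v i.
have [t tE] := choice (fun i => fS (d i)).
have rM v : r v *m M = \row_j h (f v) j.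
  apply/rowP => j; rewrite !mxE [in RHS](gE v) !linear_sum sum_ffunE.
  by apply: eq_bigr => i _; rewrite !linearZ_LR /= ffunE !mxE.
pose N := \matrix_(i, j) g (t i) j.
have NM : N *m M = 1%:M.
  apply/row_matrixP => i; rewrite row_mul.
  have -> : row i N = r (t i) by apply/rowP => j; rewrite !mxE.
  rewrite rM tE; apply/rowP => j; rewrite !mxE.
  have := hd [ffun j => (i == j)%:R]; rewrite (bigD1 i) //= ffunE eqxx scale1r.
  rewrite big1 ?addr0 => [->|l li]; first by rewrite ffunE.
  by rewrite ffunE eq_sym (negPf li) scale0r.
apply: raddf_inj => x fx.
have : r x *m M = 0 by rewrite rM fx raddf0; apply/rowP => j; rewrite !mxE ffunE.
move=> /(congr1 (mulmx^~ N)); rewrite -mulmxA (mulmx1C NM) mulmx1 mul0mx => rx.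
rewrite (gE x) big1 // => i _; have /rowP/(_ i) := rx.
by rewrite !mxE => ->; rewrite scale0r.
Qed.
End FiniteSpan.

(** * Homomorphisms and the Auslander-Reiten formula *)

Lemma qpi_linear (R : pzRingType) (V : lmodType R) (U : submodClosed V) :
  linear (qpi (submod_zmod U) : V -> quotmod U).
Proof. by move=> a x y; rewrite raddfD /= -[a *: _ in RHS]/(qscale _ _) qscale_pi. Qed.

Lemma quotmod_pi0 (R : pzRingType) (V : lmodType R) (U : submodClosed V) (x : V) :
  (qpi (submod_zmod U) x : quotmod U) = 0 <-> x \in (U : {pred V}).
Proof. exact: (qpi0 (submod_zmod U) x). Qed.

Definition submod_in (R : pzRingType) (V : lmodType R) (U : submodClosed V) (x : V)
  (xU : x \in (U : {pred V})) : submodT U := Sub x xU.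

Section Modules.
Variables (k : fieldType) (A : pzAlgType k).
Implicit Types M N P : lmodType A.

Definition homof M N (f : {linear M -> N}) : homA M N :=
  Sub (f : M -> restr N) (asboolT (linearP f)).

Lemma homA_eq M N (f g : homA M N) : hom_fun f =1 hom_fun g -> f = g.
Proof. by move=> fg; apply/val_inj/funext. Qed.

Lemma homofE M N (f : {linear M -> N}) : hom_fun (homof f) =1 f.
Proof. by []. Qed.

Definition factors M P1 P0 (d : {linear P1 -> P0}) : Prop :=
  forall f : {linear P1 -> M}, exists g : {linear P0 -> M}, forall x, f x = g (d x).

Lemma dual_basis P : fin_gen P -> projective P ->
  exists n (E : 'I_n -> P) (phi : 'I_n -> {linear P -> A^o}),
    forall x, x = \sum_i phi i x *: E i.
Proof.
move=> [n [E EP]] Pproj.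
have cL : linear (fun c : {ffun 'I_n -> A^o} => \sum_i c i *: E i).
  move=> a x y; rewrite scaler_sumr -big_split; apply: eq_bigr => i _ /=.
  by rewrite !ffunE scalerDl scalerA.
have [|h hP] := Pproj _ _ (linmap cL) (linmap (fun a (x y : P) => erefl (a *: x + y))).
  move=> y; have [c ->] := EP y; exists [ffun i => c i].
  by apply: eq_bigr => i _; rewrite ffunE.
have phiL i : linear (fun x => h x i : A^o) by move=> a x y; rewrite linearP !ffunE.
by exists n, E, (fun i => linmap (phiL i)) => x; rewrite -[LHS](hP x).
Qed.

Section ARFormula.
Variables (M P1 P0 : lmodType A) (d : {linear P1 -> P0}).

Fact rank1_linear P (phi : rdual P) (m : M) :
  linear (fun x : P => (hom_fun phi x : A) *: m).
Proof. by move=> a x y; rewrite linearP scalerDl scalerA. Qed.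
Definition rank1 P (phi : rdual P) (m : M) : homA P M :=
  homof (linmap (rank1_linear phi m)).

Lemma rank1E P (phi : rdual P) m x : hom_fun (rank1 phi m) x = (hom_fun phi x : A) *: m.
Proof. by []. Qed.

Lemma rank1D P (phi psi : rdual P) m : rank1 (phi + psi) m = rank1 phi m + rank1 psi m.
Proof. by apply: homA_eq => x; rewrite !rank1E rdual_addE scalerDl. Qed.

Lemma rank1B P (phi psi : rdual P) m : rank1 (phi - psi) m = rank1 phi m - rank1 psi m.
Proof. by apply/eqP; rewrite eq_sym subr_eq -rank1D subrK. Qed.

Lemma rank1Dr P (phi : rdual P) m m' : rank1 phi (m + m') = rank1 phi m + rank1 phi m'.
Proof. by apply: homA_eq => x; rewrite !rank1E scalerDr. Qed.

Lemma rank1Z P (a : A) (phi : rdual P) m : rank1 ((a : A^c) *: phi) m = rank1 phi (a *: m).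
Proof. by apply: homA_eq => x; rewrite !rank1E scalerA. Qed.

Lemma rank1_algin P (c : k) (phi : rdual P) m :
  rank1 phi (algin c *: m) = c *: rank1 phi m.
Proof.
apply: homA_eq => x; rewrite rank1E -[RHS]/((algin c : A) *: hom_fun (rank1 phi m) x).
by rewrite rank1E !scalerA algin_central.
Qed.

Local Notation C := (transpose_of d).
Local Notation piC := (qpi (submod_zmod (im_pred (rdual_map d)))).

Lemma kdual_linear (F : kdual C) : linear (val F : restr C -> k^o).
Proof. exact/asboolP/(valP F). Qed.

(** A map [f] outside the image of [Hom_A(P0, M)] is detected by a functional
    on [Hom_A(P1, M)] killing that image; evaluated on the maps
    [x |-> phi x *: m] it becomes a homomorphism from [M] to the translate,
    nonzero because the dual basis writes [f] as a sum of such maps. *)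
Lemma ar_zero_factors : fin_gen P1 -> projective P1 -> fdim (homA P1 M) ->
  (forall F : {linear M -> ar_translate d}, forall x, F x = 0) -> factors M d.
Proof.
move=> fg1 pr1 fd F0 f; apply: contrapT => nf.
have [n [E [phi phiE]]] := dual_basis fg1 pr1.
pose im := im_pred (hom_precomp d : homA P0 M -> homA P1 M).
pose pim := linmap (@qpi_linear k (homA P1 M) im).
have [l lf] : exists l : {linear quotmod im -> k^o}, l (pim (homof f)) != 0.
  apply: fdim_functional.
    by apply: (fdim_surj (f := pim)) fd => y; exists (qrepr y); exact: qreprK.
  apply/eqP => /quotmod_pi0/asboolP[g gE]; apply: nf; exists (hom_fun g : {linear P0 -> M}) => x.
  by rewrite -[LHS]/(hom_fun (homof f) x) -gE.
pose ev (m : M) (t : C) : k^o := l (pim (rank1 (qrepr t) m)).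
have evB m phi1 phi2 : phi1 - phi2 \in im_pred (rdual_map d) ->
    l (pim (rank1 phi1 m)) = l (pim (rank1 phi2 m)).
  move=> /asboolP[psi psiE]; apply/eqP; rewrite -subr_eq0 -!linearB -rank1B -psiE.
  rewrite (_ : pim _ = 0) ?raddf0 //.
  apply/quotmod_pi0/asboolP; exists (rank1 psi m).
  exact: homA_eq.
have evE m phi1 : ev m (piC phi1) = l (pim (rank1 phi1 m)).
  by apply: evB; exact: qrepr_qpi.
have evL m : (ev m : restr C -> k^o) \in @kdual_pred k A C.
  apply/asboolP => c s t; rewrite -(qreprK s) -(qreprK t).
  have -> : c *: (piC (qrepr s) : restr C) + piC (qrepr t)
      = piC ((algin c : A^c) *: qrepr s + qrepr t) :> restr C.
    rewrite (raddfD piC); congr (_ + _).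
    by rewrite -[LHS]/((algin c : A^c) *: (piC (qrepr s) : C)) -[LHS]/(qscale _ _) qscale_pi.
  by rewrite !evE rank1D rank1Z rank1_algin !linearP.
pose F m : ar_translate d := Sub (ev m : restr C -> k^o) (evL m).
have FL : linear F.
  move=> a x y; apply: val_inj; apply/funext => t.
  rewrite -[LHS]/(ev (a *: x + y) t).
  rewrite -[RHS]/(ev x ((a : A^c) *: (t : C)) + ev y t).
  rewrite -(qreprK t) -[_ *: _ in RHS]/(qscale _ _) qscale_pi !evE.
  by rewrite rank1Dr rank1Z !raddfD.
have fE : homof f = \sum_i rank1 (homof (phi i) : rdual P1) (f (E i)).
  apply: homA_eq => x.
  have sumE (r : seq 'I_n) (G : 'I_n -> homA P1 M) :
      hom_fun (\sum_(i <- r) G i) x = \sum_(i <- r) hom_fun (G i) x.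
    by elim/big_rec2: _ => // i y g _ <-.
  rewrite sumE homofE [in LHS](phiE x) linear_sum; apply: eq_bigr => i _.
  by rewrite linearZ_LR rank1E.
move/eqP: lf; apply; rewrite fE !linear_sum big1 // => i _.
rewrite -evE.
have := F0 (linmap FL) (f (E i)) => /(congr1 val) /(congr1 (fun g => g (piC (homof (phi i) : rdual P1)))).
exact.
Qed.

(** The dual bases turn [F] into the functional
    [f |-> \sum_i F (f (E i)) (phi i)] on [Hom_A(P1, M)], which kills the maps
    factoring through [d]. *)
Lemma factors_ar_zero : fin_gen P1 -> projective P1 -> fin_gen P0 -> projective P0 ->
  factors M d -> forall (F : {linear M -> ar_translate d}) x, F x = 0.
Proof.
move=> fg1 pr1 fg0 pr0 dF F m.
have [n [E [phi phiE]]] := dual_basis fg1 pr1.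
have [n0 [E0 [psi psiE]]] := dual_basis fg0 pr0.
pose v (y : M) (p : rdual P1) : k^o := (val (F y) : restr C -> k^o) (piC p).
have vD y p q : v y (p + q) = v y p + v y q.
  by rewrite /v (raddfD piC); exact: (raddfD (linmap (kdual_linear (F y)))).
have v0 y : v y 0 = 0 by apply: (addIr (v y 0)); rewrite -vD !add0r.
have vDm y z p : v (y + z) p = v y p + v z p.
  by rewrite /v raddfD.
have v0m p : v 0 p = 0 by rewrite /v raddf0.
have vZ a y p : v (a *: y) p = v y ((a : A^c) *: p).
  rewrite /v linearZ_LR.
  by rewrite -[LHS]/((val (F y) : restr C -> k^o) ((a : A^c) *: (piC p : C)))
    -[_ *: _ in LHS]/(qscale _ _) qscale_pi.
have vd y (q : rdual P0) : v y (rdual_map d q) = 0.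
  rewrite /v; have -> : piC (rdual_map d q) = 0.
    by apply/quotmod_pi0/asboolP; exists q.
  exact: (raddf0 (linmap (kdual_linear (F y)))).
pose lam (f : P1 -> M) := \sum_i v (f (E i)) (homof (phi i) : rdual P1).
have lamd (g : {linear P0 -> M}) : lam (g \o d) = 0.
  rewrite /lam.
  under eq_bigr => i _.
    rewrite /= (psiE (d (E i))) linear_sum (big_morph (fun y => v y _) (fun y z => vDm y z _) (v0m _)).
    under eq_bigr => j _ do rewrite linearZ_LR vZ.
    over.
  rewrite exchange_big big1 //= => j _.
  rewrite -(big_morph (v (g (E0 j))) (vD _) (v0 _)).
  rewrite -[RHS](vd (g (E0 j)) (homof (psi j) : rdual P0)); congr v.
  apply: rdualP => x.
  have sumE (r : seq 'I_n) (G : 'I_n -> rdual P1) :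
      hom_fun (\sum_(i <- r) G i) x = \sum_(i <- r) hom_fun (G i) x.
    by elim/big_rec2: _ => // i y g0 _ <-.
  rewrite sumE.
  rewrite -[RHS]/(psi j (d x)) [in RHS](phiE x) !linear_sum.
  by apply: eq_bigr => i _; rewrite !linearZ_LR.
have lamF (p : rdual P1) : lam (hom_fun (rank1 p m)) = v m p.
  rewrite /lam.
  under eq_bigr => i _ do rewrite rank1E vZ.
  rewrite -(big_morph (v m) (vD _) (v0 _)); congr v.
  apply: rdualP => x.
  have sumE (r : seq 'I_n) (G : 'I_n -> rdual P1) :
      hom_fun (\sum_(i <- r) G i) x = \sum_(i <- r) hom_fun (G i) x.
    by elim/big_rec2: _ => // i y g0 _ <-.
  rewrite sumE [in RHS](phiE x) linear_sum.
  by apply: eq_bigr => i _; rewrite linearZ_LR.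
apply: val_inj; apply/funext => t; rewrite -(qreprK (t : C)).
rewrite -[LHS]/(v m (qrepr (t : C))) -lamF.
have [g gE] := dF (hom_fun (rank1 (qrepr (t : C)) m)).
rewrite -[RHS](lamd g); apply: eq_bigr => i _.
by rewrite gE.
Qed.
End ARFormula.
End Modules.

(** * Projective presentations *)

Section Presentations.
Variables (k : fieldType) (A : pzAlgType k).
Implicit Types M N P X Y : lmodType A.

Lemma lift_image P X Y (g : {linear X -> Y}) (f : {linear P -> Y}) : projective P ->
  (forall p, exists x, g x = f p) -> exists h : {linear P -> X}, forall p, g (h p) = f p.
Proof.
move=> Pp fg.
have gI x : g x \in im_pred g by apply/asboolP; exists x.
have fI p : f p \in im_pred g by apply/asboolP.
have gL : linear (fun x => Sub (g x) (gI x) : submodT (im_pred g)).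
  by move=> a x y; apply: val_inj; rewrite /= linearP.
have fL : linear (fun p => Sub (f p) (fI p) : submodT (im_pred g)).
  by move=> a x y; apply: val_inj; rewrite /= linearP.
have [|h hE] := Pp _ _ (linmap gL) (linmap fL).
  by move=> y; have /asboolP[x xE] := valP y; exists x; apply: val_inj.
by exists h => p; have /(congr1 val) := hE p.
Qed.

(** A splitting [s] of [h] exists by projectivity; its image together with the
    kernel of [h], which is superfluous, is everything, so it is everything. *)
Lemma section_onto P (P' : lmodType A) (h : {linear P' -> P}) (K : submodClosed P') :
  projective P -> (forall x, exists y, h y = x) -> superfluous K ->
  (forall y, h y = 0 -> y \in (K : {pred P'})) ->
  exists s : {linear P -> P'}, cancel s h /\ cancel h s.
Proof.
move=> Pp hS Ks hK.
have [|s sE] := lift_image (g := h) (f := linmap (fun a (x y : P) => erefl (a *: x + y))) Pp.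
  exact: hS.
exists s; split=> // y.
have /asboolP[x <-] : y \in im_pred s; last by rewrite sE.
apply: Ks => {}y; exists (y - s (h y)), (s (h y)); split; last by rewrite subrK.
  by apply: hK; rewrite linearB /= [h (s _)]sE subrr.
by apply/asboolP; exists (h y).
Qed.

(** Two minimal presentations of [M] are isomorphic: a comparison map between
    them is onto because the kernels are superfluous, splits by projectivity,
    and its kernel is superfluous, hence zero. *)
Lemma min_pres_factors M N P1 P0 (d1 : {linear P1 -> P0}) (d0 : {linear P0 -> M})
    (P1' P0' : lmodType A) (d1' : {linear P1' -> P0'}) (d0' : {linear P0' -> M}) :
  min_proj_pres d1 d0 -> min_proj_pres d1' d0' -> factors N d1 -> factors N d1'.
Proof.
move=> m m'.
have [h hE] := lift_image (g := d0) (f := d0') (mpp_proj0 m') (fun p => mpp_surj m (d0' p)).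
have hS x : exists y, h y = x.
  suff /asboolP : x \in im_pred h by [].
  apply: (mpp_min0 m) => {}x.
  have [y yE] := mpp_surj m' (d0 x); exists (x - h y), (h y); split.
  - by apply/eqP; rewrite linearB /= hE yE subrr.
  - by apply/asboolP; exists y.
  - by rewrite subrK.
have [t [tK Kt]] : exists t : {linear P0 -> P0'}, cancel t h /\ cancel h t.
  apply: section_onto (mpp_proj0 m) hS (mpp_min0 m') _ => y hy.
  by apply/eqP; rewrite -hE hy linear0.
have [|h1 h1E] := lift_image (g := d1) (f := h \o d1') (mpp_proj1 m').
  move=> p; apply/(mpp_exact m); rewrite /= hE.
  by apply/(mpp_exact m'); exists p.
have h1S x : exists y, h1 y = x.
  suff /asboolP : x \in im_pred h1 by [].
  apply: (mpp_min1 m) => {}x.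
  have [z zE] := hS (d1 x).
  have [y yE] : exists y, d1' y = z.
    by apply/(mpp_exact m'); rewrite -hE zE; apply/(mpp_exact m); exists x.
  exists (x - h1 y), (h1 y); split.
  - by apply/eqP; rewrite linearB /= h1E /= yE zE subrr.
  - by apply/asboolP; exists y.
  - by rewrite subrK.
have [s [sK Ks]] : exists s : {linear P1 -> P1'}, cancel s h1 /\ cancel h1 s.
  apply: section_onto (mpp_proj1 m) h1S (mpp_min1 m') _ => y hy.
  by apply/eqP/(can_inj Kt); rewrite -[LHS]h1E hy !linear0.
move=> F f; have [g gE] := F (f \o s); exists (g \o h) => x.
by rewrite -[x in LHS]Ks -[LHS]/((f \o s) (h1 x)) gE h1E.
Qed.

Section Comparison.
Variables (M N : lmodType A) (Fr : proj_resolution M).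
Variables (P1 P0 : lmodType A) (d1 : {linear P1 -> P0}) (d0 : {linear P0 -> M}).
Hypotheses (pr1 : projective P1) (pr0 : projective P0).
Hypothesis d0S : forall x, exists y, d0 y = x.
Hypothesis d0E : forall x, d0 x = 0 <-> exists y, d1 y = x.

Local Notation F n := (pr_mod Fr n).
Local Notation D n := (pr_diff Fr n).
Local Notation aug := (pr_aug Fr).
Local Notation cob n := (@coboundaries k A M Fr N n).

(** The two comparison maps between the resolution and the presentation, with
    homotopies from their composites to the identity. In degree one the
    homotopy on the side of the presentation is only up to the kernel of [d1],
    where the presentation stops. *)
Lemma comparison_maps :
  exists (h0 : {linear F 0 -> P0}) (h1 : {linear F 1 -> P1})
    (l0 : {linear P0 -> F 0}) (l1 : {linear P1 -> F 1})
    (s0 : {linear F 0 -> F 1}) (s1 : {linear F 1 -> F 2}) (t0 : {linear P0 -> P1}),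
  [/\ forall x, d1 (h1 x) = h0 (D 0 x),
      forall x, D 0 (l1 x) = l0 (d1 x),
      forall x, l0 (h0 x) = x + D 0 (s0 x),
      forall x, l1 (h1 x) = x + s0 (D 0 x) + D 1 (s1 x) &
      forall x, d1 (h1 (l1 x) - x - t0 (d1 x)) = 0].
Proof.
have DD n x : D n (D n.+1 x) = 0 by apply/pr_exact; exists x.
have augD x : aug (D 0 x) = 0 by apply/pr_exact0; exists x.
have dd x : d0 (d1 x) = 0 by apply/d0E; exists x.
have [h0 h0E] := lift_image (g := d0) (f := aug) (@pr_proj _ _ _ Fr 0) (fun p => d0S (aug p)).
have [l0 l0E] := lift_image (g := aug) (f := d0) pr0 (fun p => pr_surj Fr (d0 p)).
have [|h1 h1E] := lift_image (g := d1) (f := h0 \o D 0) (@pr_proj _ _ _ Fr 1).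
  by move=> p; apply/d0E; rewrite /= h0E augD.
have [|l1 l1E] := lift_image (g := D 0) (f := l0 \o d1) pr1.
  by move=> p; apply/pr_exact0; rewrite /= l0E dd.
have [|s0 s0E] := lift_image (g := D 0) (f := (l0 \o h0) \- idfun) (@pr_proj _ _ _ Fr 0).
  by move=> p; apply/pr_exact0; rewrite /= linearB /= l0E h0E subrr.
have [|s1 s1E] := lift_image (g := D 1) (f := ((l1 \o h1) \- idfun) \- (s0 \o D 0)) (@pr_proj _ _ _ Fr 1).
  move=> p; apply/pr_exact; rewrite /= !linearB /= l1E s0E /= h1E /=.
  by rewrite subrr.
have [|t0 t0E] := lift_image (g := d1) (f := (h0 \o l0) \- idfun) pr0.
  by move=> p; apply/d0E; rewrite /= linearB /= h0E l0E subrr.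
exists h0, h1, l0, l1, s0, s1, t0; split=> x.
- by rewrite h1E.
- by rewrite l1E.
- by rewrite s0E /= addrC subrK.
- by rewrite s1E /= [RHS]addrC -[_ - _ - _]addrA -opprD subrK.
- by rewrite !linearB /= h1E t0E /= l1E /= subrr.
Qed.

Lemma Ext_of_eq0 n (z : submodT (ker_pred (codiff Fr N n))) :
  (qpi (submod_zmod (cob n)) z : Ext_of Fr N n) = 0
  <-> is_coboundary (val z).
Proof. by rewrite quotmod_pi0; split=> /asboolP. Qed.

(** A cocycle corresponds to a map out of [P1] killing the kernel of [d1], that
    is, to a map out of the first syzygy, and a coboundary to one that extends
    to [P0]. *)
Lemma Ext1_eq0 : (forall x : Ext_of Fr N 1, x = 0) <->
  (forall f : {linear P1 -> N}, (forall x, d1 x = 0 -> f x = 0) ->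
     exists g : {linear P0 -> N}, forall x, f x = g (d1 x)).
Proof.
have [h0 [h1 [l0 [l1 [s0 [s1 [t0 [h1E l1E s0E s1E t0E]]]]]]]] := comparison_maps.
have DD x : D 0 (D 1 x) = 0 by apply/pr_exact; exists x.
split=> [ext0 f fK|ext0 x].
  have fc : homof (f \o h1) \in ker_pred (codiff Fr N 1).
    apply/eqP; apply: homA_eq => x; rewrite -[LHS]/(f (h1 (D 1 x))).
    by apply: fK; rewrite h1E DD linear0.
  have /Ext_of_eq0[g gE] := ext0 (qpi (submod_zmod (cob 1)) (submod_in fc)).
  have gE' x : hom_fun g (D 0 x) = f (h1 x).
    by rewrite -[RHS]/(hom_fun (homof (f \o h1)) x) -[homof _]gE.
  exists ((hom_fun g \o l0) \- (f \o t0)) => x /=.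
  rewrite -l1E gE'; have /fK := t0E x; rewrite !linearB /= => /eqP.
  by rewrite subr_eq0 subr_eq => /eqP ->; rewrite addrC addKr.
rewrite -(qreprK x); apply/Ext_of_eq0.
case: (qrepr x) => c /= cK.
have cD y : hom_fun c (D 1 y) = 0.
  by have /eqP/(congr1 (fun f => hom_fun f y)) := cK.
have [|g gE] := ext0 (hom_fun c \o l1).
  move=> y dy /=; have [z <-] : exists z, D 1 z = l1 y; last exact: cD.
  by apply/pr_exact; rewrite l1E dy linear0.
exists (homof ((g \o h0) \- (hom_fun c \o s0))); apply: homA_eq => y.
rewrite -[LHS]/(g (h0 (D 0 y)) - hom_fun c (s0 (D 0 y))) -h1E -gE /= s1E !linearD /=.
by rewrite cD addr0 addrK.
Qed.

Local Notation K := (submodT (ker_pred d1)).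

(** Dimension shifting: a cocycle corresponds to a map out of the second syzygy,
    and it is a coboundary when that map extends to [P1]. *)
Lemma Ext2_presentation :
  exists Phi : {linear homA K N -> Ext_of Fr N 2},
    (forall x, exists f, Phi f = x) /\
    (forall f, Phi f = 0 <->
       exists r : {linear P1 -> N}, forall y : K, hom_fun f y = r (val y)).
Proof.
have [h0 [h1 [l0 [l1 [s0 [s1 [t0 [h1E l1E s0E s1E t0E]]]]]]]] := comparison_maps.
have DD n x : D n (D n.+1 x) = 0 by apply/pr_exact; exists x.
have h2K x : h1 (D 1 x) \in ker_pred d1 by apply/eqP; rewrite h1E DD linear0.
pose h2 x : K := Sub (h1 (D 1 x)) (h2K x).
have h2L : linear h2 by move=> a x y; apply: val_inj; rewrite /= !linearP.
have fc (f : homA K N) : homof (hom_fun f \o linmap h2L) \in ker_pred (codiff Fr N 2).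
  apply/eqP; apply: homA_eq => x; rewrite -[LHS]/(hom_fun f (h2 (D 2 x))).
  have -> : h2 (D 2 x) = 0 by apply: val_inj; rewrite /= DD linear0.
  by rewrite linear0.
pose z f : submodT (ker_pred (codiff Fr N 2)) := submod_in (fc f).
have zL : linear z by move=> a f g; apply: val_inj; apply: homA_eq.
exists (linmap (@qpi_linear _ _ (cob 2)) \o linmap zL); split=> [x|f].
- rewrite -(qreprK x); case: (qrepr x) => c cK.
  have cD y : hom_fun c (D 2 y) = 0.
    by have /eqP/(congr1 (fun f => hom_fun f y)) := cK.
  have l1K (y : K) : exists w, D 1 w = l1 (val y).
    by apply/pr_exact; rewrite l1E (eqP (valP y)) linear0.
  have [w wE] := choice l1K.
  have cw y y' : D 1 y = D 1 y' -> hom_fun c y = hom_fun c y'.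
    move=> yy; apply/eqP; rewrite -subr_eq0 -linearB.
    have [u <-] : exists u, D 2 u = y - y'; last by rewrite /= cD.
    by apply/pr_exact; rewrite linearB /= yy subrr.
  have gL : linear (fun y : K => hom_fun c (w y)).
    by move=> a y y'; rewrite -linearP; apply: cw; rewrite linearP !wE /= linearP.
  exists (homof (linmap gL)).
  apply/eqP; rewrite -subr_eq0; apply/eqP.
  rewrite -[LHS](raddfB (qpi (submod_zmod (cob 2))) _ _).
  apply/Ext_of_eq0; exists (homof (hom_fun c \o s1)); apply: homA_eq => y.
  rewrite -[LHS]/(hom_fun c (s1 (D 1 y))).
  rewrite -[RHS]/(hom_fun c (w (h2 y)) - hom_fun c y).
  apply/eqP; rewrite eq_sym subr_eq -linearD; apply/eqP/cw.
  by rewrite wE linearD /= s1E DD linear0 addr0 addrC.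
rewrite -[_ f]/(qpi _ (z f)) Ext_of_eq0; split=> [[g gE]|[r rE]].
- have gE' x : hom_fun g (D 1 x) = hom_fun f (h2 x).
    by rewrite -[RHS]/(hom_fun (val (z f)) x) -gE.
  have uK x : h1 (l1 x) - x - t0 (d1 x) \in ker_pred d1 by apply/eqP.
  have uL : linear (fun x => Sub (h1 (l1 x) - x - t0 (d1 x)) (uK x) : K).
    move=> a x y; apply: val_inj.
    exact: (linearP (((h1 \o l1) \- idfun) \- (t0 \o d1)) a x y).
  exists ((hom_fun g \o l1) \- (hom_fun f \o linmap uL)) => y /=.
  have [w wE] : exists w, D 1 w = l1 (val y).
    by apply/pr_exact; rewrite l1E (eqP (valP y)) linear0.
  rewrite -[X in hom_fun g X]wE gE' -linearB; congr (hom_fun f _); apply: val_inj.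
  by rewrite /= -wE (eqP (valP y)) linear0 subr0 subKr.
exists (homof (r \o h1)); apply: homA_eq => x.
by rewrite -[RHS]/(hom_fun f (h2 x)) rE.
Qed.

End Comparison.
End Presentations.

(** * Modules cut out by idempotents *)

Section IdempotentModules.
Variables (k : fieldType) (A : pzAlgType k) (I : finType) (eps : I -> A).
Hypothesis epsM : forall i, eps i * eps i = eps i.

(** The direct sum of the left ideals [A eps_i]. *)
Definition idem_pred : {pred {ffun I -> A^o}} :=
  fun f => [forall i, (f i : A) * eps i == f i].
Fact idem_pred_closed : subsemimod_closed idem_pred.
Proof.
split; first split.
- by apply/forallP => i; rewrite ffunE mul0r.
- move=> f g /forallP fP /forallP gP; apply/forallP => i; rewrite ffunE.
  by rewrite [X in X == _](mulrDl (f i : A)) (eqP (fP i)) (eqP (gP i)).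
- move=> a f /forallP fP; apply/forallP => i; rewrite ffunE.
  by rewrite -[X in X == _](mulrA a (f i : A)) (eqP (fP i)).
Qed.
HB.instance Definition _ :=
  GRing.isSubmodClosed.Build A {ffun I -> A^o} idem_pred idem_pred_closed.

Definition idemmod : lmodType A := submodT idem_pred.
Implicit Types f g : idemmod.

Definition coord f i : A := (val f : {ffun I -> A^o}) i.

Lemma idemmodP f g : (forall i, coord f i = coord g i) -> f = g.
Proof. by move=> fg; apply/val_inj/ffunP. Qed.

Lemma coord_idem f i : coord f i * eps i = coord f i.
Proof. exact/eqP/(forallP (valP f)). Qed.

Lemma coordD f g i : coord (f + g) i = coord f i + coord g i.
Proof. by rewrite /coord /= ffunE. Qed.
Lemma coord0 i : coord 0 i = 0.
Proof. by rewrite /coord /= ffunE. Qed.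
Lemma coordZ a f i : coord (a *: f) i = a * coord f i.
Proof. by rewrite /coord /= ffunE. Qed.
Lemma coord_sum (J : Type) (r : seq J) (P : pred J) (F : J -> idemmod) i :
  coord (\sum_(j <- r | P j) F j) i = \sum_(j <- r | P j) coord (F j) i.
Proof. by apply: (big_morph (coord^~ i)) => [f g|]; [exact: coordD|exact: coord0]. Qed.

Fact gen_subproof (i : I) :
  [ffun j => if j == i then eps i else 0 : A^o] \in idem_pred.
Proof.
apply/forallP => j; rewrite ffunE; apply/eqP; case: eqP => [->|_]; first exact: epsM.
exact: mul0r.
Qed.
Definition gen (i : I) : idemmod := submod_in (gen_subproof i).

Lemma coord_gen i j : coord (gen i) j = if j == i then eps i else 0.
Proof. by rewrite /coord /= ffunE. Qed.

Lemma eps_gen i : eps i *: gen i = gen i.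
Proof.
by apply: idemmodP => j; rewrite coordZ coord_gen; case: eqP; rewrite ?epsM ?mulr0.
Qed.

Lemma idemmodE f : f = \sum_i coord f i *: gen i.
Proof.
apply: idemmodP => i; rewrite coord_sum (bigD1 i) //= big1 => [|j ji].
  by rewrite coordZ coord_gen eqxx coord_idem addr0.
by rewrite coordZ coord_gen eq_sym (negPf ji) mulr0.
Qed.

Lemma idem_fin_gen : fin_gen idemmod.
Proof.
exists #|I|, (gen \o enum_val) => f; exists (fun i => coord f (enum_val i)).
rewrite [LHS]idemmodE (reindex (enum_val : 'I_#|I| -> I)) //=.
by apply: onW_bij; exact: enum_val_bij.
Qed.

Section Map.
Variables (M : lmodType A) (m : I -> M).
Definition idem_lift f : M := \sum_i coord f i *: m i.
Fact idem_lift_linear : linear idem_lift.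
Proof.
move=> a f g; rewrite /idem_lift scaler_sumr -big_split; apply: eq_bigr => i _ /=.
by rewrite coordD coordZ scalerDl scalerA.
Qed.
HB.instance Definition _ := GRing.isLinear.Build A idemmod M *:%R idem_lift idem_lift_linear.
Lemma idem_lift_gen i : idem_lift (gen i) = eps i *: m i.
Proof.
rewrite /idem_lift (bigD1 i) //= big1 ?addr0 => [|j ji]; first by rewrite coord_gen eqxx.
by rewrite coord_gen (negPf ji) scale0r.
Qed.
End Map.

Lemma idem_map_ext (M : lmodType A) (F G : {linear idemmod -> M}) :
  (forall i, F (gen i) = G (gen i)) -> F =1 G.
Proof.
move=> FG f; rewrite (idemmodE f) !linear_sum; apply: eq_bigr => i _.
by rewrite !linearZ_LR /= FG.
Qed.

(** A homomorphism is determined by the images of the generators, and [eps i]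
    times any element is allowed as the image of [gen i]. *)
Lemma idem_projective : projective idemmod.
Proof.
move=> X Y g f gS; have [x xE] := choice (fun i => gS (f (gen i))).
exists (idem_lift x).
apply: (idem_map_ext (F := g \o idem_lift x)) => i /=.
by rewrite idem_lift_gen linearZ_LR /= xE -linearZ_LR eps_gen.
Qed.

(** Nakayama: if [N] and [K] span and [K] has coordinates in the first layer
    [R 1], each generator is congruent to an element of [N] modulo [R 1]; hence
    everything with coordinates in [R m] is, modulo [R m.+1], in [N]. *)
Lemma idem_superfluous (R : nat -> A -> Prop) (n : nat) (K : submodClosed idemmod) :
  (forall x, R 0 x) -> (forall m, R m 0) ->
  (forall m x y, R m x -> R m y -> R m (x + y)) ->
  (forall m x y, R m x -> R 1 y -> R m.+1 (x * y)) ->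
  (forall x, R n x -> x = 0) ->
  (forall f, f \in (K : {pred idemmod}) -> forall i, R 1 (coord f i)) ->
  superfluous K.
Proof.
move=> R0 Rz RD RM Rn KR N NK f.
have gP i : exists y, y \in (K : {pred idemmod}) /\ gen i - y \in (N : {pred idemmod}).
  have [y [z [yK zN ->]]] := NK (gen i); exists y; split=> //.
  by rewrite addrC addKr.
have [y yP] := choice gP.
suff H j : forall m, (m + j)%N = n -> forall f0, (forall i, R m (coord f0 i)) ->
    f0 \in (N : {pred idemmod}).
  by apply: (H n 0).
elim: j => [|j IH] m mj f0 fR.
  rewrite (_ : f0 = 0) ?rpred0 //; apply: idemmodP => i.
  by rewrite coord0; apply: Rn; rewrite -mj addn0.
rewrite (idemmodE f0).
rewrite (eq_bigr (fun i => coord f0 i *: (gen i - y i) + coord f0 i *: y i)); last first.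
  by move=> i _; rewrite -scalerDr subrK.
rewrite big_split rpredD //=.
  by apply: rpred_sum => i _; apply: rpredZ; exact: (yP i).2.
apply: (IH m.+1); first by rewrite addSnnS.
move=> i; rewrite coord_sum; apply: big_ind => // [|l _]; first exact: RD.
by rewrite coordZ; apply: RM => //; apply: KR; exact: (yP l).1.
Qed.
End IdempotentModules.

(** * Tensor products of algebras *)

Section TensorProduct.
Variables (k : fieldType) (A B : pzAlgType k).
Local Notation F := (psalg k (pairmon A B)).
Local Notation T := (tensor A B).
Local Notation pure := (@tensor_pure k A B).
Local Notation mono c x := (<< c *g (x : pairmon A B) >> : F).
Local Opaque ps_mul.

Lemma tensor_rel_eq (r s : F) : tensor_rel (r - s) ->
  qproj (ideal_gen (@tensor_rel k A B)) r = qproj _ s.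
Proof. by move=> rP; apply/qpiP/asboolP => J; exact. Qed.

Lemma pureDl a a' b : pure (a + a') b = pure a b + pure a' b.
Proof. by rewrite -(raddfD (qproj _)); apply: tensor_rel_eq; exact: TensorDl. Qed.
Lemma pureDr a b b' : pure a (b + b') = pure a b + pure a b'.
Proof. by rewrite -(raddfD (qproj _)); apply: tensor_rel_eq; exact: TensorDr. Qed.
Lemma pureZl c a b : pure (algin c * a) b = algin c * pure a b.
Proof.
rewrite -[algin c in RHS]/(qproj _ (algin c)) -(rmorphM (qproj _)).
by apply: tensor_rel_eq; exact: TensorZl.
Qed.
Lemma pureZr c a b : pure a (algin c * b) = algin c * pure a b.
Proof.
rewrite -[algin c in RHS]/(qproj _ (algin c)) -(rmorphM (qproj _)).
by apply: tensor_rel_eq; exact: TensorZr.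
Qed.
Lemma free_pairM (a a' : A) (b b' : B) :
  free_pair a b * free_pair a' b' = free_pair (a * a') (b * b').
Proof. by rewrite -[LHS]/(ps_mul _ _) ps_mulUU mulr1. Qed.

Lemma pureM a a' b b' : pure a b * pure a' b' = pure (a * a') (b * b').
Proof. by rewrite -(rmorphM (qproj _)) free_pairM. Qed.
Lemma pure11 : pure 1 1 = 1.
Proof.
rewrite -[RHS](rmorph1 (qproj _)); congr (qproj _ _).
by rewrite -[RHS]/(ps_scalar _ 1) /ps_scalar big_seq1.
Qed.

Lemma psalg_UE (c : k) (x : pairmon A B) :
  << c *g x >> = algin c * free_pair x.1 x.2 :> F.
Proof. by rewrite -[RHS]/(ps_mul (ps_scalar _ c) _) ps_scalarMU mulr1; case: x. Qed.

Lemma tensor_ind (P : T -> Prop) : P 0 -> (forall x y, P x -> P y -> P (x + y)) ->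
  (forall a b, P (pure a b)) -> forall t, P t.
Proof.
move=> P0 PD Pp t; rewrite -(qreprK t) -[qpi _ _]/(qproj _ _).
rewrite (monalgE (qrepr t)) raddf_sum; apply: big_ind => // x _.
rewrite psalg_UE -[X in P X]/(qproj _ (algin _ * free_pair _ _)) (rmorphM (qproj _)).
by rewrite -[X in P X]/((algin (qrepr t)@_x : T) * pure x.1 x.2) -pureZl.
Qed.

Section Lift.
Variables (W : zmodType) (beta : A -> B -> W).
Hypothesis bDl : forall b, {morph beta^~ b : a a' / a + a'}.
Hypothesis bDr : forall a, {morph beta a : b b' / b + b'}.
Hypothesis bZ : forall c a b, beta (algin c * a) b = beta a (algin c * b).

Variable bext : F -> W.
Hypothesis bextB : zmod_morphism bext.
Hypothesis bextU : forall c x, bext << c *g x >> = beta (algin c * x.1) x.2.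

Let bker : {pred F} := fun f => `[< forall g h, bext (g * f * h) = 0 >].
Let bker_zmod : zmod_closed bker.
Proof.
split=> [|f f' /asboolP f0 /asboolP f'0]; apply/asboolP => g h.
  by rewrite mulr0 mul0r; have := bextB 0 0; rewrite !subrr.
rewrite mulrBr mulrBl bextB.
exact: etrans (congr2 (fun x y => x - y) (f0 g h) (f'0 g h)) (subrr 0).
Qed.
HB.instance Definition _ := GRing.isZmodClosed.Build F bker bker_zmod.
Let bker_Ml a f : f \in bker -> a * f \in bker.
Proof. by move=> /asboolP f0; apply/asboolP => g h; rewrite mulrA f0. Qed.
Let bker_Mr a f : f \in bker -> f * a \in bker.
Proof. by move=> /asboolP f0; apply/asboolP => g h; rewrite mulrA -mulrA f0. Qed.
HB.instance Definition _ := isTwoSided.Build F bker bker_Ml bker_Mr.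

Let bext_pair c (x : pairmon A B) d (y : pairmon A B) e a b :
  bext (mono c x * (algin e * free_pair a b) * mono d y)
  = beta (algin (c * e * d) * (x.1 * a * y.1)) (x.2 * b * y.2).
Proof.
have -> : algin e * free_pair a b = mono e (a, b).
  by rewrite psalg_UE.
have -> : mono c x * mono e (a, b) * mono d y
   = mono (c * e * d) (x.1 * a * y.1, x.2 * b * y.2).
  rewrite -[LHS]/(ps_mul (ps_mul _ _) _) ps_mulUU.
  exact: ps_mulUU.
by rewrite bextU.
Qed.

(** Additive maps out of the tensor product need no multiplicativity, whereas
    the relations are imposed as an ideal. So the kernel of the extension is
    tested after multiplication by arbitrary elements on both sides; this makes
    it an ideal, and it still contains the relations. *)
Lemma tensor_lift_free :
  exists f : T -> W, zmod_morphism f /\ forall a b, f (pure a b) = beta a b.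
Proof.
have relK r : tensor_rel r -> r \in bker.
  move=> rP; apply/asboolP => g h; rewrite -[RHS](_ : (fun=> 0) g = 0) //.
  move: g; apply: malg_ext => [g g'|g g'|c x].
  - by rewrite !mulrBl bextB.
  - by rewrite subrr.
  rewrite -[RHS](_ : (fun=> 0) h = 0) //; move: h; apply: malg_ext => [h h'|h h'|d y].
  - by rewrite mulrBr bextB.
  - by rewrite subrr.
  have [M [ME MB MP MPe]] : exists M : F -> W,
    [/\ forall f, bext (mono c x * f * mono d y) = M f, zmod_morphism M,
      forall a b, M (free_pair a b)
        = beta (algin (c * d) * (x.1 * a * y.1)) (x.2 * b * y.2) &
      forall e a b, M (algin e * free_pair a b)
        = beta (algin (c * e * d) * (x.1 * a * y.1)) (x.2 * b * y.2)].
    exists (fun f => bext (mono c x * f * mono d y)); split=> // [f g|a b].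
      by rewrite mulrBr mulrBl bextB.
    by have := bext_pair c x d y 1 a b; rewrite rmorph1 mul1r mulr1.
  have MD : {morph M : f g / f + g}.
    by move=> f g; apply: (addIr (- M g)); rewrite -MB !addrK.
  rewrite ME; case: {r} rP => [a a' b|a b b'|e a b|e a b].
  - by rewrite MB MD !MP mulrDr mulrDl mulrDr bDl subrr.
  - by rewrite MB MD !MP mulrDr mulrDl bDr subrr.
  - rewrite MB MP MPe; apply/eqP; rewrite subr_eq0; apply/eqP; congr beta.
    rewrite !rmorphM -!mulrA; congr (_ * _).
    by rewrite !mulrA -!(algin_central e) -!mulrA.
  rewrite MB MP MPe; apply/eqP; rewrite subr_eq0; apply/eqP.
  have -> : x.2 * (algin e * b) * y.2 = algin e * (x.2 * b * y.2).
    by rewrite !mulrA algin_central.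
  by rewrite -bZ mulrA -rmorphM mulrA (mulrC e).
have E f g : f - g \in (ideal_gen (@tensor_rel k A B) : {pred F}) -> bext f = bext g.
  move=> /asboolP/(_ bker relK)/asboolP/(_ 1 1).
  by rewrite mul1r mulr1 bextB => /eqP; rewrite subr_eq0 => /eqP.
have Ep f : bext (qrepr (qproj _ f : T)) = bext f by apply: E; exact: qrepr_qpi.
exists (fun t => bext (qrepr t)); split=> [s t|a b].
  by rewrite -(qreprK s) -(qreprK t) -![qpi _ _]/(qproj _ _) -(raddfB (qproj _)) !Ep bextB.
by rewrite Ep bextU rmorph1 mul1r.
Qed.
End Lift.

Lemma tensor_lift (W : zmodType) (beta : A -> B -> W) :
  (forall b, {morph beta^~ b : a a' / a + a'}) ->
  (forall a, {morph beta a : b b' / b + b'}) ->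
  (forall c a b, beta (algin c * a) b = beta a (algin c * b)) ->
  exists f : T -> W, zmod_morphism f /\ forall a b, f (pure a b) = beta a b.
Proof.
move=> bDl bDr bZ.
have hB (x : pairmon A B) : zmod_morphism (fun c : k => beta (algin c * x.1) x.2).
  by apply: morphD_zmod => c d; rewrite raddfD mulrDl bDl.
pose bext : F -> W := fext (fun (x : pairmon A B) c => beta (algin c * x.1) x.2).
have bextB : zmod_morphism bext := fextB hB.
have bextU c x : bext << c *g x >> = beta (algin c * x.1) x.2 := fextU hB x c.
exact: (tensor_lift_free bDl bDr bZ bextB bextU).
Qed.
End TensorProduct.

(** * Two-sided actions *)

(** Everything that the argument uses of an enveloping algebra. Since [pure x y]
    acts on a bimodule by [x] on the left and [y] on the right, the second
    factors multiply in the opposite order. *)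
Record env_basis (k : fieldType) (L A : pzAlgType k) (pure : L -> L -> A) : Prop := {
  eb_Dl : forall y x x', pure (x + x') y = pure x y + pure x' y;
  eb_Dr : forall x y y', pure x (y + y') = pure x y + pure x y';
  eb_Zl : forall c x y, pure (algin c * x) y = algin c * pure x y;
  eb_Zr : forall c x y, pure x (algin c * y) = algin c * pure x y;
  eb_M : forall x y x' y', pure x y * pure x' y' = pure (x * x') (y' * y);
  eb_1 : pure 1 1 = 1;
  eb_ind : forall P : A -> Prop, P 0 -> (forall s t, P s -> P t -> P (s + t)) ->
    (forall x y, P (pure x y)) -> forall t, P t;
  eb_lift : forall (W : zmodType) (beta : L -> L -> W),
    (forall y, {morph beta^~ y : x x' / x + x'}) ->
    (forall x, {morph beta x : y y' / y + y'}) ->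
    (forall c x y, beta (algin c * x) y = beta x (algin c * y)) ->
    exists f : A -> W, zmod_morphism f /\ forall x y, f (pure x y) = beta x y
}.

Lemma envalg_basis (k : fieldType) (L : pzAlgType k) :
  env_basis (fun x y : L => tensor_pure x (y : L^c) : envalg L).
Proof.
split=> [y x x'|x y y'|c x y|c x y|x y x' y'||P P0 PD Pp|W b bDl bDr bZ].
- exact: pureDl.
- exact: (@pureDr _ L L^c).
- exact: pureZl.
- by rewrite algin_central; exact: (@pureZr _ L L^c).
- exact: (@pureM _ L L^c).
- exact: (@pure11 _ L L^c).
- exact: tensor_ind.
apply: (@tensor_lift _ L L^c W b bDl bDr) => c x y.
by rewrite bZ algin_central.
Qed.

Lemma regenv_act (k : fieldType) (L : pzAlgType k) (x y : L) (m : regenv L) :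
  (tensor_pure x (y : L^c) : envalg L) *: m = x * ((m : L) * y).
Proof. exact: env_pureE. Qed.

Section TwoSidedActions.
Variables (k : fieldType) (L A : pzAlgType k) (pure : L -> L -> A).
Hypothesis env : env_basis pure.
Implicit Types (M N : lmodType A) (x y : L) (c : k).

Definition lmul M x (m : M) : M := pure x 1 *: m.
Definition rmul M x (m : M) : M := pure 1 x *: m.

Lemma pure_zmodl y : zmod_morphism (pure^~ y).
Proof. by apply: morphD_zmod => x x'; exact: (eb_Dl env). Qed.
Lemma pure_zmodr x : zmod_morphism (pure x).
Proof. by apply: morphD_zmod => y y'; exact: (eb_Dr env). Qed.
Lemma pure0l y : pure 0 y = 0.
Proof. by have := pure_zmodl y 0 0; rewrite /= !subrr. Qed.
Lemma pure0r x : pure x 0 = 0.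
Proof. by have := pure_zmodr x 0 0; rewrite !subrr. Qed.

Lemma pure_lr M x y (m : M) : pure x y *: m = lmul x (rmul y m).
Proof. by rewrite /lmul /rmul scalerA (eb_M env) mulr1 mulr1. Qed.
Lemma lmulA M x y (m : M) : lmul x (lmul y m) = lmul (x * y) m.
Proof. by rewrite /lmul scalerA (eb_M env) mulr1. Qed.
Lemma rmulA M x y (m : M) : rmul y (rmul x m) = rmul (x * y) m.
Proof. by rewrite /rmul scalerA (eb_M env) mulr1. Qed.
Lemma lrmulC M x y (m : M) : lmul x (rmul y m) = rmul y (lmul x m).
Proof. by rewrite /lmul /rmul !scalerA !(eb_M env) !mulr1 !mul1r. Qed.
Lemma lmulDl M x y (m : M) : lmul (x + y) m = lmul x m + lmul y m.
Proof. by rewrite /lmul (eb_Dl env) scalerDl. Qed.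
Lemma rmulDl M x y (m : M) : rmul (x + y) m = rmul x m + rmul y m.
Proof. by rewrite /rmul (eb_Dr env) scalerDl. Qed.
Lemma lmulDr M x (m m' : M) : lmul x (m + m') = lmul x m + lmul x m'.
Proof. exact: scalerDr. Qed.
Lemma rmulDr M x (m m' : M) : rmul x (m + m') = rmul x m + rmul x m'.
Proof. exact: scalerDr. Qed.
Lemma lmulBr M x (m m' : M) : lmul x (m - m') = lmul x m - lmul x m'.
Proof. exact: scalerBr. Qed.
Lemma rmulBr M x (m m' : M) : rmul x (m - m') = rmul x m - rmul x m'.
Proof. exact: scalerBr. Qed.
Lemma lmul0r M x : lmul x (0 : M) = 0.
Proof. exact: scaler0. Qed.
Lemma rmul0r M x : rmul x (0 : M) = 0.
Proof. exact: scaler0. Qed.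
Lemma lmul0l M (m : M) : lmul 0 m = 0.
Proof. by apply: (addIr (lmul 0 m)); rewrite -lmulDl !add0r. Qed.
Lemma rmul0l M (m : M) : rmul 0 m = 0.
Proof. by apply: (addIr (rmul 0 m)); rewrite -rmulDl !add0r. Qed.
Lemma lmul1 M (m : M) : lmul 1 m = m.
Proof. by rewrite /lmul (eb_1 env) scale1r. Qed.
Lemma rmul1 M (m : M) : rmul 1 m = m.
Proof. by rewrite /rmul (eb_1 env) scale1r. Qed.
Lemma lmul_algin M c (m : M) : lmul (algin c) m = (algin c : A) *: m.
Proof. by rewrite /lmul -[algin c in LHS]mulr1 (eb_Zl env) (eb_1 env) mulr1. Qed.
Lemma rmul_algin M c (m : M) : rmul (algin c) m = (algin c : A) *: m.
Proof. by rewrite /rmul -[algin c in LHS]mulr1 (eb_Zr env) (eb_1 env) mulr1. Qed.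
Lemma lmulZ M x (a : k) (m : M) : lmul x ((algin a : A) *: m) = (algin a : A) *: lmul x m.
Proof. by rewrite /lmul !scalerA algin_central. Qed.
Lemma rmulZ M x (a : k) (m : M) : rmul x ((algin a : A) *: m) = (algin a : A) *: rmul x m.
Proof. by rewrite /rmul !scalerA algin_central. Qed.
Lemma lmul_sumr M x (J : Type) (r : seq J) (P : pred J) (F : J -> M) :
  lmul x (\sum_(j <- r | P j) F j) = \sum_(j <- r | P j) lmul x (F j).
Proof. exact: scaler_sumr. Qed.
Lemma rmul_sumr M x (J : Type) (r : seq J) (P : pred J) (F : J -> M) :
  rmul x (\sum_(j <- r | P j) F j) = \sum_(j <- r | P j) rmul x (F j).
Proof. exact: scaler_sumr. Qed.
Lemma lmul_suml M (m : M) (J : Type) (r : seq J) (P : pred J) (F : J -> L) :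
  lmul (\sum_(j <- r | P j) F j) m = \sum_(j <- r | P j) lmul (F j) m.
Proof. by apply: (big_morph (fun x => lmul x m)) => [x y|]; rewrite ?lmulDl ?lmul0l. Qed.

Lemma lin_lmul M N (f : {linear M -> N}) x m : f (lmul x m) = lmul x (f m).
Proof. exact: linearZ_LR. Qed.
Lemma lin_rmul M N (f : {linear M -> N}) x m : f (rmul x m) = rmul x (f m).
Proof. exact: linearZ_LR. Qed.

Lemma bimod_linear M N (f : M -> N) : {morph f : m m' / m + m'} ->
  (forall x m, f (lmul x m) = lmul x (f m)) ->
  (forall x m, f (rmul x m) = rmul x (f m)) -> linear f.
Proof.
move=> fD fl fr a m m'; rewrite fD; congr (_ + _); elim/(eb_ind env): a => [|a b IHa IHb|a b].
- by rewrite !scale0r; apply: (addIr (f 0)); rewrite -fD !add0r.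
- by rewrite !scalerDl fD IHa IHb.
by rewrite !pure_lr fl fr.
Qed.
End TwoSidedActions.

(** * Path algebras *)

(** Everything that the argument uses of a path algebra. Stating it for an
    arbitrary algebra keeps finitely supported functions out of the proofs
    below. *)
Record path_basis (k : fieldType) (Q : quiver) (R : pzAlgType k)
    (pelt : qpath Q -> R) (cf : qpath Q -> R -> k) : Prop := {
  pb_mul : forall p q r, path_comp p q = Some r -> pelt p * pelt q = pelt r;
  pb_mul0 : forall p q, path_comp p q = None -> pelt p * pelt q = 0;
  pb_one : \sum_v pelt (vertex_path v) = 1;
  pb_ind : forall P : R -> Prop, P 0 -> (forall x y, P x -> P y -> P (x + y)) ->
    (forall c p, P (algin c * pelt p)) -> forall x, P x;
  pb_ext : forall (W : zmodType) (h : qpath Q -> k -> W),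
    (forall p, zmod_morphism (h p)) ->
    exists f : R -> W, zmod_morphism f /\ forall c p, f (algin c * pelt p) = h p c;
  pb_cfB : forall p, zmod_morphism (cf p);
  pb_cfE : forall c p q, cf p (algin c * pelt q) = if q == p then c else 0
}.

Definition psize (Q : quiver) (p : qpath Q) : nat := size (val p).2.

Section PathAlgebra.
Variables (k : fieldType) (Q : quiver).
Local Notation R := (pathalg k Q).
Implicit Types (p q : qpath Q) (x y : R).

Lemma psalg_scale (c : k) p : << c *g p >> = algin c * ps_elt k p :> R.
Proof. by rewrite -[RHS]/(ps_mul (ps_scalar _ c) _) ps_scalarMU mulr1. Qed.

Lemma pathalg_basis : path_basis (fun p => ps_elt k p : R) (fun p x => x@_p).
Proof.
split=> [p q r E|p q E||P P0 PD Pp x|W h hB|p x y|c p q].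
- by rewrite -[LHS]/(ps_mul _ _) ps_mulUU -[pmul p q]/(path_comp p q) E mulr1.
- by rewrite -[LHS]/(ps_mul _ _) ps_mulUU -[pmul p q]/(path_comp p q) E.
- by rewrite -[RHS]/(ps_scalar _ 1) /ps_scalar big_map big_enum.
- by rewrite (monalgE x); apply: big_ind => // p _; rewrite psalg_scale.
- exists (fext h); split=> [|c p]; first exact: (fextB hB).
  by rewrite -psalg_scale; exact: (fextU hB).
- exact: mcoeffB.
by rewrite -psalg_scale mcoeffU; case: eqP.
Qed.

(** The [m]-th power of the arrow ideal, read off coefficients. *)
Definition level m : {pred R} := fun x => `[< forall p, (psize p < m)%N -> x@_p = 0 >].

Lemma level_mul i j x y : x \in level i -> y \in level j -> x * y \in level (i + j).
Proof.
move=> /asboolP xi /asboolP yj; apply/asboolP => p pij.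
rewrite -[x * y]/(ps_mul x y) /ps_mul.
have coefB : zmod_morphism (fun z : R => z@_p) by move=> u w; rewrite mcoeffB.
rewrite (zmod_morph_sum coefB) big1 // => q _.
rewrite (zmod_morph_sum coefB) big1 // => r _.
have [qi|qi] := ltnP (psize q) i; first by rewrite xi // mul0r; case: pmul => [?|]; rewrite /= ?monalgU0 mcoeff0.
have [rj|rj] := ltnP (psize r) j; first by rewrite yj // mulr0; case: pmul => [?|]; rewrite /= ?monalgU0 mcoeff0.
case E : (pmul q r) => [t|]; last by rewrite mcoeff0.
rewrite /= mcoeffU; case: eqP => // tp; move: pij; rewrite ltnNge => /negP[].
have /path_compP[_ tE] := E.
by rewrite /psize -tp tE size_cat leq_add.
Qed.

Section Level.
Variable m : nat.
Fact level_zmod : zmod_closed (level m).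
Proof.
split; first by apply/asboolP => p _; rewrite mcoeff0.
move=> x y /asboolP xm /asboolP ym; apply/asboolP => p pm.
by rewrite mcoeffB xm // ym // subrr.
Qed.
HB.instance Definition _ := GRing.isZmodClosed.Build R (level m) level_zmod.
Lemma level_all x : x \in level 0.
Proof. exact/asboolP. Qed.
Fact level_Ml x y : y \in level m -> x * y \in level m.
Proof. exact: level_mul (level_all x). Qed.
Fact level_Mr x y : y \in level m -> y * x \in level m.
Proof. by rewrite -[m in _ -> _ \in level m]addn0 => ym; exact: level_mul ym (level_all x). Qed.
HB.instance Definition _ := isTwoSided.Build R (level m) level_Ml level_Mr.
End Level.

Lemma level_pow m x : x \in (ideal_pow (arrow_ideal k Q) m : {pred R}) -> x \in level m.
Proof.
elim: m x => [|m IH] x; first by move=> _; exact: level_all.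
move=> /asboolP/(_ (level m.+1)); apply => _ [y [z [yF zm ->]]].
apply: (@level_mul 1 m); last exact: IH.
move: yF => /asboolP/(_ (level 1)); apply => _ [a ->].
apply/asboolP => p p0; rewrite mcoeffU; case: eqP => // E.
by move: p0; rewrite -E.
Qed.

End PathAlgebra.

(** * Bound quiver algebras *)

Section BoundQuiver.
Variables (k : fieldType) (Q : quiver) (R : pzAlgType k).
Variables (pelt : qpath Q -> R) (cf : qpath Q -> R -> k).
Hypothesis basis : path_basis pelt cf.
Implicit Types (p q r : qpath Q) (v w : vertex Q) (a : arrow Q) (s : seq (arrow Q)).

Local Notation vpath v := (@vertex_path Q v).
Definition vx v : R := pelt (vpath v).
Definition ar a : R := pelt (arrow_path a).
Definition pend p := path_end (val p).1 (val p).2.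

Lemma pelt_mul_neq p q : pend p != (val q).1 -> pelt p * pelt q = 0.
Proof. by move=> pq; apply: (pb_mul0 basis); rewrite /path_comp -/(pend p) (negPf pq). Qed.

Lemma pelt_mul_eq p q r : pend p = (val q).1 ->
  val r = ((val p).1, (val p).2 ++ (val q).2) -> pelt p * pelt q = pelt r.
Proof. by move=> pq rE; apply: (pb_mul basis); apply/path_compP. Qed.

Lemma pelt_mulP p q : pelt p * pelt q = 0 \/
  exists r, pelt p * pelt q = pelt r /\ psize r = (psize p + psize q)%N.
Proof.
case E : (path_comp p q) => [r|]; last by left; exact: (pb_mul0 basis).
right; exists r; split; first exact: (pb_mul basis).
by have /path_compP[_ rE] := E; rewrite /psize rE size_cat.
Qed.

Lemma vx_mul v w : vx v * vx w = if v == w then vx v else 0.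
Proof.
case: eqP => [<-|/eqP vw]; first exact: pelt_mul_eq.
exact: pelt_mul_neq.
Qed.
Lemma vxK v : vx v * vx v = vx v.
Proof. by rewrite vx_mul eqxx. Qed.

Lemma vx_pelt p : vx (val p).1 * pelt p = pelt p.
Proof. by apply: pelt_mul_eq => //; case: (val p). Qed.
Lemma pelt_vx p : pelt p * vx (pend p) = pelt p.
Proof. by apply: pelt_mul_eq => //; rewrite cats0; case: (val p). Qed.
Lemma vx_ar a : vx (source a) * ar a = ar a.
Proof. exact: (vx_pelt (arrow_path a)). Qed.
Lemma ar_vx a : ar a * vx (target a) = ar a.
Proof. exact: (pelt_vx (arrow_path a)). Qed.

Fixpoint word s : R := if s is a :: s' then ar a * word s' else 1.

Lemma word_cat s t : word (s ++ t) = word s * word t.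
Proof. by elim: s => [|a s IH] /=; rewrite ?mul1r // IH mulrA. Qed.

Lemma pelt_word p : pelt p = vx (val p).1 * word (val p).2.
Proof.
case: p => -[v s] /=; elim: s v => [|a s IH] v p /=.
  by rewrite mulr1; congr pelt; apply: val_inj.
have /= /andP[/eqP av sp] := p.
have := IH (target a) sp; rewrite /= => E.
have -> : pelt (exist (fun u : vertex Q * seq (arrow Q) => is_path u.1 u.2) (v, a :: s) p)
    = ar a * pelt (exist (fun u : vertex Q * seq (arrow Q) => is_path u.1 u.2) (target a, s) sp).
  by apply/esym/pelt_mul_eq => //=; rewrite av.
by rewrite E !mulrA ar_vx -av vx_ar.
Qed.

(** Every path is a product of arrows. *)
Lemma path_gen_ind (P : R -> Prop) : (forall x y, P x -> P y -> P (x + y)) ->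
  (forall x y, P x -> P y -> P (x * y)) -> (forall c, P (algin c)) ->
  (forall v, P (vx v)) -> (forall a, P (ar a)) -> forall x, P x.
Proof.
move=> PD PM Pc Pv Pa; apply: (pb_ind basis) => // [|c p].
  by rewrite -(raddf0 (algin : k -> R)); exact: Pc.
rewrite pelt_word; apply: (PM) => //; apply: (PM) => //.
elim: (val p).2 => [|a s IH] /=; last exact: PM.
by rewrite -(rmorph1 (algin : k -> R)); exact: Pc.
Qed.

Lemma long_path_pow (F : ideal R) n p : (forall a, ar a \in (F : {pred R})) ->
  (n <= psize p)%N -> pelt p \in (ideal_pow F n : {pred R}).
Proof.
move=> aF np; rewrite pelt_word -(cat_take_drop n (val p).2) word_cat.
apply: Defs.idealMl; apply: Defs.idealMr.
have {2}<- : size (take n (val p).2) = n by rewrite size_takel.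
elim: (take n _) => [|a s IH] /=; first by apply/asboolP => J; exact.
by apply/asboolP => J; apply; exists (ar a), (word s).
Qed.

Lemma cf_algin p c x : cf p (algin c * x) = c * cf p x.
Proof.
have cfD : {morph cf p : x y / x + y}.
  move=> y z; apply: (addIr (- cf p z)).
  by rewrite -(pb_cfB basis) !addrK.
have cf0 : cf p 0 = 0 by apply: (addIr (cf p 0)); rewrite -cfD !add0r.
move: x; apply: (pb_ind basis) => [|x y IHx IHy|d q].
- by rewrite mulr0 cf0 mulr0.
- by rewrite mulrDr !cfD IHx IHy mulrDr.
by rewrite mulrA -rmorphM !(pb_cfE basis); case: eqP => _; rewrite ?mulr0.
Qed.

Variables (I : ideal R) (n : nat).
Hypothesis longI : forall p, (n <= psize p)%N -> pelt p \in (I : {pred R}).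
Hypothesis I2 : forall x, x \in (I : {pred R}) -> forall p, (psize p < 2)%N -> cf p x = 0.

Variables (L A : pzAlgType k) (pi : {rmorphism R -> L}) (rep : L -> R) (pure : L -> L -> A).
Hypothesis repK : cancel rep pi.
Hypothesis pi_ker : forall x, pi x = 0 <-> x \in (I : {pred R}).
Hypothesis pi_algin : forall c, pi (algin c) = algin c.
Hypothesis env : env_basis pure.

Lemma proj_onto (x : L) : exists y, x = pi y.
Proof. by exists (rep x); rewrite repK. Qed.

Definition vL v : L := pi (vx v).
Definition aL a : L := pi (ar a).

Lemma vL_mul v w : vL v * vL w = if v == w then vL v else 0.
Proof. by rewrite -(rmorphM pi) vx_mul; case: eqP => _; rewrite ?raddf0. Qed.
Lemma vLK v : vL v * vL v = vL v.
Proof. by rewrite vL_mul eqxx. Qed.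
Lemma sum_vL : \sum_v vL v = 1.
Proof. by rewrite -(rmorph1 pi) -(pb_one basis) raddf_sum. Qed.
Lemma vL_aL a : vL (source a) * aL a = aL a.
Proof. by rewrite -(rmorphM pi) vx_ar. Qed.
Lemma aL_vL a : aL a * vL (target a) = aL a.
Proof. by rewrite -(rmorphM pi) ar_vx. Qed.

(** For a path of length at most one this does not depend on the representative,
    because [I] lies in the square of the arrow ideal. *)
Definition lcf p (x : L) : k := cf p (rep x).

Section ShortCoefficient.
Variables (p : qpath Q) (p2 : (psize p < 2)%N).
Lemma lcf_pi x : lcf p (pi x) = cf p x.
Proof.
apply/eqP; rewrite -subr_eq0 -(pb_cfB basis) I2 //.
by apply/pi_ker; rewrite rmorphB repK subrr.
Qed.
Lemma lcfB : zmod_morphism (lcf p).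
Proof.
move=> x y; have [x' ->] := proj_onto x; have [y' ->] := proj_onto y.
by rewrite -rmorphB !lcf_pi (pb_cfB basis).
Qed.
Lemma lcfD : {morph lcf p : x y / x + y}.
Proof. by move=> x y; apply: (addIr (- lcf p y)); rewrite -lcfB !addrK. Qed.
Lemma lcf_algin c x : lcf p (algin c * x) = c * lcf p x.
Proof.
by have [y ->] := proj_onto x; rewrite -pi_algin -(rmorphM pi) !lcf_pi cf_algin.
Qed.
End ShortCoefficient.

Definition mono p q : A := pure (pi (pelt p)) (pi (pelt q)).

Lemma functional2 p q : (psize p < 2)%N -> (psize q < 2)%N ->
  exists f : A -> k, [/\ zmod_morphism f, forall c t, f (algin c * t) = c * f t &
    forall x y, f (pure x y) = lcf p x * lcf q y].
Proof.
move=> p2 q2.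
have [|||f [fB fE]] := eb_lift env (beta := fun x y => lcf p x * lcf q y).
- by move=> y x x'; rewrite lcfD // mulrDl.
- by move=> x y y'; rewrite lcfD // mulrDr.
- by move=> c x y; rewrite !lcf_algin // mulrCA mulrA.
have fD : {morph f : x y / x + y}.
  by move=> x y; apply: (addIr (- f y)); rewrite -fB !addrK.
exists f; split=> // c t; elim/(eb_ind env): t => [|x y IHx IHy|x y].
- by rewrite !mulr0 -(subrr (0 : A)) fB !subrr mulr0.
- by rewrite mulrDr !fD IHx IHy mulrDr.
by rewrite -(eb_Zl env) !fE lcf_algin // mulrA.
Qed.

(** * The radical filtration of the enveloping algebra *)

(** The powers of the radical of [A]: the radical is spanned by the tensors of
    paths that do not both have length zero. *)
Inductive layer (m : nat) : A -> Prop :=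
| layer0 : layer m 0
| layerS c p q t : (m <= psize p + psize q)%N -> layer m t ->
    layer m ((algin c : A) * mono p q + t).

Lemma layerD m x y : layer m x -> layer m y -> layer m (x + y).
Proof.
move=> xm ym; elim: xm => [|c p q t mpq _ IH]; first by rewrite add0r.
by rewrite -addrA; constructor.
Qed.

Lemma layer_gen m c p q : (m <= psize p + psize q)%N ->
  layer m ((algin c : A) * mono p q).
Proof. by move=> mpq; rewrite -[_ * _]addr0; constructor=> //; constructor. Qed.

Lemma layer_algin m c x : layer m x -> layer m ((algin c : A) * x).
Proof.
elim=> [|d p q t mpq _ IH]; first by rewrite mulr0; constructor.
by rewrite mulrDr mulrA -rmorphM; constructor.
Qed.

Lemma layer_all t : layer 0 t.
Proof.
elim/(eb_ind env): t => [|x y|x y]; [by constructor|exact: layerD|].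
have [x' ->] := proj_onto x; have [y' ->] := proj_onto y.
elim/(pb_ind basis): x' => [|x1 x2 IH1 IH2|c p].
- by rewrite rmorph0 (pure0l env); constructor.
- by rewrite rmorphD (eb_Dl env); exact: layerD.
rewrite rmorphM pi_algin (eb_Zl env); apply: layer_algin.
elim/(pb_ind basis): y' => [|x1 x2 IH1 IH2|d q].
- by rewrite rmorph0 (pure0r env); constructor.
- by rewrite rmorphD (eb_Dr env); exact: layerD.
rewrite rmorphM pi_algin (eb_Zr env).
exact: layer_gen.
Qed.

Lemma mono_mul p q p' q' : mono p q * mono p' q' = 0 \/
  exists r r', mono p q * mono p' q' = mono r r' /\
    (psize r + psize r' = (psize p + psize q) + (psize p' + psize q'))%N.
Proof.
rewrite /mono (eb_M env) -!(rmorphM pi).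
have [->|[r [-> rE]]] := pelt_mulP p p'.
  by left; rewrite rmorph0 (pure0l env).
have [->|[r' [-> rE']]] := pelt_mulP q' q.
  by left; rewrite rmorph0 (pure0r env).
by right; exists r, r'; split=> //; rewrite rE rE' [(psize q' + _)%N]addnC addnACA.
Qed.

Lemma layer_mul m l x y : layer m x -> layer l y -> layer (m + l) (x * y).
Proof.
move=> xm yl; elim: xm => [|c p q t mpq _ IH]; first by rewrite mul0r; constructor.
rewrite mulrDl; apply: layerD => //; rewrite -mulrA; apply: layer_algin.
elim: yl => [|d p' q' t' lpq _ IH']; first by rewrite mulr0; constructor.
rewrite mulrDr; apply: layerD => //.
rewrite mulrA -algin_central -mulrA; apply: layer_algin.
have [->|[r [r' [-> rE]]]] := mono_mul p q p' q'; first by constructor.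
rewrite -[mono r r']mul1r -(rmorph1 (algin : k -> A)); apply: layer_gen.
by rewrite rE leq_add.
Qed.

(** A pair of paths of total length [n + n] has a member of length at least
    [n], which is zero in [L]. *)
Lemma layer_top x : layer (n + n) x -> x = 0.
Proof.
elim=> [//|c p q t npq _ ->]; rewrite addr0 /mono.
have [np|pn] := leqP n (psize p).
  by move/longI/pi_ker: np => ->; rewrite (pure0l env) mulr0.
have nq : (n <= psize q)%N.
  by rewrite leqNgt; apply/negP => qn; move: npq; rewrite leqNgt -addnS leq_add // ltnW.
by move/longI/pi_ker: nq => ->; rewrite (pure0r env) mulr0.
Qed.

(** Modulo [layer 1] only the tensors of two vertices survive, and these are
    orthogonal idempotents. *)
Lemma layer_vertex t v w : exists c,
  layer 1 (t * mono (vpath v) (vpath w) - (algin c : A) * mono (vpath v) (vpath w)).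
Proof.
elim: (layer_all t) => [|c p q t' _ _ [c' IH]].
  by exists 0; rewrite mul0r (raddf0 algin) mul0r subrr; constructor.
have [|pq] := leqP 1 (psize p + psize q).
  move=> pq; exists c'; rewrite mulrDl -addrA; apply: layerD => //.
  by rewrite -[1%N]addn0; apply: layer_mul; [exact: layer_gen|exact: layer_all].
have vp r : psize r = 0%N -> exists u, r = vpath u.
  case: r => -[u s] rP; rewrite /psize /= => /size0nil s0.
  by exists u; apply: val_inj; rewrite /= s0.
have /andP[/eqP/vp[u ->] /eqP/vp[u' ->]] : (psize p == 0%N) && (psize q == 0%N).
  by rewrite -addn_eq0 -leqn0 -ltnS.
exists ((if (u == v) && (w == u') then c else 0) + c').
rewrite mulrDl raddfD mulrDl opprD addrACA; apply: layerD => //.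
rewrite -mulrA {1}/mono (eb_M env) -!/(vL _) !vL_mul.
case: eqP => [->|_]; last first.
  by rewrite (pure0l env) mulr0 raddf0 mul0r subrr; constructor.
case: eqP => [->|_] /=; first by rewrite subrr; constructor.
by rewrite (pure0r env) mulr0 raddf0 mul0r subrr; constructor.
Qed.

(** * Coefficients of products *)

Lemma cf_pelt p q : cf p (pelt q) = (q == p)%:R.
Proof.
have := pb_cfE basis 1 p q; rewrite rmorph1 mul1r => ->.
by case: eqP.
Qed.

Lemma lcf_pelt p q : (psize p < 2)%N -> lcf p (pi (pelt q)) = (q == p)%:R.
Proof. by move=> p2; rewrite lcf_pi // cf_pelt. Qed.

Lemma lcf0 p : (psize p < 2)%N -> lcf p 0 = 0.
Proof. by move=> p2; have := lcfB p2 0 0; rewrite !subrr. Qed.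

Lemma lcf_mul_long p q r : (psize p < 2)%N -> (psize p < psize q + psize r)%N ->
  lcf p (pi (pelt q) * pi (pelt r)) = 0.
Proof.
move=> p2 pqr; rewrite -rmorphM; have [->|[t [-> tE]]] := pelt_mulP q r.
  by rewrite rmorph0 lcf0.
rewrite lcf_pelt //; case: eqP => // tp.
by move: pqr; rewrite -tE tp ltnn.
Qed.

Lemma lcf_mul3_long p q r t : (psize p < 2)%N -> (psize p < psize q + psize r + psize t)%N ->
  lcf p (pi (pelt q) * pi (pelt r) * pi (pelt t)) = 0.
Proof.
move=> p2 pqr; rewrite -rmorphM; have [->|[u [-> uE]]] := pelt_mulP q r.
  by rewrite rmorph0 mul0r lcf0.
by apply: lcf_mul_long => //; rewrite uE.
Qed.

Lemma lcf_vertex_arrow v w a z : lcf (vpath v) (vL w * aL a * z) = 0.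
Proof.
have [z' ->] := proj_onto z; elim/(pb_ind basis): z' => [|x y IHx IHy|c q].
- by rewrite rmorph0 mulr0 lcf0.
- by rewrite rmorphD mulrDr lcfD // IHx IHy addr0.
rewrite rmorphM pi_algin mulrA -algin_central -mulrA lcf_algin //.
by rewrite lcf_mul3_long ?mulr0.
Qed.

(** * The standard presentation *)

Local Notation lm x m := (lmul pure x m).
Local Notation rm x m := (rmul pure x m).

Definition eps0 v : A := pure (vL v) (vL v).
Definition eps1 a : A := pure (vL (source a)) (vL (target a)).
Lemma eps0K v : eps0 v * eps0 v = eps0 v.
Proof. by rewrite /eps0 (eb_M env) !vLK. Qed.
Lemma eps1K a : eps1 a * eps1 a = eps1 a.
Proof. by rewrite /eps1 (eb_M env) !vLK. Qed.

Local Notation P0 := (idemmod eps0).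
Local Notation P1 := (idemmod eps1).
Definition g0 v : P0 := gen eps0K v.
Definition g1 a : P1 := gen eps1K a.

Lemma eps0_g0 v : eps0 v *: g0 v = g0 v.
Proof. exact: eps_gen. Qed.
Lemma eps1_g1 a : eps1 a *: g1 a = g1 a.
Proof. exact: eps_gen. Qed.
Lemma g0_l v : lm (vL v) (g0 v) = g0 v.
Proof. by rewrite -(eps0_g0 v) /eps0 (pure_lr env) (lmulA env) vLK. Qed.
Lemma g0_r v : rm (vL v) (g0 v) = g0 v.
Proof. by rewrite -(eps0_g0 v) /eps0 (pure_lr env) -(lrmulC env) (rmulA env) vLK. Qed.
Lemma g1_l a : lm (vL (source a)) (g1 a) = g1 a.
Proof. by rewrite -(eps1_g1 a) /eps1 (pure_lr env) (lmulA env) vLK. Qed.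
Lemma g1_r a : rm (vL (target a)) (g1 a) = g1 a.
Proof. by rewrite -(eps1_g1 a) /eps1 (pure_lr env) -(lrmulC env) (rmulA env) vLK. Qed.

(** [P0] is the tensor square of [L] over the span of the vertices, and this is
    the tensor of [1] with [1]. *)
Definition unitP0 : P0 := \sum_v g0 v.
Local Notation U := unitP0.

Lemma lmul_U v : lm (vL v) U = g0 v.
Proof.
rewrite lmul_sumr (bigD1 v) //= g0_l big1 ?addr0 // => w wv.
by rewrite -g0_l (lmulA env) vL_mul eq_sym (negPf wv) (lmul0l env).
Qed.
Lemma rmul_U v : rm (vL v) U = g0 v.
Proof.
rewrite rmul_sumr (bigD1 v) //= g0_r big1 ?addr0 // => w wv.
by rewrite -g0_r (rmulA env) vL_mul (negPf wv) (rmul0l env).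
Qed.
Lemma eps0_U v : eps0 v *: U = g0 v.
Proof. by rewrite /eps0 (pure_lr env) rmul_U g0_l. Qed.
Lemma coord_U v : coord U v = eps0 v.
Proof.
rewrite /U coord_sum (bigD1 v) //= coord_gen eqxx big1 ?addr0 // => w wv.
by rewrite coord_gen eq_sym (negPf wv).
Qed.
Lemma P0_cyclic (f : P0) : f = (\sum_v coord f v) *: U.
Proof.
rewrite [LHS](idemmodE eps0K) scaler_suml; apply: eq_bigr => v _.
by rewrite -[in RHS]coord_idem -scalerA eps0_U.
Qed.

Definition commU x : P0 := lm x U - rm x U.

Variables (N : lmodType A) (iota : L -> N) (jota : N -> L).
Hypothesis iotaD : {morph iota : x y / x + y}.
Hypotheses (iotaK : cancel iota jota) (jotaK : cancel jota iota).
Hypothesis iota_act : forall x y z, pure x y *: iota z = iota (x * z * y).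

Lemma jotaD : {morph jota : x y / x + y}.
Proof. by move=> x y; apply: (can_inj iotaK); rewrite iotaD !jotaK. Qed.
Lemma iota0 : iota 0 = 0.
Proof. by apply: (addIr (iota 0)); rewrite -iotaD !add0r. Qed.
Lemma jota0 : jota 0 = 0.
Proof. by rewrite -iota0 iotaK. Qed.
Lemma iota_l x y : lm x (iota y) = iota (x * y).
Proof. by rewrite /lmul iota_act mulr1. Qed.
Lemma iota_r x y : rm x (iota y) = iota (y * x).
Proof. by rewrite /rmul iota_act mul1r. Qed.

Definition d0 : {linear P0 -> N} := idem_lift (fun _ : vertex Q => iota 1).
Definition d1 : {linear P1 -> P0} := idem_lift (fun a => commU (aL a)).

Lemma d0_g0 v : d0 (g0 v) = iota (vL v).
Proof. by rewrite [LHS]idem_lift_gen iota_act mulr1 vLK. Qed.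
Lemma d0_U : d0 U = iota 1.
Proof.
rewrite linear_sum -sum_vL (big_morph iota iotaD iota0).
by apply: eq_bigr => v _; rewrite d0_g0.
Qed.
Lemma d0_comm x : d0 (commU x) = 0.
Proof. by rewrite linearB /= lin_lmul lin_rmul d0_U iota_l iota_r mulr1 mul1r subrr. Qed.

Lemma d1_g1 a : d1 (g1 a) = commU (aL a).
Proof.
rewrite [LHS]idem_lift_gen (pure_lr env) rmulBr lmulBr /commU; congr (_ - _).
  rewrite -{1}(aL_vL a) -{1}(lmulA env) lmul_U -(lrmulC env) g0_r.
  by rewrite (lmulA env) vL_aL -lmul_U (lmulA env) aL_vL.
rewrite -{1}(vL_aL a) -{1}(rmulA env) rmul_U (rmulA env) aL_vL (lrmulC env) g0_l.
by rewrite -rmul_U (rmulA env) vL_aL.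
Qed.

Lemma d0_d1 y : d0 (d1 y) = 0.
Proof.
rewrite -[d1 y]/(\sum_a coord y a *: commU (aL a)) linear_sum big1 // => a _.
by rewrite linearZ_LR /= d0_comm scaler0.
Qed.

(** * The universal derivation *)

(** The Leibniz rule read from the first arrow on: the sum, over the positions in
    the word, of the generator of the arrow there with the arrows before it
    acting on the left and those after it on the right. *)
Fixpoint dpath s : P1 :=
  if s is a :: s' then rm (pi (word s')) (g1 a) + lm (aL a) (dpath s') else 0.

Lemma derivation_exists : exists f : R -> P1,
  zmod_morphism f /\ forall c p, f (algin c * pelt p) = (algin c : A) *: dpath (val p).2.
Proof.
apply: (pb_ext basis (h := fun p c => (algin c : A) *: dpath (val p).2)) => p c d.
by rewrite rmorphB scalerBl.
Qed.

(** [P1] is the bimodule of noncommutative differentials of the path algebra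
    relative to the vertices, extended to [L] on both sides; this is the
    universal derivation into it. *)
Definition delta : R -> P1 := sval (cid derivation_exists).

Lemma deltaB : zmod_morphism delta.
Proof. exact: (svalP (cid derivation_exists)).1. Qed.
Lemma delta_basis c p : delta (algin c * pelt p) = (algin c : A) *: dpath (val p).2.
Proof. exact: (svalP (cid derivation_exists)).2. Qed.
Lemma deltaD : {morph delta : x y / x + y}.
Proof. by move=> x y; apply: (addIr (- delta y)); rewrite -deltaB !addrK. Qed.
Lemma delta0 : delta 0 = 0.
Proof. by have := deltaB 0 0; rewrite !subrr. Qed.
Lemma delta_pelt p : delta (pelt p) = dpath (val p).2.
Proof. by have := delta_basis 1 p; rewrite !rmorph1 mul1r scale1r. Qed.
Lemma delta_algin c x : delta (algin c * x) = (algin c : A) *: delta x.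
Proof.
elim/(pb_ind basis): x => [|x y IHx IHy|d p].
- by rewrite mulr0 delta0 scaler0.
- by rewrite mulrDr !deltaD IHx IHy scalerDr.
by rewrite mulrA -rmorphM !delta_basis rmorphM scalerA.
Qed.

Lemma dpath_cat s t : dpath (s ++ t) = rm (pi (word t)) (dpath s) + lm (pi (word s)) (dpath t).
Proof.
elim: s => [|a s IH] /=; first by rewrite rmul0r rmorph1 (lmul1 env) add0r.
rewrite word_cat !rmorphM IH rmulDr lmulDr addrA (rmulA env) (lrmulC env).
by rewrite (lmulA env).
Qed.

Lemma dpath_l v s : is_path v s -> lm (vL v) (dpath s) = dpath s.
Proof.
case: s => [|a s] /=; first by rewrite lmul0r.
move=> /andP[/eqP <- _]; rewrite lmulDr (lrmulC env) g1_l (lmulA env).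
by rewrite vL_aL.
Qed.

Lemma dpath_r v s : is_path v s -> rm (vL (path_end v s)) (dpath s) = dpath s.
Proof.
elim: s v => [|a s IH] v /=; first by rewrite rmul0r.
move=> /andP[_ sp]; rewrite rmulDr -(lrmulC env) IH //; congr (_ + _).
rewrite (rmulA env) -(g1_r a) !(rmulA env); congr rmul.
pose p : qpath Q := exist (fun u : vertex Q * seq (arrow Q) => is_path u.1 u.2) (target a, s) sp.
rewrite -!(rmorphM pi) mulrA -[vx _ * word s](pelt_word p) -[path_end _ _]/(pend p).
by rewrite pelt_vx.
Qed.

Lemma deltaM x y : delta (x * y) = rm (pi y) (delta x) + lm (pi x) (delta y).
Proof.
elim/(pb_ind basis): x => [|x x' IHx IHx'|c p].
- by rewrite mul0r delta0 rmul0r rmorph0 (lmul0l env) addr0.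
- rewrite mulrDl !deltaD IHx IHx' rmulDr rmorphD (lmulDl env).
  by rewrite addrACA.
rewrite -mulrA !delta_algin rmulZ // rmorphM pi_algin -(lmulA env) (lmul_algin env).
rewrite -scalerDr; congr (_ *: _); elim/(pb_ind basis): y => [|x x' IHx IHx'|{}c q].
- by rewrite mulr0 delta0 lmul0r rmorph0 (rmul0l env) addr0.
- rewrite mulrDr !deltaD IHx IHx' lmulDr rmorphD (rmulDl env).
  by rewrite addrACA.
rewrite mulrA -algin_central -mulrA !delta_algin lmulZ // rmorphM pi_algin.
rewrite -(rmulA env) rmul_algin // ?rmulZ // -scalerDr; congr (_ *: _).
rewrite !delta_pelt.
have [pq|pq] := eqVneq (pend p) (val q).1; last first.
  rewrite pelt_mul_neq // delta0 -(dpath_r (valP p)) -(dpath_l (valP q)).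
  rewrite -/(pend p) -(vx_pelt q) -(pelt_vx p) !rmorphM -!/(vL _).
  rewrite !(rmulA env) !(lmulA env) !mulrA vL_mul (negPf pq) mul0r (rmul0l env).
  by rewrite -!mulrA vL_mul (negPf pq) mulr0 (lmul0l env) addr0.
have rP : is_path (val p).1 ((val p).2 ++ (val q).2).
  by rewrite is_path_cat (valP p) -/(pend p) pq (valP q).
pose r : qpath Q := exist (fun u : vertex Q * seq (arrow Q) => is_path u.1 u.2) (_, _) rP.
have rE : path_comp p q = Some r by apply/path_compP.
rewrite (pb_mul basis rE) delta_pelt.
have piE p' : pi (pelt p') = vL (val p').1 * pi (word (val p').2).
  by rewrite {1}pelt_word rmorphM.
rewrite -[LHS](dpath_l (valP r)) [dpath (val r).2](dpath_cat (val p).2 (val q).2).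
rewrite [(val r).1]/= lmulDr (lrmulC env) (dpath_l (valP p)) (lmulA env) -(piE p).
by rewrite (piE q) -(rmulA env) -pq (dpath_r (valP p)).
Qed.

Lemma delta1 : delta 1 = 0.
Proof.
apply: (addIr (delta 1)); rewrite add0r -[in RHS](mulr1 1) deltaM.
by rewrite rmorph1 (rmul1 env) (lmul1 env).
Qed.
Lemma delta_vx v : delta (vx v) = 0.
Proof. by rewrite delta_pelt. Qed.
Lemma delta_vxM v x : delta (vx v * x) = lm (vL v) (delta x).
Proof. by rewrite deltaM delta_vx rmul0r add0r. Qed.
Lemma delta_ar a : delta (ar a) = g1 a.
Proof. by rewrite delta_pelt /= rmorph1 (rmul1 env) lmul0r addr0. Qed.

Lemma d1_delta x : d1 (delta x) = commU (pi x).
Proof.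
elim/path_gen_ind: x => [x y IHx IHy|x y IHx IHy|c|v|a].
- by rewrite deltaD linearD /= IHx IHy /commU rmorphD (lmulDl env) (rmulDl env) opprD addrACA.
- rewrite deltaM linearD /= lin_rmul lin_lmul IHx IHy /commU rmulBr lmulBr.
  rewrite (rmulA env) (lmulA env) (lrmulC env) rmorphM [LHS]addrC addrA subrK.
  by [].
- rewrite -[algin c]mulr1 delta_algin delta1 scaler0 linear0 mulr1 pi_algin.
  by rewrite /commU (lmul_algin env) (rmul_algin env) subrr.
- by rewrite delta_vx linear0 /commU -/(vL v) lmul_U rmul_U subrr.
by rewrite delta_ar d1_g1.
Qed.

(** Every element of [P0] is, modulo the image of [d1], of the form [1 (x) z]:
    move the left factor across with [d1 (delta x)]. *)
Lemma d1_exact f : d0 f = 0 <-> exists y, d1 y = f.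
Proof.
split=> [f0|[y <-]]; last exact: d0_d1.
have H t : exists y, d1 y = t *: U - rm (jota (d0 (t *: U))) U.
  elim/(eb_ind env): t => [|s t [y yE] [z zE]|x z].
  - by exists 0; rewrite linear0 scale0r linear0 jota0 (rmul0l env) subrr.
  - exists (y + z); rewrite linearD /= yE zE scalerDl linearD /= jotaD (rmulDl env).
    by rewrite opprD addrACA.
  have [x' ->] := proj_onto x; exists (rm z (delta x')).
  rewrite lin_rmul d1_delta /commU rmulBr (rmulA env) (pure_lr env) (lrmulC env).
  by rewrite lin_rmul lin_lmul d0_U iota_l iota_r iotaK mulr1.
have [y] := H (\sum_v coord f v); rewrite -P0_cyclic f0 jota0 (rmul0l env) subr0.
by exists y.
Qed.

Lemma d0_onto x : exists f, d0 f = x.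
Proof. by exists (lm (jota x) U); rewrite lin_lmul d0_U iota_l mulr1 jotaK. Qed.

(** * Minimality *)

Lemma iota_lcfB v : zmod_morphism (fun x : N => lcf (vpath v) (jota x)).
Proof.
have jB : zmod_morphism jota by apply: morphD_zmod; exact: jotaD.
by move=> x y; rewrite jB lcfB.
Qed.

(** An element of the kernel of [d0] reduces modulo the radical to a tuple of
    scalars, one for each vertex; these are the vertex coefficients of its
    image. *)
Lemma ker_d0_layer f : d0 f = 0 -> forall v, layer 1 (coord f v).
Proof.
move=> f0 v.
have hc w : exists c, layer 1 (coord f w - (algin c : A) * eps0 w).
  by have [c] := layer_vertex (coord f w) w w; rewrite coord_idem; exists c.
have [c cP] := choice hc.
pose lam x := lcf (vpath v) (jota x).
have lamB : zmod_morphism lam := iota_lcfB v.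
have lamD : {morph lam : x y / x + y}.
  by move=> x y; apply: (addIr (- lam y)); rewrite -lamB !addrK.
have lam0 : lam 0 = 0 by have := lamB 0 0; rewrite !subrr.
have lamL t : layer 1 t -> lam (t *: iota 1) = 0.
  elim=> [|d p q u pq _ IH]; first by rewrite scale0r.
  rewrite scalerDl lamD IH addr0 -scalerA /mono iota_act mulr1.
  rewrite -(lmul_algin env) iota_l /lam iotaK lcf_algin //.
  by rewrite lcf_mul_long // mulr0.
have : lam (d0 f) = c v.
  rewrite -[d0 f]/(\sum_w coord f w *: iota 1) (big_morph lam lamD lam0).
  have lamf w : lam (coord f w *: iota 1) = if w == v then c w else 0.
    rewrite -[coord f w](subrK ((algin (c w) : A) * eps0 w)) scalerDl lamD lamL //.
    rewrite add0r -scalerA iota_act mulr1 vLK -(lmul_algin env) iota_l /lam iotaK.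
    rewrite lcf_algin // lcf_pelt // -(inj_eq val_inj) /= xpair_eqE eqxx andbT.
    by case: eqP => _; rewrite ?mulr1 ?mulr0.
  rewrite (eq_bigr _ (fun w _ => lamf w)) (bigD1 v) //= eqxx big1 ?addr0 // => w wv.
  by rewrite (negPf wv).
rewrite f0 lam0 => cv.
by have := cP v; rewrite -cv raddf0 mul0r subr0.
Qed.

Lemma coord_comm x v : coord (commU x) v = pure (x * vL v) (vL v) - pure (vL v) (vL v * x).
Proof.
have coordN (g : P0) : coord (- g) v = - coord g v.
  by apply: (addIr (coord g v)); rewrite -coordD !addNr coord0.
rewrite /commU coordD coordN !coordZ coord_U /eps0 !(eb_M env).
by rewrite mulr1 mul1r.
Qed.

(** The scalar of an arrow [a] in an element of the kernel of [d1] is the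
    coefficient, in the component of the image at the target of [a], of [a]
    tensored with that vertex. *)
Lemma ker_d1_layer f : d1 f = 0 -> forall a, layer 1 (coord f a).
Proof.
move=> f0 a.
have hc b : exists c, layer 1 (coord f b - (algin c : A) * eps1 b).
  by have [c] := layer_vertex (coord f b) (source b) (target b); rewrite coord_idem; exists c.
have [c cP] := choice hc.
pose t := target a.
have [th [thB thZ thE]] := @functional2 (arrow_path a) (vpath t) erefl erefl.
have thD : {morph th : x y / x + y}.
  by move=> x y; apply: (addIr (- th y)); rewrite -thB !addrK.
have th0 : th 0 = 0 by have := thB 0 0; rewrite !subrr.
have thW (s : A) b : th (s * coord (commU (aL b)) t) = th (s * pure (aL b * vL t) (vL t)).
  rewrite coord_comm mulrBr thB -[RHS]subr0; congr (_ - _).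
  elim/(eb_ind env): s => [|x y IHx IHy|x y]; first by rewrite mul0r.
    by rewrite mulrDl thD IHx IHy addr0.
  by rewrite (eb_M env) thE lcf_vertex_arrow mulr0.
have thL (s : A) b : layer 1 s -> th (s * pure (aL b * vL t) (vL t)) = 0.
  elim=> [|d p q u pq _ IH]; first by rewrite mul0r.
  rewrite mulrDl thD IH addr0 -mulrA thZ /mono (eb_M env) thE.
  have [q0|q0] := posnP (psize q).
    rewrite (mulrA (pi (pelt p))) lcf_mul3_long ?mul0r ?mulr0 //.
    by rewrite addn0 addn1 ltnS; move: pq; rewrite q0 addn0.
  by rewrite [lcf (vpath t) _]lcf_mul_long ?mulr0.
have : th (coord (d1 f) t) = c a.
  rewrite -[d1 f]/(\sum_b coord f b *: commU (aL b)) coord_sum.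
  rewrite (big_morph th thD th0).
  have thf b : th (coord (coord f b *: commU (aL b)) t) = if b == a then c b else 0.
    rewrite coordZ thW -[coord f b](subrK ((algin (c b) : A) * eps1 b)) mulrDl thD.
    rewrite thL // add0r -mulrA thZ /eps1 (eb_M env) thE (mulrA (vL (source b))) vL_aL.
    have [bt|bt] := eqVneq (target b) t; last first.
      rewrite vL_mul eq_sym (negPf bt) lcf0 // !mulr0.
      by case: eqP => // ba; rewrite ba eqxx in bt.
    rewrite -bt aL_vL vLK !lcf_pelt // eqxx mulr1.
    have -> : (arrow_path b == arrow_path a) = (b == a).
      by apply/eqP/eqP => [/(congr1 val)[]|->].
    by case: eqP => _; rewrite ?mulr1 ?mulr0.
  rewrite (eq_bigr _ (fun b _ => thf b)) (bigD1 a) //= eqxx big1 ?addr0 // => b ba.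
  by rewrite (negPf ba).
rewrite f0 coord0 th0 => ca.
by have := cP a; rewrite -ca raddf0 mul0r subr0.
Qed.

Lemma standard_min_proj_pres : min_proj_pres d1 d0.
Proof.
have layer_mul1 m x y : layer m x -> layer 1 y -> layer m.+1 (x * y).
  by move=> xm y1; rewrite -addn1; exact: layer_mul.
split.
- exact: (idem_fin_gen eps0K).
- exact: (idem_fin_gen eps1K).
- exact: (idem_projective eps0K).
- exact: (idem_projective eps1K).
- exact: d0_onto.
- exact: d1_exact.
- apply: (idem_superfluous eps0K layer_all layer0 layerD layer_mul1 layer_top).
  by move=> f /eqP; exact: ker_d0_layer.
- apply: (idem_superfluous eps1K layer_all layer0 layerD layer_mul1 layer_top).
  by move=> f /eqP; exact: ker_d1_layer.
Qed.

(** * The conormal sequence *)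

Local Notation J := (ideal_mul I I).

Lemma ideal_mul_in x y : x \in (I : {pred R}) -> y \in (I : {pred R}) ->
  x * y \in (J : {pred R}).
Proof. by move=> xI yI; apply/asboolP => K; apply; exists x, y. Qed.

Lemma d1_delta_ideal (w : R) : w \in (I : {pred R}) -> d1 (delta w) = 0.
Proof.
by move=> /pi_ker w0; rewrite d1_delta w0 /commU (lmul0l env) (rmul0l env) subrr.
Qed.

Lemma delta_lmul_ideal x (w : R) : w \in (I : {pred R}) -> delta (x * w) = lm (pi x) (delta w).
Proof. by move=> /pi_ker w0; rewrite deltaM w0 (rmul0l env) add0r. Qed.
Lemma delta_rmul_ideal x (w : R) : w \in (I : {pred R}) -> delta (w * x) = rm (pi x) (delta w).
Proof. by move=> /pi_ker w0; rewrite deltaM w0 (lmul0l env) addr0. Qed.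

Definition delta_ker : {pred R} := fun x => `[< x \in (I : {pred R}) /\ delta x = 0 >].
Fact delta_ker_zmod : zmod_closed delta_ker.
Proof.
split=> [|x y /asboolP[xI x0] /asboolP[yI y0]]; apply/asboolP.
  by split; [exact: rpred0|exact: delta0].
by split; [exact: rpredB|rewrite deltaB x0 y0 subrr].
Qed.
HB.instance Definition _ := GRing.isZmodClosed.Build R delta_ker delta_ker_zmod.
Fact delta_ker_Ml x y : y \in delta_ker -> x * y \in delta_ker.
Proof.
move=> /asboolP[yI y0]; apply/asboolP; split; first exact: Defs.idealMl.
by rewrite delta_lmul_ideal // y0 lmul0r.
Qed.
Fact delta_ker_Mr x y : y \in delta_ker -> y * x \in delta_ker.
Proof.
move=> /asboolP[yI y0]; apply/asboolP; split; first exact: Defs.idealMr.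
by rewrite delta_rmul_ideal // y0 rmul0r.
Qed.
HB.instance Definition _ := isTwoSided.Build R delta_ker delta_ker_Ml delta_ker_Mr.

Lemma delta_square (w : R) : w \in (J : {pred R}) -> delta w = 0.
Proof.
suff H : w \in (J : {pred R}) -> w \in delta_ker by move=> /H/asboolP[].
move=> /asboolP/(_ delta_ker); apply => _ [x [y [xI yI ->]]].
apply/asboolP; split; first exact: Defs.idealMl.
by rewrite delta_lmul_ideal //; move/pi_ker: xI => ->; rewrite (lmul0l env).
Qed.

Variable s0 : L -> R.
Hypothesis s0K : forall x, pi (s0 x) = x.
Hypothesis s0D : {morph s0 : x y / x + y}.
Hypothesis s0Z : forall c x, s0 (algin c * x) = algin c * s0 x.

(** Averaging an arbitrary linear section over the vertices makes it linear over
    them on the left, so that expressions built from it descend to tensors over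
    the vertices. *)
Definition sec x : R := \sum_v vx v * s0 (vL v * x).

Lemma secK x : pi (sec x) = x.
Proof.
rewrite -[RHS]mul1r -sum_vL mulr_suml rmorph_sum; apply: eq_bigr => v _.
by rewrite rmorphM s0K mulrA vLK.
Qed.
Lemma secD : {morph sec : x y / x + y}.
Proof.
by move=> x y; rewrite -big_split; apply: eq_bigr => v _; rewrite mulrDr s0D mulrDr.
Qed.
Lemma secZ c x : sec (algin c * x) = algin c * sec x.
Proof.
rewrite mulr_sumr; apply: eq_bigr => v _.
by rewrite mulrA -algin_central -mulrA s0Z mulrA -algin_central -mulrA.
Qed.
Lemma sec_vx v x : sec (vL v * x) = vx v * sec x.
Proof.
rewrite /sec (bigD1 v) //= big1 ?addr0 => [|w wv]; last first.
  rewrite mulrA vL_mul (negPf wv) mul0r.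
  have -> : s0 0 = 0 by apply: (addIr (s0 0)); rewrite -s0D !add0r.
  by rewrite mulr0.
rewrite mulr_sumr (bigD1 v) //= big1 ?addr0 => [|w wv]; last first.
  by rewrite mulrA vx_mul eq_sym (negPf wv) mul0r.
by rewrite !mulrA vLK vxK.
Qed.

Lemma sec_sub x : x - sec (pi x) \in (I : {pred R}).
Proof. by apply/pi_ker; rewrite rmorphB secK subrr. Qed.

Local Notation cls := (qpi J).

Lemma cls_eq x y : x - y \in (J : {pred R}) -> cls x = cls y.
Proof. by move=> xy; apply/(qpiP J). Qed.

(** A left inverse of [delta] on [I] modulo its square. The assignment sending
    [x] to the map [m |-> x * sec m - sec (pi x * m)] from [L] to [I] modulo its
    square is a derivation on [R] that kills the vertices, so it factors through
    [delta]; for [x] in [I] the value at [1] is [x] modulo the square. *)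
Lemma conormal_retraction : exists G : P1 -> quotalg J,
  {morph G : f g / f + g} /\ forall x, G (delta x) = cls (x * sec 1 - sec (pi x)).
Proof.
pose der a y := ar a * sec y - sec (aL a * y).
have derI a y : der a y \in (I : {pred R}).
  by apply/pi_ker; rewrite rmorphB rmorphM !secK subrr.
have derD a y z : der a (y + z) = der a y + der a z.
  by rewrite /der mulrDr !secD mulrDr opprD addrACA.
have derZ a c y : der a (algin c * y) = algin c * der a y.
  rewrite /der secZ mulrA -algin_central -mulrA mulrBr; congr (_ - _).
  by rewrite mulrA -algin_central -mulrA secZ.
pose beta a x y : quotalg J := cls (rep x * der a y).
have betaE a x y : beta a (pi x) y = cls (x * der a y).
  apply: cls_eq; rewrite -mulrBl; apply: ideal_mul_in => //.
  by apply/pi_ker; rewrite rmorphB repK subrr.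
have Gex a : exists g : A -> quotalg J,
    zmod_morphism g /\ forall x y, g (pure x y) = beta a x y.
  apply: (eb_lift env) => [y x x'|x y y'|c x y].
  - have [z ->] := proj_onto x; have [z' ->] := proj_onto x'.
    by rewrite -rmorphD !betaE mulrDl (raddfD cls).
  - by rewrite /beta derD mulrDr (raddfD cls).
  have [z ->] := proj_onto x; rewrite -[algin c in LHS]pi_algin -rmorphM !betaE.
  by rewrite derZ mulrA algin_central.
have [g gP] := choice Gex.
have gD a : {morph g a : s t / s + t}.
  by move=> s t; apply: (addIr (- g a t)); rewrite -(gP a).1 !addrK.
pose G (f : P1) := \sum_a g a (coord f a).
have GD : {morph G : f h / f + h}.
  by move=> f h; rewrite -big_split; apply: eq_bigr => a _; rewrite coordD gD.
have g_0 a : g a 0 = 0 by have := (gP a).1 0 0; rewrite !subrr.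
have der_vL a y : der a (vL (target a) * y) = der a y.
  by rewrite /der sec_vx !mulrA ar_vx aL_vL.
have vL_der a y : vx (source a) * der a y = der a y.
  by rewrite /der mulrBr mulrA vx_ar -sec_vx mulrA vL_aL.
have Gg1 x y a : G (lm (pi x) (rm y (g1 a))) = cls (x * der a y).
  rewrite -(pure_lr env) /G (bigD1 a) //= coordZ coord_gen eqxx big1 ?addr0 => [|b ba].
    rewrite /eps1 (eb_M env) (gP a).2 -rmorphM betaE der_vL -mulrA.
    by rewrite vL_der.
  by rewrite coordZ coord_gen (negPf ba) mulr0.
have Gdpath x y (s : seq (arrow Q)) :
    G (lm (pi x) (rm y (dpath s))) = cls (x * (word s * sec y - sec (pi (word s) * y))).
  elim: s x => [|a s IH] x.
    rewrite /= rmul0r lmul0r rmorph1 !mul1r subrr mulr0 (raddf0 cls).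
    by rewrite /G big1 // => a _; rewrite coord0.
  rewrite /= rmulDr lmulDr GD (rmulA env) Gg1 -(lrmulC env) (lmulA env) -rmorphM IH.
  rewrite -(raddfD cls) -mulrA -mulrDr; congr (cls (_ * _)).
  by rewrite /der mulrBr [LHS]addrC addrA subrK rmorphM !mulrA.
exists G; split=> // x; elim/(pb_ind basis): x => [|x y IHx IHy|c p].
- rewrite delta0 mul0r rmorph0.
  have -> : sec 0 = 0 by apply: (addIr (sec 0)); rewrite -secD !add0r.
  by rewrite subrr (raddf0 cls) /G big1 // => a _; rewrite coord0.
- rewrite deltaD GD IHx IHy rmorphD secD mulrDl -(raddfD cls); congr cls.
  by rewrite opprD addrACA.
have := Gdpath (algin c * vx (val p).1) 1 (val p).2.
rewrite (rmul1 env) rmorphM pi_algin -(lmulA env) (dpath_l (valP p)) (lmul_algin env).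
rewrite -delta_basis => ->; congr cls.
rewrite mulr1 mulrBr [pelt p]pelt_word; congr (_ - _); first by rewrite !mulrA.
by rewrite -mulrA -sec_vx -secZ !rmorphM pi_algin.
Qed.

Lemma delta_inj_square (w : R) : w \in (I : {pred R}) -> delta w = 0 -> w \in (J : {pred R}).
Proof.
move=> wI w0; have [G [GD GE]] := conormal_retraction.
have G0 : G 0 = 0 by apply: (addIr (G 0)); rewrite -GD !add0r.
have sec0 : sec 0 = 0 by apply: (addIr (sec 0)); rewrite -secD !add0r.
have /(qpi0 J) : cls (w * sec 1) = 0.
  by rewrite -[RHS]G0 -w0 GE; move/pi_ker: (wI) => ->; rewrite sec0 subr0.
have s1 : 1 - sec 1 \in (I : {pred R}) by have := sec_sub 1; rewrite rmorph1.
move=> ws; rewrite -[w]mulr1 -[X in w * X](subrK (sec 1)) mulrDr.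
by rewrite rpredD // ideal_mul_in.
Qed.

(** Write an element of the kernel of [d1] as a sum of [x . delta r]. Its image
    is the sum of [x r (x) 1 - x (x) r]; the additive map sending [x (x) z] to
    [x . delta (sec z)] turns this into a sum that agrees, up to sign and modulo
    [delta I], with the element itself. *)
Lemma delta_onto_kernel y : d1 y = 0 ->
  exists w : R, w \in (I : {pred R}) /\ y = delta w.
Proof.
have [|||T' [T'B T'E]] := eb_lift env (beta := fun x z => lm x (delta (sec z))).
- by move=> z x x'; rewrite (lmulDl env).
- by move=> x z z'; rewrite secD deltaD lmulDr.
- move=> c x z; rewrite secZ delta_algin lmulZ // -(lmulA env) (lmul_algin env).
  by [].
have T'D : {morph T' : x y / x + y}.
  by move=> x z; apply: (addIr (- T' z)); rewrite -T'B !addrK.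
pose T (f : P0) := \sum_v T' (coord f v).
have TD : {morph T : f g / f + g}.
  by move=> f g; rewrite -big_split; apply: eq_bigr => v _; rewrite coordD T'D.
have TU x z : T (lm x (rm z U)) = lm x (delta (sec z)).
  rewrite -(pure_lr env) /T.
  transitivity (\sum_v lm (x * vL v) (delta (sec z))).
    apply: eq_bigr => v _; rewrite coordZ coord_U /eps0 (eb_M env) T'E sec_vx.
    by rewrite delta_vxM (lmulA env) -mulrA vLK.
  by rewrite -(lmul_suml env) -mulr_sumr sum_vL mulr1.
pose good f := exists w : R, w \in (I : {pred R}) /\ f + T (d1 f) = delta w.
have T0 : T 0 = 0 by apply: (addIr (T 0)); rewrite -TD !add0r.
have goodD f g : good f -> good g -> good (f + g).
  move=> [w [wI wE]] [w' [wI' wE']]; exists (w + w'); split; first exact: rpredD.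
  by rewrite deltaD -wE -wE' linearD /= TD addrACA.
have good0 : good 0.
  by exists 0; rewrite rpred0 linear0 T0 delta0 addr0.
have goodl x (r : R) : good (lm x (delta r)).
  have [x' ->] := proj_onto x.
  (* [delta (sec 1)] is [delta (sec 1 - 1)], and the last argument lies in [I] *)
  have w1 := sec_sub r; have w2 : sec 1 - 1 \in (I : {pred R}).
    by apply/pi_ker; rewrite rmorphB secK rmorph1 subrr.
  exists (x' * (r - sec (pi r)) + x' * r * (sec 1 - 1)); split.
    by rewrite rpredD ?Defs.idealMl.
  rewrite deltaD !delta_lmul_ideal // !deltaB delta1 subr0.
  rewrite lin_lmul d1_delta /commU lmulBr (lmulA env) -rmorphM.
  have -> : lm (pi (x' * r)) U = lm (pi (x' * r)) (rm 1 U) by rewrite (rmul1 env).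
  have TN f : T (- f) = - T f.
    by apply: (addIr (T f)); rewrite -TD !addNr.
  by rewrite TD TN !TU lmulBr -addrA; congr (_ + _); rewrite addrC.
have goodB f g : good f -> good g -> good (f - g).
  move=> gf gg; apply: goodD => //; case: gg => w [wI wE].
  exists (- w); split; first by rewrite rpredN.
  have TN h : T (- h) = - T h by apply: (addIr (T h)); rewrite -TD !addNr.
  have dN : delta (- w) = - delta w by rewrite -sub0r deltaB delta0 sub0r.
  by rewrite dN -wE opprD linearN /= TN.
have goodA f : good f.
  rewrite (idemmodE eps1K f); apply: big_ind => // a _.
  elim/(eb_ind env): (coord f a) => [|s t IHs IHt|x z].
  - by rewrite scale0r.
  - by rewrite scalerDl; exact: goodD.
  have [z' ->] := proj_onto z.
  have -> : pure x (pi z') *: gen eps1K a = lm x (delta (ar a * z')) - lm (x * aL a) (delta z').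
    rewrite deltaM delta_ar lmulDr (lmulA env) addrK (pure_lr env).
    by [].
  by apply: goodB; exact: goodl.
move=> y0; have [w [wI wE]] := goodA y; exists w; split=> //.
by rewrite -wE y0 T0 addr0.
Qed.

Local Notation K := (submodT (ker_pred d1)).
Local Notation Isq := (ideal_mod_sq I).
Local Notation clI := (qpi (@ideal_sq_pred k R I)).

Lemma clI_eq (w w' : subzmodT I) : delta (val w) = delta (val w') -> clI w = clI w'.
Proof.
move=> ww; apply/(qpiP (@ideal_sq_pred k R I)).
have : val (w - w') \in (J : {pred R}).
  apply: delta_inj_square; first exact: valP.
  by rewrite raddfB deltaB ww subrr.
exact.
Qed.

Variables (V : bimodType R) (kap : V -> N) (kap' : N -> V).
Hypothesis kapD : {morph kap : x y / x + y}.
Hypotheses (kapK : cancel kap kap') (kapK' : cancel kap' kap).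
Hypothesis kap_l : forall (r : R) x, kap (lact r x) = lm (pi r) (kap x).
Hypothesis kap_r : forall (r : R) x, kap (ract r x) = rm (pi r) (kap x).

Local Notation HomI := (bimod_hom Isq V).

Lemma bimod_homP (g : HomI) : is_bimod_hom (val g : Isq -> V).
Proof. exact/asboolP/(valP g). Qed.

(** [delta] identifies the bimodule [I] modulo its square with the kernel of
    [d1]: it kills the square by the Leibniz rule, [delta_inj_square] and
    [delta_onto_kernel] do the rest. *)
Lemma hom_conormal : exists Th : {linear HomI -> homA K N},
  injective Th /\ (forall f, exists g, Th g = f).
Proof.
have wex (y : K) : exists w : subzmodT I, delta (val w) = val y.
  have [w [wI wE]] := delta_onto_kernel (eqP (valP y)).
  by exists (Sub w wI).
have [w wE] := choice wex.
have thI (g : HomI) (y : K) (u : subzmodT I) : delta (val u) = val y ->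
    (val g : Isq -> V) (clI (w y)) = (val g : Isq -> V) (clI u).
  by move=> uy; rewrite (@clI_eq (w y) u) // wE.
pose th (g : HomI) (y : K) : N := kap ((val g : Isq -> V) (clI (w y))).
have thL g : linear (th g).
  have [gD gl gr] := bimod_homP g.
  apply: (bimod_linear env) => [y z|x y|x y].
  - rewrite /th -kapD -gD -(raddfD clI) (@thI g _ (w y + w z)) //.
    by rewrite raddfD /= deltaD !wE.
  - have [x' ->] := proj_onto x; rewrite /th -kap_l -gl -[lact _ _]/(ims_lact _ _) ims_lact_pi.
    rewrite (@thI g _ (ideal_lmul x' (w y))) //.
    rewrite -[val (ideal_lmul _ _)]/(x' * val (w y)) delta_lmul_ideal; last exact: valP.
    by rewrite wE.
  have [x' ->] := proj_onto x; rewrite /th -kap_r -gr -[ract _ _]/(ims_ract _ _) ims_ract_pi.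
  rewrite (@thI g _ (ideal_rmul x' (w y))) //.
  rewrite -[val (ideal_rmul _ _)]/(val (w y) * x') delta_rmul_ideal; last exact: valP.
  by rewrite wE.
have ThL : linear (fun g => homof (linmap (thL g))).
  move=> c g h; apply: homA_eq => y.
  rewrite -[LHS]/(kap (lact (algin c) ((val g : Isq -> V) (clI (w y)))
    + (val h : Isq -> V) (clI (w y)))).
  by rewrite kapD kap_l pi_algin (lmul_algin env).
exists (linmap ThL); split=> [g h gh|f].
- apply: val_inj; apply/funext => t; rewrite -(qreprK t).
  have uK : delta (val (qrepr t)) \in ker_pred d1.
    by apply/eqP/d1_delta_ideal; exact: valP.
  have := congr1 (fun f => hom_fun f (submod_in uK)) gh.
  rewrite -[LHS]/(th g (submod_in uK)) -[RHS]/(th h (submod_in uK)) /th.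
  move/(can_inj kapK); rewrite (@thI g _ (qrepr t)) // (@thI h _ (qrepr t)) //.
have uK (u : subzmodT I) : delta (val u) \in ker_pred d1.
  by apply/eqP/d1_delta_ideal; exact: valP.
pose g (t : Isq) : V := kap' (hom_fun f (submod_in (uK (qrepr t)))).
have gE u : g (clI u) = kap' (hom_fun f (submod_in (uK u))).
  congr (kap' (hom_fun f _)); apply: val_inj; rewrite /=.
  apply/eqP; rewrite -subr_eq0 -deltaB; apply/eqP/delta_square.
  exact: (qrepr_qpi (@ideal_sq_pred k R I) u).
have kapD' : {morph kap' : x y / x + y}.
  by move=> x y; apply: (can_inj kapK); rewrite kapD !kapK'.
have gH : is_bimod_hom g.
  split=> [t t'|z t|z t].
  - rewrite -(qreprK t) -(qreprK t') -(raddfD clI) !gE -kapD' -raddfD.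
    congr (kap' (hom_fun f _)); apply: val_inj => /=.
    by rewrite deltaD.
  - rewrite -(qreprK t) -[lact _ _]/(ims_lact _ _) ims_lact_pi !gE.
    apply: (can_inj kapK); rewrite kap_l !kapK' -lin_lmul.
    congr (hom_fun f _); apply: val_inj => /=.
    by rewrite delta_lmul_ideal //; exact: valP.
  rewrite -(qreprK t) -[ract _ _]/(ims_ract _ _) ims_ract_pi !gE.
  apply: (can_inj kapK); rewrite kap_r !kapK' -lin_rmul.
  congr (hom_fun f _); apply: val_inj => /=.
  by rewrite delta_rmul_ideal //; exact: valP.
have gM : (g : Isq -> bimod_k V) \in @bimod_hom_pred k R Isq V by apply/asboolP.
exists (submod_in gM).
apply: homA_eq => y; rewrite -[LHS]/(kap (g (clI (w y)))) gE kapK'.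
by congr (hom_fun f _); apply: val_inj; rewrite /= wE.
Qed.

(** Both groups are read off the complex
    [Hom(P0, N) -> Hom(P1, N) -> Hom(K, N)]: the first is its cohomology in the
    middle and the second is the cokernel of its last map. The first map of the
    complex is onto iff the complex is exact in the middle and its last map is
    zero, and the latter means that the cokernel of that map has the dimension
    of its target. *)
Lemma factors_Ext (Fr : proj_resolution N) : fdim HomI ->
  factors N d1 <-> (forall x : Ext_of Fr N 1, x = 0) /\ eq_dim (Ext_of Fr N 2) HomI.
Proof.
move=> fd.
have pr1 : projective P1 by exact: (idem_projective eps1K).
have pr0 : projective P0 by exact: (idem_projective eps0K).
have [Phi [PhiS PhiK]] := Ext2_presentation N Fr pr1 pr0 d0_onto d1_exact.
have [Th [ThI ThS]] := hom_conormal.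
have PTS x : exists g, (Phi \o Th) g = x.
  by have [f <-] := PhiS x; have [g <-] := ThS f; exists g.
rewrite (Ext1_eq0 N Fr pr1 pr0 d0_onto d1_exact); split=> [F|[F1 [m [dm2 dmI]]] f].
- split=> [f _|]; first exact: F.
  have [m dm] := fdim_basis fd; exists m; split=> //.
  apply: (has_dim_bij (f := Phi \o Th)) PTS dm.
  apply: raddf_inj => g /PhiK[r rE]; apply: ThI; rewrite linear0.
  apply: homA_eq => y; rewrite rE; have [h hE] := F r.
  by rewrite hE (eqP (valP y)) linear0.
have PTI : injective (Phi \o Th) by exact: has_dim_surj_inj dmI dm2 PTS.
apply: F1 => x d1x.
have rL : linear (fun y : K => f (val y)) by move=> a y z; rewrite /= linearP.
have [g gE] := ThS (homof (linmap rL)).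
have g0' : g = 0.
  apply: PTI; rewrite linear0 /= gE; apply/PhiK; exists f => y.
  by rewrite homofE.
have xK : x \in ker_pred d1 by apply/eqP.
rewrite -[LHS]/(hom_fun (homof (linmap rL)) (submod_in xK)) -gE g0' linear0.
by [].
Qed.

Lemma homA_fdim P : fin_gen P -> fdim (restr N) -> fdim (homA P N).
Proof.
move=> [m [E EP]] fd.
have evL : linear (fun f : homA P N => [ffun i => hom_fun f (E i)] : {ffun 'I_m -> restr N}).
  by move=> c f g; apply/ffunP => i; rewrite !ffunE.
apply: (fdim_inj (f := linmap evL)); last exact: fdim_ffun.
move=> f g /ffunP fg; apply: homA_eq => x; have [c ->] := EP x.
rewrite !linear_sum; apply: eq_bigr => i _; rewrite !linearZ_LR /=; congr (_ *: _).
by have := fg i; rewrite !ffunE.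
Qed.

Lemma tau_rigid_factors : fdim (restr N) -> tau_rigid N <-> factors N d1.
Proof.
move=> fd; have sp := standard_min_proj_pres; split.
  move=> [P1' [P0' [d1' [d0' [mp F0]]]]]; apply: (min_pres_factors mp sp).
  apply: ar_zero_factors F0; [exact: (mpp_fg1 mp)|exact: (mpp_proj1 mp)|].
  by apply: homA_fdim => //; exact: (mpp_fg1 mp).
move=> F; exists P1, P0, d1, d0; split=> //.
apply: factors_ar_zero F; [exact: (mpp_fg1 sp)|exact: (mpp_proj1 sp)|
  exact: (mpp_fg0 sp)|exact: (mpp_proj0 sp)].
Qed.
End BoundQuiver.

(** * Finite dimension of the quotients *)

Section FiniteQuotients.
Variables (k : fieldType) (Q : quiver) (R : pzAlgType k).
Variables (pelt : qpath Q -> R) (cf : qpath Q -> R -> k).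
Hypothesis basis : path_basis pelt cf.

Lemma short_paths_fdim (L : pzAlgType k) (pi : {rmorphism R -> L}) n :
  (forall x, exists y, x = pi y) -> (forall c, pi (algin c) = algin c) ->
  (forall p, (n <= psize p)%N -> pi (pelt p) = 0) -> fdim (restr (L^o : lmodType L)).
Proof.
move=> pi_onto pi_algin long.
pose g (i : vertex Q * {bseq n of arrow Q}) : restr (L^o : lmodType L) :=
  if insub (i.1, i.2 : seq (arrow Q)) is Some p then pi (pelt (p : qpath Q)) else 0.
exists (vertex Q * {bseq n of arrow Q})%type, g => x.
have [y ->] := pi_onto x; elim/(pb_ind basis): y => [|y z [c cE] [d dE]|c p].
- exists (fun=> 0); rewrite big1 ?rmorph0 // => i _; exact: scale0r.
- exists (fun i => c i + d i); rewrite rmorphD.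
  rewrite (eq_bigr (fun i => c i *: g i + d i *: g i)) => [|i _]; last exact: scalerDl.
  by rewrite big_split /= -cE -dE.
have [np|pn] := leqP n (psize p).
  by exists (fun=> 0); rewrite rmorphM long // mulr0 big1 // => i _; exact: scale0r.
pose i0 : vertex Q * {bseq n of arrow Q} := ((val p).1, Bseq (ltnW pn : (size (val p).2 <= n)%N)).
have gi0 : g i0 = pi (pelt p).
  by rewrite /g /= -surjective_pairing valK.
exists (fun i => if i == i0 then c else 0).
rewrite (bigD1 i0) //= eqxx big1 ?addr0 => [|i ii]; last by rewrite (negPf ii) scale0r.
by rewrite gi0 rmorphM pi_algin.
Qed.

Lemma path_split p i : (i <= psize p)%N ->
  exists p1 p2, [/\ pelt p = pelt p1 * pelt p2, psize p1 = i & psize p2 = (psize p - i)%N].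
Proof.
move=> ip; pose s := (val p).2.
have sP : is_path (val p).1 (take i s ++ drop i s) by rewrite cat_take_drop (valP p).
have /andP[s1 s2] : is_path (val p).1 (take i s)
    && is_path (path_end (val p).1 (take i s)) (drop i s) by rewrite -is_path_cat.
pose p1 : qpath Q := exist (fun u : vertex Q * seq (arrow Q) => is_path u.1 u.2) (_, _) s1.
pose p2 : qpath Q := exist (fun u : vertex Q * seq (arrow Q) => is_path u.1 u.2) (_, _) s2.
exists p1, p2; split; last by rewrite /psize size_drop.
  apply/esym/(pb_mul basis)/path_compP; split=> //=.
  by rewrite cat_take_drop /s -surjective_pairing.
by rewrite /psize /= size_takel.
Qed.

Variables (I : ideal R) (n : nat).
Hypothesis longI : forall p, (n <= psize p)%N -> pelt p \in (I : {pred R}).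

(** Cut the path after [n] arrows. *)
Lemma long_path_square p : (n + n <= psize p)%N -> pelt p \in (ideal_mul I I : {pred R}).
Proof.
move=> np; have [|p1 [p2 [-> p1E p2E]]] := @path_split p n.
  by apply: leq_trans np; rewrite leq_addr.
apply/asboolP => K; apply; exists (pelt p1), (pelt p2); split=> //; apply: longI.
  by rewrite p1E.
by rewrite p2E leq_subRL // (leq_trans _ np) // leq_addr.
Qed.

Lemma quotalg_fdim (J : ideal R) m :
  (forall p, (m <= psize p)%N -> pelt p \in (J : {pred R})) ->
  fdim (restr ((quotalg J)^o : lmodType (quotalg J))).
Proof.
move=> longJ; apply: (short_paths_fdim (pi := qproj J) (n := m)) => //.
  by move=> x; exists (qrepr x); rewrite -[LHS]qreprK.
by move=> p mp; apply/(qpi0 J)/longJ.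
Qed.

(** The square of [I] contains all paths of length [n + n], and [I] modulo its
    square embeds in the quotient by that square. *)
Lemma ideal_mod_sq_fdim : fdim (bimod_k (ideal_mod_sq I)).
Proof.
pose J := ideal_mul I I.
pose f (t : bimod_k (ideal_mod_sq I)) : restr ((quotalg J)^o : lmodType (quotalg J)) :=
  qproj J (val (qrepr (t : ideal_mod_sq I))).
have fE u : f (qpi (@ideal_sq_pred k R I) u) = qproj J (val u).
  apply/(qpiP J); exact: (qrepr_qpi (@ideal_sq_pred k R I) u).
have fL : linear f.
  move=> c t t'; rewrite -(qreprK (t : ideal_mod_sq I)) -(qreprK (t' : ideal_mod_sq I)).
  rewrite -[c *: _]/(ims_lact (algin c) _) ims_lact_pi.
  rewrite -[_ + _ in LHS](raddfD (qpi (@ideal_sq_pred k R I))) !fE.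
  apply: etrans (raddfD (qproj J) _ _) _; congr (_ + _).
  exact: (rmorphM (qproj J)).
apply: (fdim_inj (f := linmap fL)); last exact: quotalg_fdim long_path_square.
move=> t t' /=; rewrite -(qreprK (t : ideal_mod_sq I)) -(qreprK (t' : ideal_mod_sq I)).
rewrite !fE => /(qpiP J) tt; apply/(qpiP (@ideal_sq_pred k R I)).
exact: tt.
Qed.
End FiniteQuotients.

Lemma bimod_hom_fdim (k : fieldType) (A : pzAlgType k) (U V : bimodType A) :
  fdim (bimod_k U) -> fdim (bimod_k V) -> fdim (bimod_hom U V).
Proof.
move=> [T [g gP]] fV.
have evL : linear (fun f : bimod_hom U V => [ffun i => val f (g i)] : {ffun T -> bimod_k V}).
  by move=> c f h; apply/ffunP => i; rewrite !ffunE.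
apply: (fdim_inj (f := linmap evL)); last exact: fdim_ffun.
move=> f h /ffunP fh; apply: val_inj; apply/funext => u.
have [c ->] := gP u.
have homL (f0 : bimod_hom U V) : val f0 (\sum_i c i *: g i : bimod_k U)
    = \sum_i c i *: val f0 (g i).
  have /asboolP[fD fl _] := valP f0.
  have f00 : val f0 0 = 0 by apply: (addIr (val f0 0)); rewrite -fD !add0r.
  rewrite (big_morph (val f0) fD f00); apply: eq_bigr => i _.
  exact: fl.
rewrite !homL; apply: eq_bigr => i _; congr (_ *: _).
by have := fh i; rewrite !ffunE.
Qed.

Section Transfer.
Variables (k : fieldType) (R : pzAlgType k) (I : ideal R).
Local Notation L := (quotalg I).
Hypothesis fd : fdim (restr (L^o : lmodType L)).

Lemma regenv_algin c (m : regenv L) : (algin c : envalg L) *: m = algin c * (m : L).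
Proof. by rewrite -(lmul_algin (envalg_basis L)) /lmul regenv_act mulr1. Qed.

Lemma regenv_fdim : fdim (restr (regenv L)).
Proof.
have idL : linear (fun x : restr (L^o : lmodType L) => x : restr (regenv L)).
  move=> c x y; congr (_ + _); exact/esym/regenv_algin.
by apply: (fdim_surj (f := linmap idL)) fd => x; exists x.
Qed.

Lemma quot_bimod_fdim : fdim (bimod_k (quot_bimod I)).
Proof.
have idL : linear (fun x : restr (L^o : lmodType L) => x : bimod_k (quot_bimod I)).
  by move=> c x y.
by apply: (fdim_surj (f := linmap idL)) fd => x; exists x.
Qed.

Lemma linear_section : exists s : L -> R, [/\ forall x, qproj I (s x) = x,
  {morph s : x y / x + y} & forall c x, s (algin c * x) = algin c * s x].
Proof.
have pL : linear (fun x : restr (R^o : lmodType R) => qproj I x : restr (L^o : lmodType L)).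
  move=> c x y; rewrite (raddfD (qproj I)); congr (_ + _).
  exact: (rmorphM (qproj I)).
have [|s sK] := @fdim_section _ _ _ (linmap pL) _ fd.
  by move=> x; exists (qrepr x); exact: (qreprK x).
exists s; split=> [x|x y|c x]; first exact: (sK x).
  exact: (linearD s).
exact: (linearZ_LR s).
Qed.
End Transfer.

Theorem corollary4p9 (k : fieldType) (Q : quiver) (I : ideal (pathalg k Q))
    (hI : admissible I) :
  tau_rigid (regenv (quotalg I)) <->
    (forall x : HH (quotalg I) 1, x = 0)
    /\ eq_dim (HH (quotalg I) 2) (bimod_hom (ideal_mod_sq I) (quot_bimod I)).
Proof.
have [n _ [powI I2]] := hI.
have basis := pathalg_basis k Q.
have longI (p : qpath Q) : (n <= psize p)%N -> ps_elt k p \in (I : {pred pathalg k Q}).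
  move=> np; apply: powI; apply: (long_path_pow basis) np => a.
  by apply/asboolP => J; apply; exists a.
have shortI x : x \in (I : {pred pathalg k Q}) ->
    forall p : qpath Q, (psize p < 2)%N -> x@_p = 0.
  by move=> /I2/level_pow/asboolP.
have fdL := quotalg_fdim basis longI.
have [s [sK sD sZ]] := linear_section fdL.
have env := envalg_basis (quotalg I).
have repK : cancel (fun x : quotalg I => qrepr x) (qproj I) := @qreprK _ _.
have pi_ker x : qproj I x = 0 <-> x \in (I : {pred pathalg k Q}) := qpi0 I x.
have actE (x y z : quotalg I) :
    (tensor_pure x (y : (quotalg I)^c) : envalg (quotalg I)) *: (z : regenv (quotalg I))
    = x * z * y :> quotalg I.
  by rewrite -mulrA; exact: regenv_act.
have fdHom := bimod_hom_fdim (ideal_mod_sq_fdim basis longI) (quot_bimod_fdim fdL).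
rewrite (tau_rigid_factors basis longI shortI repK pi_ker (fun=> erefl) env
  (iota := fun x : quotalg I => x : regenv (quotalg I)) (jota := fun x => x)
  (fun x y => erefl) (fun x => erefl) (fun x => erefl) actE (regenv_fdim fdL)).
apply: (factors_Ext basis repK pi_ker (fun=> erefl) env
  (iota := fun x : quotalg I => x : regenv (quotalg I)) (jota := fun x => x)
  (fun x y => erefl) (fun x => erefl) (fun x => erefl) actE sK sD sZ
  (kap := fun x : quot_bimod I => x : regenv (quotalg I)) (kap' := fun x => x)
  (fun x y => erefl) (fun x => erefl) (fun x => erefl)) => // r x.
  by rewrite /lmul actE mulr1.
by rewrite /rmul actE mul1r.
Qed.
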